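(* Let $\Sigma^2$ be a closed connected surface and let $F:\Sigma^2\to\mathbb{R}^4\simeq\mathbb{C}^2$ be a Lagrangian self-shrinker which is symmetric with respect to a hyperplane $P\subset\mathbb{R}^4$. Then, up to a unitary transformation of $\mathbb{C}^2$, $\Sigma^2$ is given by the product of two Abresch-Langer curves; that is, there exist $G\in U(2)$ and Abresch-Langer curves $\Gamma_1,\Gamma_2\subset\mathbb{C}$ such that $G(F(\Sigma^2))=\Gamma_1\times\Gamma_2\subset\mathbb{C}\times\mathbb{C}=\mathbb{C}^2$.
   Context: Closed means compact without boundary; everything is smooth. $\mathbb{R}^4$ is identified with $\mathbb{C}^2$ via $(x_1,x_2,x_3,x_4)\leftrightarrow(x_1+ix_2,\,x_3+ix_4)$, with the standard Euclidean inner product and K\''ahler form $\omega=dx_1\wedge dx_2+dx_3\wedge dx_4$. A self-shrinker is an immersion $F:M^n\to\mathbb{R}^{n+k}$ satisfying $\vec{H}=-F^{\perp}$, where $\vec{H}$ is the mean curvature vector (the trace of the second fundamental form) and $F^\perp$ is the projection of the position vector onto the normal bundle of $M$. A Lagrangian self-shrinker in $\mathbb{R}^4$ is an immersed surface $F:\Sigma^2\to\mathbb{R}^4$ that is a self-shrinker and satisfies $F^*\omega=0$. The immersed surface $F:\Sigma^2\to\mathbb{R}^4$ is symmetric with respect to an (affine) hyperplane $P$ if its image $F(\Sigma^2)$ is invariant under the orthogonal reflection of $\mathbb{R}^4$ across $P$. An Abresch-Langer curve is a closed immersed self-shrinking planar curve, i.e. (the image of) a closed immersed curve $\gamma:S^1\to\mathbb{R}^2\simeq\mathbb{C}$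 whose curvature vector satisfies $\vec{\kappa}=-\gamma^\perp$; the unit circle centered at the origin is included. *)

(* Defs.v *)
From HB Require Import structures.
From mathcomp Require Import all_boot all_order all_algebra.
From mathcomp Require Import all_classical all_reals all_analysis.
From mathcomp Require Import spectral complex.

Set Implicit Arguments.
Unset Strict Implicit.
Unset Printing Implicit Defensive.

Import Order.TTheory GRing.Theory Num.Theory.
Import numFieldNormedType.Exports.

Local Open Scope classical_set_scope.
Local Open Scope ring_scope.

Section Smoothness.
Context (R : realType) (V W : normedModType R).

(* Only meant for an open U.  Continuity of the differential is not assumed
   separately: it is the continuity of the directional derivatives, which
   Ck_on k imposes on every 'D_v f. *)
Fixpoint Ck_on (k : nat) (U : set V) (f : V -> W) : Prop :=
  if k is k'.+1 then
    (forall x, U x -> differentiable f x) /\ (forall v, Ck_on k' U ('D_v f))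
  else forall x, U x -> {for x, continuous f}.

Definition smooth_on (U : set V) (f : V -> W) : Prop := forall k, Ck_on k U f.

End Smoothness.

Section Manifolds.
Context (R : realType) (n : nat) (S : topologicalType).

(* The two maps are total functions whose values matter only on chart_dom and
   chart_cod, between which they are mutually inverse homeomorphisms. *)
Record chart := Chart {
  chart_dom : set S;
  chart_cod : set 'rV[R]_n;
  chart_map : S -> 'rV[R]_n;
  chart_inv : 'rV[R]_n -> S;
  chart_dom_open : open chart_dom;
  chart_cod_open : open chart_cod;
  chart_map_cod : forall s, chart_dom s -> chart_cod (chart_map s);
  chart_inv_dom : forall x, chart_cod x -> chart_dom (chart_inv x);
  chart_mapK : forall s, chart_dom s -> chart_inv (chart_map s) = s;
  chart_invK : forall x, chart_cod x -> chart_map (chart_inv x) = x;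
  chart_map_continuous : forall s, chart_dom s -> {for s, continuous chart_map};
  chart_inv_continuous : forall x, chart_cod x -> {for x, continuous chart_inv}
}.

Definition smooth_atlas (A : set chart) : Prop :=
  (forall s, exists2 c, A c & chart_dom c s) /\
  (forall c d, A c -> A d ->
     smooth_on (chart_cod c `&` chart_inv c @^-1` chart_dom d)
               (chart_map d \o chart_inv c)).

(* Second countability is automatic for a compact space covered by charts. *)
Definition closed_connected_manifold (A : set chart) : Prop :=
  [/\ smooth_atlas A, hausdorff_space S, compact [set: S],
      connected [set: S] & [set: S] !=set0].

End Manifolds.

Section LocalGeometry.
Context (R : realType) (m n : nat).
Implicit Types (f : 'rV[R]_m -> 'rV[R]_n) (U : set 'rV[R]_m) (x : 'rV[R]_m).

Definition immersion_on U f : Prop :=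
  smooth_on U f /\ forall x, U x -> injective ('d f x).

(* The rows of 'J f x are the partial derivatives of f at x, so its row space
   is the tangent space and kermx ('J f x)^T is the orthogonal complement. *)
Definition normal_part f x (v : 'rV[R]_n) : 'rV[R]_n :=
  v *m proj_mx (kermx ('J f x)^T) <<'J f x>>%MS.

Definition first_fundamental_form f x : 'M[R]_m := 'J f x *m ('J f x)^T.

Definition second_fundamental_form f x (i j : 'I_m) : 'rV[R]_n :=
  normal_part f x ('D_(delta_mx 0 i) ('D_(delta_mx 0 j) f) x).

Definition mean_curvature f x : 'rV[R]_n :=
  \sum_(i < m) \sum_(j < m)
    invmx (first_fundamental_form f x) i j *: second_fundamental_form f x i j.

Definition self_shrinker_on U f : Prop :=
  immersion_on U f /\
  forall x, U x -> mean_curvature f x = - normal_part f x (f x).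

End LocalGeometry.

Definition self_shrinker (R : realType) (m n : nat) (S : topologicalType)
    (A : set (chart R m S)) (F : S -> 'rV[R]_n) : Prop :=
  forall c, A c -> self_shrinker_on (chart_cod c) (F \o chart_inv c).

Section FourSpace.
Context (R : realType).

Definition kahler_form (u v : 'rV[R]_4) : R :=
  (u 0 0 * v 0 1 - u 0 1 * v 0 0) + (u 0 2 * v 0 3 - u 0 3 * v 0 2).

Definition lagrangian (m : nat) (S : topologicalType)
    (A : set (chart R m S)) (F : S -> 'rV[R]_4) : Prop :=
  forall c, A c -> forall x, chart_cod c x -> forall v w : 'rV[R]_m,
    kahler_form ('d (F \o chart_inv c) x v) ('d (F \o chart_inv c) x w) = 0.

Definition C2_of_R4 (x : 'rV[R]_4) : 'cV[R[i]]_2 :=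
  \col_(k < 2) (if k == 0 then Complex (x 0 0) (x 0 1)
                else Complex (x 0 2) (x 0 3)).

Definition C_of_R2 (x : 'rV[R]_2) : R[i] := Complex (x 0 0) (x 0 1).

Definition cprod (G1 G2 : set R[i]) : set 'cV[R[i]]_2 :=
  [set z | G1 (z 0 0) /\ G2 (z 1 0)].

End FourSpace.

Section Hyperplanes.
Context (R : realType) (n : nat).

Definition dotv (u v : 'rV[R]_n) : R := \sum_(i < n) u 0 i * v 0 i.

Definition hyperplane (nu : 'rV[R]_n) (a : R) : set 'rV[R]_n :=
  [set x | dotv x nu = a].

Definition reflection (nu : 'rV[R]_n) (a : R) (x : 'rV[R]_n) : 'rV[R]_n :=
  x - (2 * (dotv x nu - a) / dotv nu nu) *: nu.

Definition symmetric_wrt_hyperplane (P X : set 'rV[R]_n) : Prop :=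
  exists (nu : 'rV[R]_n) (a : R),
    [/\ nu != 0, P = hyperplane nu a & reflection nu a @` X = X].

End Hyperplanes.

(* S^1 is R/Z: closed curves are 1-periodic maps on R.  The curvature vector of
   a plane curve is its mean curvature vector as an immersion R^1 -> R^2. *)
Definition abresch_langer_curve (R : realType) (Gamma : set R[i]) : Prop :=
  exists gamma : R -> 'rV[R]_2,
    [/\ forall t, gamma (t + 1) = gamma t,
        self_shrinker_on [set: 'rV[R]_1] (fun t => gamma (t 0 0)) &
        Gamma = (@C_of_R2 R \o gamma) @` [set: R]].

(* Main.v *)
(* Let sigma be the reflection and F the immersion.  Since sigma(F(S)) = F(S),
   every vector of a reflected tangent plane is, by compactness, tangent to F(S)
   at some preimage of the reflected point; preimages are isolated, so two of
   the vectors u + k v share a preimage and the reflected plane is Lagrangian.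
   Hence each tangent plane is isotropic for both omega and sigma^* omega.  In a
   unitary frame whose last vector is the normal n of the hyperplane this says
   that both complex coordinates F1, F2 of F have rank one: the tangent plane is
   a product of two lines (the hyperplane need not pass through the origin).

   The self-shrinker equation then says that F1 and F2 run along solutions of
   gamma'' = - gamma^perp, |gamma'| = 1.  By connectedness F1 stays on the
   trajectory of one solution z, and by compactness on the image of a bounded
   time interval; likewise F2 on that of a solution w.  Conversely the pairs of
   times (t, u) with (z(t), w(u)) in F(S) form an open set, uniformly so by
   compactness, and therefore all of R^2.  So F(S) is the product of the two
   trajectories.  A time outside the bounded interval repeats a position up to
   the sign of the velocity; opposite velocities would make the solution stop by
   reversibility, so z is periodic, hence an Abresch-Langer curve. *)

Require Import Defs.
From mathcomp Require Import all_boot all_order all_algebra.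
From mathcomp Require Import all_classical all_reals all_analysis.
From mathcomp Require Import spectral complex ring lra.

Set Implicit Arguments.
Unset Strict Implicit.
Unset Printing Implicit Defensive.

Import Order.TTheory GRing.Theory Num.Theory.
Import numFieldNormedType.Exports.

Local Open Scope classical_set_scope.
Local Open Scope ring_scope.

(** * Picard iteration and uniqueness for Lipschitz fields *)

(** In the unitary frame [m], [i m], [n], [i n] the form omega is the sum of the area forms of two
    complex lines, and the reflection changes only the sign of the second one; the sum and the
    difference of the two vanishing conditions give rank one for each complex coordinate. The curve
    traced by a rank one map is not known beforehand, and its tangent line carries no orientation.
    Each factor is therefore compared with a solution in phase space, with velocity taken up to
    sign: along a segment in a chart the factor obeys the same equation with an extra scalar speed,
    and uniqueness keeps it on the trajectory. The shrinker equation controls the curvature of a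
    single factor because differentiating the rank one relation makes the normal Hessian of that
    factor a multiple of the square of one linear form. That the pairs of times form an open set is
    seen by minimising the distance to a target point over a small ball of a chart: near the
    surface, a critical point of this distance is an exact hit. Truncation makes the equation
    globally Lipschitz; the bound of F on the compact surface makes the truncation invisible. *)

Lemma is_derive_continuous (R : realType) (f : R -> R) (x df : R) :
  is_derive x 1 f df -> {for x, continuous f}.
Proof. by case=> d _; apply/differentiable_continuous/derivable1_diffP. Qed.

Lemma continuous_antiderivative (R : realType) (g : R -> R) :
  continuous g -> exists2 G : R -> R, G 0 = 0 & forall t : R, is_derive t 1 G (g t).
Proof.
move=> cg.
have ig (a b : R) : lebesgue_measure.-integrable `[a, b] (EFin \o g).
  by apply: continuous_compact_integrable; [exact: segment_compact|exact: continuous_subspaceT].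
pose H (a x : R) := \int[lebesgue_measure]_(t in `[a, x]) g t.
have dH (a x : R) : a < x -> is_derive x 1 (H a) (g x).
  move=> ax; have xu : x < x + 1 by rewrite ltrDl.
  have [d e] := @continuous_FTC1_closed R g a x (x + 1) xu (ig _ _) ax (cg x).
  by split=> //; rewrite -derive1E.
have HB (a b x : R) : a <= b -> b <= x -> H a x - H a b = H b x.
  move=> ab bx; rewrite /H.
  rewrite (@Rintegral_itvB R g (BLeft a) (BRight x) b) ?bnd_simp //.
  rewrite Rintegral_itv_obnd_cbnd //.
  by apply: integrableS (ig b x) => //; apply: subset_itvr; rewrite bnd_simp.
pose G x := if 0 <= x then H 0 x else - H x 0.
have GE (a x : R) : a <= 0 -> a <= x -> G x = H a x - H a 0.
  move=> a0 ax; rewrite /G; case: (leP 0 x) => x0; first by rewrite HB.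
  by rewrite -(HB a x 0) ?(ltW x0)// opprB.
exists G.
  by rewrite (GE 0 0) // subrr.
(* The fundamental theorem of calculus differentiates only to the right of the base point, so a base
   point below both 0 and [t] is used; there [G] differs from [H a] by a constant. *)
move=> t; pose a := Num.min 0 t - 1.
have a0 : a < 0 by rewrite ltrBlDr add0r gt_min ltr01.
have at' : a < t by rewrite ltrBlDr gt_min ltrDl ltr01 orbT.
apply: (@near_eq_is_derive _ _ _ (fun x => H a x - H a 0)).
  near=> x; rewrite (GE a x) ?(ltW a0) //; apply: ltW.
  by near: x; exact: lt_nbhsr.
have -> : g t = g t - 0 by rewrite subr0.
apply: is_deriveB; exact: dH.
Unshelve. all: by end_near. Qed.

(* [exp (b t)] serves as the weight of the norm in which the Picard operator is
   a contraction. *)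
Lemma norm_le_expR (R : realType) (d d' : R -> R) (C b T : R) :
  0 <= T -> 0 <= C -> {within `[0, T], continuous d} ->
  (forall t, t \in `]0, T[ -> is_derive t 1 d (d' t)) ->
  (forall t, t \in `]0, T[ -> `|d' t| <= C * b * expR (b * t)) ->
  d 0 = 0 -> `|d T| <= C * expR (b * T).
Proof.
move=> T0 C0 cd dd bd d0.
pose E t : R := C * expR (b * t).
have dE (t : R) : is_derive t 1 E (C * b * expR (b * t)).
  rewrite /E; apply: is_derive_eq.
  by rewrite /GRing.scale /= ; ring.
have cE : {within `[0, T], continuous E}.
  by apply: continuous_subspaceT => t; apply: is_derive_continuous (dE t).
(* For [s] equal to 1 or -1, [E - s d] is nondecreasing, since [E'] is exactly the bound on [|d'|],
   and it starts at [E 0 >= 0]. *)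
have key (s : R) : `|s| <= 1 -> s * d T <= E T.
  move=> s1; have : (E \- (s \*o d)) 0 <= (E \- (s \*o d)) T.
    have dD (t : R) : t \in `]0, T[ ->
        is_derive t 1 (E \- (s \*o d)) (C * b * expR (b * t) - s * d' t).
      by move=> tT; have h := dd t tT; apply: is_deriveB.
    apply: (@ger0_derive1_le_cc R (E \- (s \*o d)) 0 T).
    - by move=> t /dD [].
    - move=> t tT; have [_] := dD t tT; rewrite derive1E => ->.
      rewrite subr_ge0 (le_trans (ler_norm _))// normrM.
      by rewrite (le_trans _ (bd t tT))// ler_piMl.
    - by move=> t; apply: cvgB; [exact: cE|apply: cvgMr; exact: cd].
    - by rewrite in_itv /= lexx.
    - by rewrite in_itv /= lexx T0.
    - exact: T0.
  rewrite /= d0 mulr0 subr0 => h.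
  have E0 : 0 <= E 0 by rewrite mulr_ge0 ?expR_ge0.
  by rewrite -subr_ge0 (le_trans E0).
rewrite ler_norml; apply/andP; split.
  by rewrite lerNl -mulN1r; apply: key; rewrite normrN1.
by rewrite -[d T]mul1r; apply: key; rewrite normr1.
Qed.

Lemma norm_le_expR_abs (R : realType) (d d' : R -> R) (C b : R) :
  0 <= C -> (forall t : R, is_derive t 1 d (d' t)) ->
  (forall t, `|d' t| <= C * b * expR (b * `|t|)) ->
  d 0 = 0 -> forall t, `|d t| <= C * expR (b * `|t|).
Proof.
move=> C0 dd bd d0 t.
wlog t0 : d d' t dd bd d0 / 0 <= t => [hw|].
  case: (leP 0 t) => t0; first exact: hw.
  pose D x := d (- x).
  have dD (x : R) : is_derive x 1 D (- d' (- x)).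
    have h1 : is_derive x 1 (@GRing.opp R) (-1) by apply: is_deriveNid.
    rewrite -mulrN1; exact: (@is_derive1_comp R d (@GRing.opp R) x (d' (- x)) (-1) (dd (- x)) h1).
  have := hw D _ (- t) dD; rewrite /D opprK normrN; apply; rewrite ?oppr0 //.
  - by move=> x; rewrite normrN -(normrN x); exact: bd.
  - by rewrite oppr_ge0 ltW.
rewrite (ger0_norm t0); apply: (@norm_le_expR R d d' C b t) => //.
- by apply: continuous_subspaceT => x; apply: is_derive_continuous (dd x).
- move=> x; rewrite in_itv => /andP[/= x0 _]; have := bd x; by rewrite (gtr0_norm x0).
Qed.

Lemma le0_of_le_div2n (R : realType) (x K : R) :
  (forall k : nat, x <= K / 2 ^+ k) -> x <= 0.
Proof.
move=> h; rewrite leNgt; apply/negP => x0.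
have K0 : 0 < K by have := h 0%N; rewrite expr0 divr1; exact: lt_le_trans.
have [k hk] : exists k : nat, K / x < k%:R.
  by exists (Num.bound (K / x)); exact: archi_boundP (ltW (divr_gt0 K0 x0)).
have h2 := h k; rewrite ler_pdivlMr ?exprn_gt0// in h2.
have k2 : (k%:R : R) <= 2 ^+ k by rewrite -natrX ler_nat ltnW // ltn_expl.
have := lt_le_trans hk k2; rewrite ltr_pdivrMr // mulrC => /lt_le_trans /(_ h2).
by rewrite ltxx.
Qed.

(** The intervals of radius [e k = 2 * K / 2 ^+ k] around [u k] are nested, because [e k - e k.+1]
    is exactly the allowed step; the limit is the supremum of their left ends. *)
Lemma geometric_limit (R : realType) (u : nat -> R) (K : R) :
  (forall k, `|u k.+1 - u k| <= K / 2 ^+ k) ->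
  exists l, forall k, `|u k - l| <= 2 * K / 2 ^+ k.
Proof.
move=> hu; pose e k : R := 2 * K / 2 ^+ k.
have eS k : e k - e k.+1 = K / 2 ^+ k.
  by rewrite /e exprS; field; rewrite expf_neq0.
have K0 : 0 <= K by have := hu 0%N; rewrite expr0 divr1; exact: le_trans.
have e0 k : 0 <= e k by rewrite /e !mulr_ge0 ?invr_ge0 ?exprn_ge0.
have up k j : u k - e k <= u (k + j)%N - e (k + j)%N.
  elim: j => [|j IH]; first by rewrite addn0.
  rewrite (le_trans IH)// addnS; have := hu (k + j)%N.
  by rewrite -eS ler_norml => /andP[h1 _]; lra.
have dn k j : u (k + j)%N + e (k + j)%N <= u k + e k.
  elim: j => [|j IH]; first by rewrite addn0.
  rewrite (le_trans _ IH)// addnS; have := hu (k + j)%N.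
  by rewrite -eS ler_norml => /andP[_ h1]; lra.
have ab k j : u k - e k <= u j + e j.
  have h1 := up k j; have h2 := dn j k; rewrite addnC in h2.
  have h3 := e0 (k + j)%N; lra.
pose A := [set u k - e k | k in [set: nat]].
have A0 : A !=set0 by exists (u 0%N - e 0%N); exists 0%N.
exists (sup A) => k; rewrite ler_norml; apply/andP; split.
  rewrite -/(e k) lerBrDr addrC lerBlDr; apply: ge_sup => //.
  by move=> _ [j _ <-].
rewrite -/(e k). rewrite lerBlDr -lerBlDl; apply: (ub_le_sup (E := A)); last by exists k.
by exists (u 0%N + e 0%N) => _ [j _ <-].
Qed.

Lemma lipschitz_of_derive (R : realType) (f f' : R -> R) (B : R) :
  (forall t : R, is_derive t 1 f (f' t)) -> (forall t, `|f' t| <= B) ->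
  forall t u, `|f t - f u| <= B * `|t - u|.
Proof.
move=> df bf t u; wlog ut : t u / u <= t => [hw|].
  by case: (leP u t) => [/hw//|/ltW/hw]; rewrite distrC (distrC u).
have [|c _ ->] := @MVT_segment R f f' u t ut (fun x _ => df x).
  by apply: continuous_subspaceT => x; apply: is_derive_continuous (df x).
by rewrite normrM ler_wpM2r.
Qed.

Section Picard.
Context (R : realType) (I : Type) (V : (I -> R) -> I -> R) (L B : R).
Hypothesis L_gt0 : 0 < L.
Hypothesis V_lipschitz : forall (x y : I -> R) (d : R), (forall i, `|x i - y i| <= d) ->
  forall i, `|V x i - V y i| <= L * d.
Hypothesis V_bounded : forall x i, `|V x i| <= B.

Lemma field_along_lipschitz_continuous (z : I -> R -> R) :
  (forall i t u, `|z i t - z i u| <= B * `|t - u|) ->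
  forall i, continuous (fun t => V (z^~ t) i).
Proof.
move=> zB i t; apply/cvgrPdist_le => e e0.
have B0 : 0 <= B by apply: le_trans (V_bounded (z^~ 0) i).
have d0 : 0 < e / (L * B + 1) by rewrite divr_gt0// ltr_wpDl // mulr_ge0 // ltW.
near=> u; have := V_lipschitz (fun j => zB j t u) i => h.
apply: le_trans h _.
have : `|t - u| <= e / (L * B + 1).
  near: u; apply: (@cvgr_dist_le _ _ _ _ _ id t) => //; exact: cvg_id.
rewrite ler_pdivlMr; last by rewrite ltr_wpDl // mulr_ge0 // ltW.
move=> h2.
by apply: le_trans h2; rewrite mulrDr mulr1 mulrA mulrC lerDl.
Unshelve. all: by end_near. Qed.

Lemma picard (x0 : I -> R) : exists z : I -> R -> R,
  (forall i, z i 0 = x0 i) /\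
  forall i (t : R), is_derive t 1 (z i) (V (z^~ t) i).
Proof.
(* One primitive operator is chosen for all functions at once, with a dummy value on discontinuous
   ones. Every iterate below is [B]-Lipschitz, so the field is continuous along it. *)
have [Prim PrimP] : {Prim : (R -> R) -> R -> R & forall g, continuous g ->
    Prim g 0 = 0 /\ forall t : R, is_derive t 1 (Prim g) (g t)}.
  apply: (choice (P := fun (g G : R -> R) => continuous g ->
    G 0 = 0 /\ forall t : R, is_derive t 1 G (g t))) => g; have [cg|ncg] := pselect (continuous g).
    by have [G G0 dG] := continuous_antiderivative cg; exists G.
  by exists (cst 0).
pose step (z : I -> R -> R) i t := x0 i + Prim (fun u => V (z^~ u) i) t.
have stepP z : (forall i t u, `|z i t - z i u| <= B * `|t - u|) ->
    forall i, step z i 0 = x0 i /\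
      forall t : R, is_derive t 1 (step z i) (V (z^~ t) i).
  move=> zB i; have [h0 hd] := PrimP _ (@field_along_lipschitz_continuous z zB i).
  split; first by rewrite /step h0 addr0.
  move=> t; rewrite -[V _ i]add0r; apply: is_deriveD.
have stepB z : (forall i t u, `|z i t - z i u| <= B * `|t - u|) ->
    forall i t u, `|step z i t - step z i u| <= B * `|t - u|.
  move=> zB i; have [_ hd] := stepP z zB i.
  exact: lipschitz_of_derive hd (fun t => V_bounded _ _).
pose zs k := iter k step (fun i _ => x0 i).
have zsB k : forall i t u, `|zs k i t - zs k i u| <= B * `|t - u|.
  elim: k => [|k IH] /=; last exact: stepB.
  by move=> i t u; rewrite subrr normr0 mulr_ge0// (le_trans _ (V_bounded x0 i)).
(* With the weight [expR (b * |t|)], integrating the Lipschitz bound gives the contraction factor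
   [L / b = 1/2]; [C = B / b] is what the first Picard step, of speed at most [B], requires. *)
pose b := 2 * L.
have b0 : 0 < b by rewrite mulr_gt0.
pose C := B / b.
have C0 (i : I) : 0 <= C by rewrite divr_ge0 ?(ltW b0)// (le_trans _ (V_bounded x0 i)).
have e1 (t : R) : 1 <= expR (b * `|t|).
  by rewrite -expR0 ler_expR mulr_ge0// ltW.
have zsC k i t : `|zs k.+1 i t - zs k i t| <= C / 2 ^+ k * expR (b * `|t|).
  elim: k i t => [|k IH] i t.
    have [h0 hd] := stepP _ (zsB 0%N) i.
    rewrite expr0 divr1; apply: (@norm_le_expR_abs R (fun t => zs 1%N i t - x0 i) (fun t => V x0 i)) => //.
    - exact: C0 i.
    - move=> u; rewrite -[V x0 i]subr0; apply: is_deriveB.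
    - move=> u; rewrite /C divfK ?gt_eqF// (le_trans (V_bounded _ _))//.
      by rewrite ler_peMr ?e1// (le_trans _ (V_bounded x0 i)).
    - by rewrite [zs 1%N i 0]h0 subrr.
  have [h0 hd] := stepP _ (zsB k) i; have [h0' hd'] := stepP _ (zsB k.+1) i.
  apply: (@norm_le_expR_abs R (fun t => zs k.+2 i t - zs k.+1 i t)
     (fun t => V ((zs k.+1)^~ t) i - V ((zs k)^~ t) i)) => //.
  - by rewrite divr_ge0 ?exprn_ge0 ?(C0 i).
  - move=> u; have h := V_lipschitz (fun j => IH j u) i.
    rewrite (le_trans h)// le_eqVlt; apply/orP; left; apply/eqP.
    by rewrite /b exprS; field; rewrite expf_neq0.
  - by rewrite [zs k.+2 i 0]h0' [zs k.+1 i 0]h0 subrr.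
have [z zP] : {z : I -> R -> R & forall i t k,
    `|zs k i t - z i t| <= 2 * (C * expR (b * `|t|)) / 2 ^+ k}.
  apply: (choice (P := fun i (zi : R -> R) => forall t k,
    `|zs k i t - zi t| <= 2 * (C * expR (b * `|t|)) / 2 ^+ k)) => i.
  suff [zi ziP] : {zi : R -> R & forall t k,
    `|zs k i t - zi t| <= 2 * (C * expR (b * `|t|)) / 2 ^+ k} by exists zi.
  apply: (choice (P := fun t l => forall k,
    `|zs k i t - l| <= 2 * (C * expR (b * `|t|)) / 2 ^+ k)) => t.
  have [|l hl] := @geometric_limit R (fun k => zs k i t) (C * expR (b * `|t|)).
    by move=> k; rewrite mulrAC; exact: zsC.
  by exists l.
have zB i t u : `|z i t - z i u| <= B * `|t - u|.
  rewrite -subr_le0; apply: (@le0_of_le_div2n _ _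
    (2 * (C * expR (b * `|t|)) + 2 * (C * expR (b * `|u|)))) => k.
  rewrite mulrDl; have := zP i t k; have := zP i u k; have := zsB k i t u.
  have -> : z i t - z i u = - (zs k i t - z i t) + (zs k i t - zs k i u) + (zs k i u - z i u).
    by ring.
  move=> h1 h2 h3; rewrite lerBlDr (le_trans (ler_normD _ _))//.
  rewrite (le_trans (lerD (ler_normD _ _) (lexx _)))// normrN; clear -h1 h2 h3; lra.
(* A fixed point of [step] inherits its initial value and its derivative from [stepP], so the
   uniform limit never has to be differentiated. *)
suff zE i : z i = step z i.
  exists z; split=> i; rewrite ?zE; have [h0 hd] := stepP z zB i.
    exact: h0.
  exact: hd.
apply/funext => t; apply/eqP; rewrite -subr_eq0 -normr_le0.
apply: (@le0_of_le_div2n _ _ (2 * (C * expR (b * `|t|)))) => k.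
have [h0 hd] := stepP _ zB i; have [h0' hd'] := stepP _ (zsB k) i.
have h : `|step z i t - zs k.+1 i t| <= C / 2 ^+ k * expR (b * `|t|).
  apply: (@norm_le_expR_abs R (fun t => step z i t - zs k.+1 i t)
     (fun t => V (z^~ t) i - V ((zs k)^~ t) i)) => //.
  - by rewrite divr_ge0 ?exprn_ge0 ?(C0 i).
  - move=> u; have h := V_lipschitz (fun j => zP j u k) i.
    rewrite distrC (le_trans h)// le_eqVlt; apply/orP; left; apply/eqP.
    by rewrite /b; ring.
  - by rewrite h0 [zs k.+1 i 0]h0' subrr.
have h2 := zP i t k.+1.
have -> : z i t - step z i t = - (zs k.+1 i t - z i t) - (step z i t - zs k.+1 i t).
  by ring.
rewrite (le_trans (ler_normB _ _))// normrN (le_trans (lerD h2 h))//.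
rewrite le_eqVlt; apply/orP; left; apply/eqP.
by rewrite exprS; field; rewrite expf_neq0.
Qed.

(** Both curves follow the field at the same varying speed [lam], which may vanish or change sign.
    Their distance is bounded by [C / 2 ^+ k] times an exponential weight for every [k]: boundedness
    of [V] starts the induction, and each integration of the Lipschitz bound halves the constant. *)
Lemma reparametrised_unique (z w : I -> R -> R) (lam : R -> R) (Lam T : R) :
  0 < Lam -> (forall t, `|lam t| <= Lam) ->
  (forall i, {within `[0, T], continuous (z i)}) ->
  (forall i, {within `[0, T], continuous (w i)}) ->
  (forall i t, t \in `]0, T[ -> is_derive t 1 (z i) (lam t * V (z^~ t) i)) ->
  (forall i t, t \in `]0, T[ -> is_derive t 1 (w i) (lam t * V (w^~ t) i)) ->
  (forall i, z i 0 = w i 0) ->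
  forall t, t \in `[0, T] -> forall i, z i t = w i t.
Proof.
move=> Lam0 hlam cz cw dz dw zw0 t tT i.
pose b := 2 * (Lam * L).
have b0 : 0 < b by rewrite !mulr_gt0.
pose C := B / L.
have B0 : 0 <= B by apply: le_trans (V_bounded (z^~ 0) i).
have C0 : 0 <= C by rewrite divr_ge0 // ltW.
have Ck k : 0 <= C / 2 ^+ k by apply: divr_ge0 => //; exact: exprn_ge0.
suff key k u j : u \in `[0, T] -> `|z j u - w j u| <= C / 2 ^+ k * expR (b * u).
  apply/eqP; rewrite -subr_eq0 -normr_le0.
  apply: (@le0_of_le_div2n _ _ (C * expR (b * t))) => k.
  by rewrite mulrAC; exact: key.
elim: k u j => [|k IH] u j uT.
all: have uT' := uT; move: uT'; rewrite in_itv /= => /andP[u0 u1].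
all: have sub : `[0, u] `<=` `[0, T] by apply: subset_itvl; rewrite bnd_simp.
all: have sub' x : x \in `]0, u[ -> x \in `]0, T[
  by rewrite !in_itv /= => /andP[-> /lt_le_trans]; exact.
all: apply: (@norm_le_expR R (z j \- w j) (fun t => lam t * (V (z^~ t) j - V (w^~ t) j))) => //.
all: try by move=> x; apply: cvgB; [exact: (continuous_subspaceW sub (cz j))|exact: (continuous_subspaceW sub (cw j))].
all: try by move=> x /sub' xT; rewrite mulrBr; apply: is_deriveB; [exact: dz|exact: dw].
all: try by rewrite /= zw0 subrr.
- move=> x /[dup] /sub' xT; rewrite in_itv /= => /andP[x0 _].
  have e1 : 1 <= expR (b * x) by rewrite -expR0 ler_expR mulr_ge0// ltW.
  have := ler_normB (V (z^~ x) j) (V (w^~ x) j).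
  have := V_bounded (z^~ x) j; have := V_bounded (w^~ x) j => h1 h2 h3.
  have h4 : `|V (z^~ x) j - V (w^~ x) j| <= 2 * B by clear -h1 h2 h3; lra.
  rewrite normrM expr0 divr1 (le_trans (ler_pM _ _ (hlam x) h4))//.
  have -> : C * b * expR (b * x) = Lam * (2 * B) * expR (b * x).
    by rewrite /C /b; field; rewrite gt_eqF.
  by rewrite ler_peMr// !mulr_ge0// ltW.
- move=> x /[dup] /sub' xT; rewrite in_itv /= => /andP[x0 xu].
  have xT' : x \in `[0, T] by rewrite in_itv /= (ltW x0) (le_trans (ltW xu)).
  have h := V_lipschitz (fun i => IH x i xT') j.
  rewrite normrM (le_trans (ler_pM _ _ (hlam x) h))//.
  rewrite le_eqVlt; apply/orP; left; apply/eqP.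
  by rewrite /b exprS; field; rewrite expf_neq0.
Qed.

End Picard.

(** * Symmetry of second derivatives *)

Lemma is_derive_line (R : numFieldType) (V W : normedModType R) (f : V -> W)
    (x v : V) (t : R) :
  derivable f (x + t *: v) v ->
  is_derive t 1 (fun s => f (x + s *: v)) ('D_v f (x + t *: v)).
Proof.
have E : (fun h : R => h^-1 *: (f (x + (h *: (1 : R) + t) *: v) - f (x + t *: v))) =
         (fun h => h^-1 *: (f (h *: v + (x + t *: v)) - f (x + t *: v))).
  apply/funext => h; congr (_ *: (f _ - _)).
  by rewrite [h *: (1 : R)]mulr1 scalerDl addrCA.
move=> df; split; first by rewrite /derivable /= E.
by rewrite /derive /= E.
Qed.

Lemma nbhs_parallelogram (R : realType) (V : normedModType R) (A : set V) (x u v : V) :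
  nbhs x A -> exists2 h : R, 0 < h &
    forall s t, 0 <= s <= h -> 0 <= t <= h -> A (x + s *: u + t *: v).
Proof.
move=> /nbhs_ballP[r /= r0 rA].
pose K := `|u| + `|v| + 1.
have K0 : 0 < K by rewrite ltr_wpDl// addr_ge0.
exists (r / (2 * K)); first by rewrite divr_gt0// mulr_gt0.
move=> s t /andP[s0 sh] /andP[t0 th]; apply: rA.
rewrite -ball_normE /= -addrA opprD addNKr normrN.
apply: le_lt_trans (ler_normD _ _) _; rewrite !normrZ !ger0_norm//.
apply: (@le_lt_trans _ _ (r / (2 * K) * (`|u| + `|v|))).
  by rewrite mulrDr lerD// ler_wpM2r.
apply: (@le_lt_trans _ _ (r / (2 * K) * K)).
  by rewrite ler_wpM2l ?lerDl// divr_ge0 ?mulr_ge0 ?(ltW r0) ?(ltW K0).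
have -> : r / (2 * K) * K = r / 2 by field; rewrite gt_eqF.
by rewrite ltr_pdivrMr ?ltr_pMr ?ltr1n.
Qed.

(** The mean value theorem is applied in the direction [u] to the difference of [f] along the two
    edges parallel to [u], then in the direction [v] to ['D_u f]. *)
Lemma mixed_difference (R : realType) (V : normedModType R) (f : V -> R)
    (x u v : V) (h : R) : 0 < h ->
  (forall s t, 0 <= s <= h -> 0 <= t <= h ->
     derivable f (x + s *: u + t *: v) u /\
     derivable ('D_u f) (x + s *: u + t *: v) v) ->
  exists s t, [/\ 0 <= s <= h, 0 <= t <= h &
    f (x + h *: u + h *: v) - f (x + h *: u) - f (x + h *: v) + f x =
    'D_v ('D_u f) (x + s *: u + t *: v) * h ^+ 2].
Proof.
move=> h0 H.
pose phi s := f (x + h *: v + s *: u) - f (x + s *: u).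
have hh : 0 <= h <= h by rewrite lexx ltW.
have zh : 0 <= (0 : R) <= h by rewrite lexx ltW.
have dphi s : 0 <= s <= h -> is_derive s 1 phi
    ('D_u f (x + h *: v + s *: u) - 'D_u f (x + s *: u)).
  move=> sh; apply: is_deriveB; apply: is_derive_line.
    by rewrite addrAC; have [] := H s h sh hh.
  by have [] := H s 0 sh zh; rewrite scale0r addr0.
have oc s : s \in `]0, h[ -> 0 <= s <= h.
  by rewrite in_itv /= => /andP[s0 sh]; rewrite !ltW.
have cc s : s \in `[0, h] -> 0 <= s <= h by rewrite in_itv.
have [||s /oc sh E] := @MVT _ phi (fun s => 'D_u f (x + h *: v + s *: u) - 'D_u f (x + s *: u)) 0 h h0.
- by move=> s /oc; exact: dphi.
- by apply: derivable_within_continuous => s /cc /dphi [].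
pose psi t := 'D_u f (x + s *: u + t *: v).
have dpsi t : 0 <= t <= h -> is_derive t 1 psi ('D_v ('D_u f) (x + s *: u + t *: v)).
  by move=> th; apply: is_derive_line; have [] := H s t sh th.
have [||t /oc th E2] := @MVT _ psi (fun t => 'D_v ('D_u f) (x + s *: u + t *: v)) 0 h h0.
- by move=> t /oc; exact: dpsi.
- by apply: derivable_within_continuous => t /cc /dpsi [].
exists s, t; split => //.
move: E E2; rewrite /phi /psi !scale0r !addr0 !subr0 => E E2.
rewrite expr2 mulrA -E2 (addrAC x (s *: u)) -E.
rewrite (addrAC x (h *: u)); ring.
Qed.

(** The second difference over a parallelogram is symmetric in [u] and [v], so the two mixed
    derivatives share a value at points arbitrarily close to [x], and continuity concludes. The
    symmetry of the Hessian of a factor rests on this. *)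
Lemma derive_commute (R : realType) (V : normedModType R) (U : set V)
    (f : V -> R) (x u v : V) : open U -> U x ->
  (forall y, U y -> derivable f y u) -> (forall y, U y -> derivable f y v) ->
  (forall y, U y -> derivable ('D_v f) y u) ->
  (forall y, U y -> derivable ('D_u f) y v) ->
  {for x, continuous ('D_u ('D_v f))} -> {for x, continuous ('D_v ('D_u f))} ->
  'D_u ('D_v f) x = 'D_v ('D_u f) x.
Proof.
move=> oU Ux du dv dvu duv c1 c2.
apply/eqP; rewrite -subr_eq0 -normr_le0; apply/ler_addgt0Pl => e e0; rewrite addr0.
have e20 : 0 < e / 2 by rewrite divr_gt0.
pose A := [set y | U y /\ (`|'D_u ('D_v f) x - 'D_u ('D_v f) y| <= e / 2 /\
  `|'D_v ('D_u f) x - 'D_v ('D_u f) y| <= e / 2)].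
have N : nbhs x A.
  apply: filterI; first exact: open_nbhs_nbhs.
  by apply: filterI; [move: c1 => /cvgrPdist_le; exact|move: c2 => /cvgrPdist_le; exact].
have [h h0 hA] := nbhs_parallelogram u v N.
have [h' h'0 hA'] := nbhs_parallelogram v u N.
pose k := Num.min h h'.
have k0 : 0 < k by rewrite lt_min h0.
have kh s : 0 <= s <= k -> 0 <= s <= h /\ 0 <= s <= h'.
  by move=> /andP[s0]; rewrite le_min s0 => /andP[].
have [|s [t [sk tk E]]] := @mixed_difference R V f x u v k k0.
  by move=> s t /kh[sh _] /kh[th _]; have [Uy _] := hA s t sh th; split; [exact: du|exact: duv].
have [|s' [t' [sk' tk' E']]] := @mixed_difference R V f x v u k k0.
  by move=> s' t' /kh[_ sh] /kh[_ th]; have [Uy _] := hA' s' t' sh th; split; [exact: dv|exact: dvu].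
have [_ [_ b1]] := hA s t (kh _ sk).1 (kh _ tk).1.
have [_ [b2 _]] := hA' s' t' (kh _ sk').2 (kh _ tk').2.
have EE : 'D_v ('D_u f) (x + s *: u + t *: v) = 'D_u ('D_v f) (x + s' *: v + t' *: u).
  apply: (@mulIf _ (k ^+ 2)); first by rewrite expf_neq0// gt_eqF.
  apply: etrans (esym E) _; apply: etrans _ E'; rewrite (addrAC x (k *: v)); ring.
rewrite EE in b1; move: b1 b2.
move: ('D_u ('D_v f) (x + _ + _)) ('D_u ('D_v f) x) ('D_v ('D_u f) x) => c a b b1 b2.
have -> : a - b = (a - c) - (b - c) by ring.
have tri := ler_normB (a - c) (b - c).
clear -b1 b2 tri; lra.
Qed.

(** * The phase space of unit speed self-shrinking curves *)

Definition clip (R : realType) (r x : R) : R := Num.max (- r) (Num.min r x).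

Lemma clip_id (R : realType) (r x : R) : `|x| <= r -> clip r x = x.
Proof.
by rewrite ler_norml /clip => /andP[h1 h2]; rewrite min_r// max_r.
Qed.

Lemma norm_clip (R : realType) (r x : R) : 0 <= r -> `|clip r x| <= r.
Proof.
move=> r0; rewrite ler_norml /clip le_max lexx /=.
rewrite ge_max ge_min lexx /= andbT. apply: (le_trans _ r0); by rewrite oppr_le0.
Qed.

Lemma clip_lipschitz (R : realType) (r x y : R) : `|clip r x - clip r y| <= `|x - y|.
Proof.
wlog xy : x y / y <= x => [hw|].
  by case: (leP y x) => [/hw//|/ltW/hw]; rewrite distrC (distrC y).
rewrite /clip (ger0_norm (_ : 0 <= x - y)) ?subr_ge0// ler_norml.
rewrite /Order.max /Order.min.
case: (ltP r x) => ?; case: (ltP r y) => ?; repeat (case: ifPn; rewrite -?leNgt => ?); apply/andP; split; lra.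
Qed.

(* Coordinates of the phase space of unit speed plane curves: [(false, _)] are
   the coordinates of the position, [(true, _)] those of the velocity. *)
Definition phase : Type := (bool * bool)%type.

(* The truncation makes the field of  gamma'' = - gamma^perp  globally
   Lipschitz; it is harmless while |gamma| <= r and |gamma'| = 1. *)
Definition shrinker_field (R : realType) (r : R) (z : phase -> R) (i : phase) : R :=
  let x := clip r (z (false, false)) in let y := clip r (z (false, true)) in
  let c := clip 1 (z (true, false)) in let s := clip 1 (z (true, true)) in
  let k := x * s - y * c in
  match i with
  | (false, false) => c
  | (false, true) => s
  | (true, false) => - s * k
  | (true, true) => c * k
  end.

Lemma norm_mulB_le (R : realType) (x y c s r : R) :
  `|x| <= r -> `|y| <= r -> `|c| <= 1 -> `|s| <= 1 -> `|x * s - y * c| <= 2 * r.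
Proof.
move=> hx hy hc hs.
have pr (a b : R) : `|a| <= r -> `|b| <= 1 -> `|a * b| <= r.
  by move=> h1 h2; rewrite normrM -[leRHS]mulr1; exact: ler_pM.
have h1 := pr _ _ hx hs; have h2 := pr _ _ hy hc.
rewrite (le_trans (ler_normB _ _))//; lra.
Qed.

Lemma norm_mul_sub_mul_le (R : realType) (a b a' b' M N e f : R) :
  `|a| <= M -> `|b'| <= N -> `|b - b'| <= e -> `|a - a'| <= f ->
  `|a * b - a' * b'| <= M * e + N * f.
Proof.
move=> h1 h2 h3 h4.
have -> : a * b - a' * b' = a * (b - b') + (a - a') * b' by ring.
rewrite (le_trans (ler_normD _ _))// !normrM lerD//; first exact: ler_pM.
by rewrite mulrC; exact: ler_pM.
Qed.

Lemma shrinker_field_bounded (R : realType) (r : R) (z : phase -> R) i :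
  0 <= r -> `|shrinker_field r z i| <= 2 * r + 1.
Proof.
move=> r0; rewrite /shrinker_field.
have hx := norm_clip (z (false, false)) r0; have hy := norm_clip (z (false, true)) r0.
have hc := norm_clip (z (true, false)) (ler01 : 0 <= 1 :> R).
have hs := norm_clip (z (true, true)) (ler01 : 0 <= 1 :> R).
move: (clip r _) (clip r _) (clip 1 _) (clip 1 _) hx hy hc hs => x y c s hx hy hc hs.
have hk := norm_mulB_le hx hy hc hs.
have pr (a b : R) : `|a| <= 1 -> `|b| <= 2 * r -> `|a * b| <= 2 * r + 1.
  move=> h1 h2; have : `|a * b| <= 1 * (2 * r) by rewrite normrM; exact: ler_pM.
  lra.
move: i => [[] []] /=.
- exact: pr.
- by apply: pr => //; rewrite normrN.
- lra.
- lra.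
Qed.

(** The curvature [k] is bounded by [2 r] and has Lipschitz constant [2 (r + 1)]; multiplying it by
    a velocity coordinate bounded by 1 gives [2 (r + 1) + 2 r = 4 r + 2]. *)
Lemma shrinker_field_lipschitz (R : realType) (r : R) (z w : phase -> R) (d : R) :
  0 <= r -> (forall i, `|z i - w i| <= d) ->
  forall i, `|shrinker_field r z i - shrinker_field r w i| <= (4 * r + 2) * d.
Proof.
move=> r0 zw i; rewrite /shrinker_field.
have cl j (u : R) : `|clip u (z j) - clip u (w j)| <= d.
  by rewrite (le_trans (clip_lipschitz _ _ _)).
have d0 : 0 <= d by apply: le_trans (zw (true, true)).
have rd : 0 <= r * d by rewrite mulr_ge0.
have hx := cl (false, false) r; have hy := cl (false, true) r.
have hc := cl (true, false) 1; have hs := cl (true, true) 1.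
have nx := norm_clip (z (false, false)) r0; have ny := norm_clip (z (false, true)) r0.
have nx' := norm_clip (w (false, false)) r0; have ny' := norm_clip (w (false, true)) r0.
have nc := norm_clip (z (true, false)) (ler01 : 0 <= 1 :> R).
have ns := norm_clip (z (true, true)) (ler01 : 0 <= 1 :> R).
have nc' := norm_clip (w (true, false)) (ler01 : 0 <= 1 :> R).
have ns' := norm_clip (w (true, true)) (ler01 : 0 <= 1 :> R).
move: (clip r (z (false, false))) (clip r (z (false, true)))
  (clip 1 (z (true, false))) (clip 1 (z (true, true)))
  (clip r (w (false, false))) (clip r (w (false, true)))
  (clip 1 (w (true, false))) (clip 1 (w (true, true)))
  hx hy hc hs nx ny nx' ny' nc ns nc' ns' => x y c s x' y' c' s'.
clear cl zw => hx hy hc hs nx ny nx' ny' nc ns nc' ns'.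
have hk : `|(x * s - y * c) - (x' * s' - y' * c')| <= 2 * (r + 1) * d.
  have -> : (x * s - y * c) - (x' * s' - y' * c') =
     (x * s - x' * s') - (y * c - y' * c') by ring.
  rewrite (le_trans (ler_normB _ _))//.
  have h1 := norm_mul_sub_mul_le nx ns' hs hx.
  have h2 := norm_mul_sub_mul_le ny nc' hc hy; lra.
have nk := norm_mulB_le nx' ny' nc' ns'.
move: i => [[] []] /=.
- have := norm_mul_sub_mul_le nc nk hk hc; lra.
- rewrite !mulNr -opprD normrN.
  have := norm_mul_sub_mul_le ns nk hk hs; lra.
- lra.
- lra.
Qed.

Definition shrinker_flow (R : realType) (r : R) (z : phase -> R -> R) : Prop :=
  forall i (t : R), is_derive t 1 (z i) (shrinker_field r (z^~ t) i).

Lemma shrinker_flow_exists (R : realType) (r : R) (z0 : phase -> R) : 0 < r ->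
  exists z, shrinker_flow r z /\ forall i, z i 0 = z0 i.
Proof.
move=> r0; have r0' := ltW r0.
have L0 : 0 < 4 * r + 2 by lra.
have [z [h1 h2]] := @picard R phase (shrinker_field r) (4 * r + 2) (2 * r + 1) L0
  (fun z w d => @shrinker_field_lipschitz R r z w d r0')
  (fun z i => shrinker_field_bounded z i r0') z0.
by exists z.
Qed.

(** * Propagation along segments *)

(** The direction of [(a, b)] turns at the angular speed [(a b' - a' b) / (a^2 + b^2)], and the
    cosine of an angle changes at minus the sine times that speed. *)
Lemma is_derive_normalise (R : realType) (a b : R -> R) (t a' b' : R) :
  is_derive t 1 a a' -> is_derive t 1 b b' -> 0 < a t ^+ 2 + b t ^+ 2 ->
  is_derive t 1 (fun u => a u / Num.sqrt (a u ^+ 2 + b u ^+ 2))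
    (- b t * (a t * b' - a' * b t) / Num.sqrt (a t ^+ 2 + b t ^+ 2) ^+ 3).
Proof.
move=> da db n0; pose n u : R := a u ^+ 2 + b u ^+ 2.
have dn : is_derive t 1 n (2 * (a t * a' + b t * b')).
  have -> : n = (a * a) + (b * b) by apply/funext.
  apply: is_derive_eq (is_deriveD (is_deriveM da da) (is_deriveM db db)) _.
  by rewrite /GRing.scale /=; move: (a t) (b t) => u v; ring.
have dr := @is_derive1_comp R Num.sqrt n t _ _ (is_derive1_sqrt (n0 : 0 < n t)) dn.
pose rho u := Num.sqrt (n u).
have r0 : 0 < rho t by rewrite sqrtr_gt0.
have r2 : rho t ^+ 2 = n t by rewrite sqr_sqrtr// ltW.
have dv : is_derive t 1 (fun u => (rho u)^-1)
    (- (rho t) ^- 2 * ((2 * rho t)^-1 * (2 * (a t * a' + b t * b')))).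
  have [d e] := dr.
  by split; [apply: derivableV|rewrite deriveV ?e]; rewrite ?gt_eqF.
have -> : (fun u => a u / Num.sqrt (a u ^+ 2 + b u ^+ 2)) = a * (fun u => (rho u)^-1).
  by [].
apply: is_derive_eq; rewrite /GRing.scale /= -/(n t) -/(rho t).
have rn : rho t != 0 by rewrite gt_eqF.
transitivity ((rho t ^+ 2 * a' - a t * (a t * a' + b t * b')) / rho t ^+ 3).
  by field.
by rewrite r2 /n; congr (_ / _); ring.
Qed.

(** One constant direction [k] serves the whole patch: [('D_k p, 'D_k q)] never vanishes and spans
    the tangent line of the image curve. If theta is its angle and ds the arc length form,
    [fp_curvature] reads [dtheta = (p sin theta - q cos theta) ds], which is the equation of a
    self-shrinking curve. *)
Record factor_patch (R : realType) (V : normedModType R) (B : set V)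
    (p q : V -> R) (k : V) (r C : R) : Prop := FactorPatch {
  fp_derivable : forall y v, B y -> derivable p y v /\ derivable q y v;
  fp_derivable2 : forall y v w, B y ->
    derivable ('D_w p) y v /\ derivable ('D_w q) y v;
  fp_regular : forall y, B y -> 0 < 'D_k p y ^+ 2 + 'D_k q y ^+ 2;
  fp_rank1 : forall y v, B y -> 'D_v p y * 'D_k q y = 'D_v q y * 'D_k p y;
  fp_curvature : forall y v, B y ->
    'D_k p y * 'D_v ('D_k q) y - 'D_v ('D_k p) y * 'D_k q y =
    (p y * 'D_k q y - q y * 'D_k p y) *
    ('D_k p y * 'D_v p y + 'D_k q y * 'D_v q y);
  fp_bounded : forall y, B y -> `|p y| <= r /\ `|q y| <= r;
  fp_bounded1 : forall y v, B y -> `|'D_v p y| <= C * `|v| /\ `|'D_v q y| <= C * `|v|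
}.

(** The last clause places the image of the differential in the line of the velocity without fixing
    an orientation, so the factor may run along the trajectory in either direction or stand
    still. *)
Definition phase_match (R : realType) (V : normedModType R)
    (z : phase -> R -> R) (p q : V -> R) (y : V) (s : R) : Prop :=
  [/\ p y = z (false, false) s, q y = z (false, true) s,
      z (true, false) s ^+ 2 + z (true, true) s ^+ 2 = 1 &
      forall w, 'D_w p y * z (true, true) s = 'D_w q y * z (true, false) s].

(** Along the segment, [(p, q)] and its unit tangent solve the shrinker field multiplied by the
    signed speed [lam]. So does the flow [z] read at the time [s0 + L], where [L] is a primitive of
    [lam]; uniqueness identifies the two, and the bound on [lam] bounds the change of time. *)
Lemma phase_match_along_segment (R : realType) (V : normedModType R) (B : set V)
    (p q : V -> R) (k : V) (r C : R) (z : phase -> R -> R) (y0 y1 : V) (s0 : R) :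
  0 < r -> 0 < C -> shrinker_flow r z -> factor_patch B p q k r C ->
  (forall t : R, 0 <= t <= 1 -> B (y0 + t *: (y1 - y0))) ->
  phase_match z p q y0 s0 ->
  exists2 s1, phase_match z p q y1 s1 & `|s1 - s0| <= 2 * C * `|y1 - y0|.
Proof.
move=> r0 C0 zflow [d1 d2 reg rank curv bnd bnd1] seg [pz qz cs1 tang].
set v := y1 - y0; pose y (t : R) := y0 + t *: v.
pose a (t : R) : R := 'D_k p (y t); pose b (t : R) : R := 'D_k q (y t).
pose rho t := Num.sqrt (a t ^+ 2 + b t ^+ 2).
have By (t : R) : 0 <= t <= 1 -> B (y t) by exact: seg.
have By0 : B y0 by have := By 0; rewrite /y scale0r addr0; apply; rewrite lexx ler01.
have n0 (t : R) : 0 <= t <= 1 -> 0 < a t ^+ 2 + b t ^+ 2 by move=> /By /reg.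
have rho0 (t : R) : 0 <= t <= 1 -> 0 < rho t by move=> /n0; rewrite sqrtr_gt0.
have rho2 (t : R) : 0 <= t <= 1 -> rho t ^+ 2 = a t ^+ 2 + b t ^+ 2.
  by move=> /n0 h; rewrite sqr_sqrtr// ltW.
(* Taking [w = k] in [tang] makes [(a 0, b 0)] parallel to the velocity of [z] at [s0], so this
   inner product is [rho 0] up to sign, and [eps = 1] or [-1] orients the unit tangent [(ex, ey)]
   like that velocity. *)
pose sg : R := a 0 * z (true, false) s0 + b 0 * z (true, true) s0.
pose eps : R := sg / rho 0.
have z01 : 0 <= (0 : R) <= 1 by rewrite lexx ler01.
have o01 : 0 <= (1 : R) <= 1 by rewrite lexx ler01.
have y0E : y 0 = y0 by rewrite /y scale0r addr0.
have a0c : a 0 = sg * z (true, false) s0.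
  rewrite /sg -[LHS]mulr1 -cs1; have := tang k; rewrite -y0E -/(a 0) -/(b 0) => h.
  ring: h.
have b0s : b 0 = sg * z (true, true) s0.
  rewrite /sg -[LHS]mulr1 -cs1; have := tang k; rewrite -y0E -/(a 0) -/(b 0) => h.
  ring: h.
have sg2 : sg ^+ 2 = rho 0 ^+ 2.
  by rewrite rho2// a0c b0s -[LHS]mulr1 -cs1; ring.
have eps2 : eps ^+ 2 = 1 by rewrite /eps exprMn exprVn sg2 divff// expf_neq0// gt_eqF ?rho0.
have rn0 : rho 0 != 0 by rewrite gt_eqF ?rho0.
have exc : eps * (a 0 / rho 0) = z (true, false) s0.
  have -> : eps * (a 0 / rho 0) = sg ^+ 2 * z (true, false) s0 / rho 0 ^+ 2.
    by rewrite /eps a0c; field.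
  by rewrite sg2; field.
have eys0 : eps * (b 0 / rho 0) = z (true, true) s0.
  have -> : eps * (b 0 / rho 0) = sg ^+ 2 * z (true, true) s0 / rho 0 ^+ 2.
    by rewrite /eps b0s; field.
  by rewrite sg2; field.
clearbody eps; clear sg a0c b0s sg2.
pose ex (t : R) : R := eps * (a t / rho t); pose ey (t : R) : R := eps * (b t / rho t).
have e1 (t : R) : 0 <= t <= 1 -> ex t ^+ 2 + ey t ^+ 2 = 1.
  move=> t01; have rn : rho t != 0 by rewrite gt_eqF ?rho0.
  rewrite /ex /ey !(exprMn _ eps) eps2 !mul1r !exprMn -mulrDl -rho2// -exprMn divff// expr1n//.
pose lam (t : R) : R := 'D_v p (y t) * ex t + 'D_v q (y t) * ey t.
pose W (i : phase) : R -> R := match i with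
  | (false, false) => p \o y | (false, true) => q \o y
  | (true, false) => ex | (true, true) => ey end.
have dline (f : V -> R) t : derivable f (y t) v -> is_derive t 1 (f \o y) ('D_v f (y t)).
  exact: is_derive_line.
have da (t : R) : 0 <= t <= 1 -> is_derive t 1 a ('D_v ('D_k p) (y t)).
  by move=> /By h; apply: dline; have [] := d2 _ v k h.
have db (t : R) : 0 <= t <= 1 -> is_derive t 1 b ('D_v ('D_k q) (y t)).
  by move=> /By h; apply: dline; have [] := d2 _ v k h.
have small c : c ^+ 2 <= 1 -> `|c| <= 1 :> R.
  by move=> h; rewrite -(@expr_le1 _ 2)// real_normK// num_real.
have exs (t : R) : 0 <= t <= 1 -> `|ex t| <= 1.
  by move=> /e1 h; apply: small; rewrite -h lerDl sqr_ge0.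
have eys (t : R) : 0 <= t <= 1 -> `|ey t| <= 1.
  by move=> /e1 h; apply: small; rewrite -h lerDr sqr_ge0.
have rk (t : R) : 0 <= t <= 1 -> 'D_v p (y t) * b t = 'D_v q (y t) * a t.
  by move=> /By h; rewrite /a /b rank.
have dW i (t : R) : 0 <= t <= 1 ->
    is_derive t 1 (W i) (lam t * shrinker_field r (W^~ t) i).
  move=> t01; have rn : rho t != 0 by rewrite gt_eqF ?rho0.
  have [pb qb] := bnd _ (By _ t01); have r2 := rho2 _ t01; have rkt := rk _ t01.
  have cv := curv _ v (By _ t01).
  have [dp dq] := d1 _ v (By _ t01).
  (* The field times [lam] is cubic in [eps], whereas the derivative of [ex] or [ey] is linear in
     it. *)
  have eps3 : eps ^+ 3 = eps by rewrite exprS eps2 mulr1.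
  have dex : is_derive t 1 ex (lam t * (- ey t * (p (y t) * ey t - q (y t) * ex t))).
    have h := is_derive_normalise (da t t01) (db t t01) (n0 t t01).
    have hE := is_deriveZ eps h; apply: is_derive_eq hE _.
    rewrite /GRing.scale /= -/(rho t) [_ * 'D_v ('D_k q) _ - _]cv.
    rewrite -[in LHS]eps3 /lam /ex /ey -/(a t) -/(b t); field.
    exact: rn.
  have dey : is_derive t 1 ey (lam t * (ex t * (p (y t) * ey t - q (y t) * ex t))).
    have n0' : 0 < b t ^+ 2 + a t ^+ 2 by rewrite addrC n0.
    have h := is_derive_normalise (db t t01) (da t t01) n0'.
    have eyE : ey = eps *: (fun u => b u / Num.sqrt (b u ^+ 2 + a u ^+ 2)).
      by apply/funext => u; rewrite /ey /rho addrC.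
    rewrite eyE; have hE := is_deriveZ eps h; apply: is_derive_eq hE _; rewrite -eyE.
    rewrite /GRing.scale /= [b t ^+ 2 + _]addrC -/(rho t).
    have -> : b t * 'D_v ('D_k p) (y t) - 'D_v ('D_k q) (y t) * a t =
      - (a t * 'D_v ('D_k q) (y t) - 'D_v ('D_k p) (y t) * b t).
      by rewrite opprB (mulrC (b t)) (mulrC (a t)).
    rewrite [_ * 'D_v ('D_k q) _ - _]cv.
    rewrite -[in LHS]eps3 /lam /ex /ey -/(a t) -/(b t); field.
    exact: rn.
  have E : shrinker_field r (W^~ t) i = match i with
    | (false, false) => ex t | (false, true) => ey t
    | (true, false) => - ey t * (p (y t) * ey t - q (y t) * ex t)
    | (true, true) => ex t * (p (y t) * ey t - q (y t) * ex t) end.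
    rewrite /shrinker_field /W /= (clip_id pb) (clip_id qb).
    by rewrite (clip_id (exs _ t01)) (clip_id (eys _ t01)); case: (i) => [[] []].
  rewrite E; case: i {E} => [[] []].
  - exact: dey.
  - exact: dex.
  - have -> : lam t * ey t = 'D_v q (y t); last exact: dline.
    transitivity (eps ^+ 2 * (('D_v p (y t) * b t) * a t + 'D_v q (y t) * b t ^+ 2) / rho t ^+ 2).
      by rewrite /lam /ex /ey; field.
    rewrite eps2 rkt; transitivity ('D_v q (y t) * (a t ^+ 2 + b t ^+ 2) / rho t ^+ 2).
      by field.
    by rewrite -r2; field.
  - have -> : lam t * ex t = 'D_v p (y t); last exact: dline.
    transitivity (eps ^+ 2 * ('D_v p (y t) * a t ^+ 2 + ('D_v q (y t) * a t) * b t) / rho t ^+ 2).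
      by rewrite /lam /ex /ey; field.
    rewrite eps2 -rkt; transitivity ('D_v p (y t) * (a t ^+ 2 + b t ^+ 2) / rho t ^+ 2).
      by field.
    by rewrite -r2; field.
have lamB (t : R) : 0 <= t <= 1 -> `|lam t| <= 2 * C * `|v|.
  move=> t01; have [b1 b2] := bnd1 _ v (By _ t01).
  have h1 : `|'D_v p (y t) * ex t| <= C * `|v|.
    by rewrite normrM -[leRHS]mulr1; apply: ler_pM => //; exact: exs.
  have h2 : `|'D_v q (y t) * ey t| <= C * `|v|.
    by rewrite normrM -[leRHS]mulr1; apply: ler_pM => //; exact: eys.
  apply: le_trans (ler_normD _ _) _; rewrite -mulrA mulr2n mulrDl !mul1r.
  exact: lerD.
(* Clamping to [0, 1] extends [lam] to a continuous function on the whole line, which has a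
   primitive. *)
pose cl (t : R) : R := Num.max 0 (Num.min 1 t).
have cl01 (t : R) : 0 <= cl t <= 1.
  by rewrite /cl le_max lexx /= ge_max ler01 ge_min lexx.
have clE (t : R) : 0 <= t <= 1 -> cl t = t.
  by move=> /andP[h1 h2]; rewrite /cl min_r// max_r.
have clc : continuous cl.
  move=> t; apply: continuous_max; first exact: cvg_cst.
  by apply: continuous_min; [exact: cvg_cst|exact: cvg_id].
have lamc (t : R) : 0 <= t <= 1 -> {for t, continuous lam}.
  move=> t01; have [h1 h2] := d2 _ v v (By _ t01).
  have k1 := is_derive_continuous (dline _ _ h1); have k2 := is_derive_continuous (dline _ _ h2).
  have k3 := is_derive_continuous (dW (true, false) _ t01).
  have k4 := is_derive_continuous (dW (true, true) _ t01).
  by apply: cvgD; apply: cvgM.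
have [L L0 dL] : exists2 L : R -> R, L 0 = 0 & forall t : R, is_derive t 1 L (lam (cl t)).
  apply: continuous_antiderivative => t.
  apply: continuous_comp; [exact: clc|exact: lamc].
pose Z (i : phase) (t : R) := z i (s0 + L t).
have dZ i (t : R) : is_derive t 1 (Z i) (lam (cl t) * shrinker_field r (Z^~ t) i).
  have dsL : is_derive t 1 (fun u => s0 + L u) (lam (cl t)).
    rewrite -[lam _]add0r; apply: is_deriveD.
  rewrite mulrC; exact: (@is_derive1_comp R (z i) (fun u => s0 + L u) t _ _ (zflow i (s0 + L t)) dsL).
have r0' := ltW r0.
have Lp : 0 < 4 * r + 2 by lra.
have Lam0 : 0 < 2 * C * `|v| + 1 by rewrite ltr_wpDl// !mulr_ge0// ltW.
have cc t : t \in `[0, 1] -> 0 <= t <= 1 by rewrite in_itv.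
have oc (t : R) : t \in `]0, 1[ -> 0 <= t <= 1.
  by rewrite in_itv /= => /andP[h1 h2]; rewrite !ltW.
have WZ i : W i 1 = Z i 1.
  have hlam t : `|(lam \o cl) t| <= 2 * C * `|v| + 1.
    by move=> /=; apply: le_trans (lamB _ (cl01 t)) _; rewrite lerDl ler01.
  have cW j : {within `[0, 1], continuous (W j)}.
    by apply: derivable_within_continuous => t /cc t01; have [] := dW j t t01.
  have cZ j : {within `[0, 1], continuous (Z j)}.
    by apply: derivable_within_continuous => t _; have [] := dZ j t.
  have dW' j (t : R) : t \in `]0, 1[ ->
      is_derive t 1 (W j) ((lam \o cl) t * shrinker_field r (W^~ t) j).
    by move=> /oc t01; rewrite /= clE//; exact: dW.
  have dZ' j (t : R) : t \in `]0, 1[ ->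
      is_derive t 1 (Z j) ((lam \o cl) t * shrinker_field r (Z^~ t) j).
    by move=> _; exact: dZ.
  have WZ0 j : W j 0 = Z j 0.
    rewrite /Z L0 addr0; case: j => [[] []] /=.
    - exact: eys0.
    - exact: exc.
    - by rewrite y0E qz.
    - by rewrite y0E pz.
  have t1 : (1 : R) \in `[0, 1] by rewrite in_itv /= ler01 lexx.
  exact: (@reparametrised_unique R phase (shrinker_field r) (4 * r + 2) (2 * r + 1) Lp
    (fun z w d => @shrinker_field_lipschitz R r z w d r0')
    (fun z i => shrinker_field_bounded z i r0') W Z (lam \o cl) (2 * C * `|v| + 1) 1
    Lam0 hlam cW cZ dW' dZ' WZ0 1 t1 i).
have y1E : y 1 = y1 by rewrite /y scale1r /v addrC subrK.
exists (s0 + L 1).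
  split.
  - by have := WZ (false, false); rewrite /= y1E.
  - by have := WZ (false, true); rewrite /= y1E.
  - by have := e1 1 o01; have := WZ (true, false); have := WZ (true, true); rewrite /= => -> ->.
  - move=> w; have := WZ (true, false); have := WZ (true, true); rewrite /Z /= => <- <-.
    have := rank _ w (By _ o01); rewrite /ex /ey -/(a 1) -/(b 1) y1E => h.
    transitivity (eps * ('D_w p y1 * b 1) / rho 1).
      by field; rewrite gt_eqF// rho0.
    by rewrite h; field; rewrite gt_eqF// rho0.
have := lipschitz_of_derive dL (fun t => lamB _ (cl01 t)) 1 0.
by rewrite L0 !subr0 normr1 mulr1 addrAC subrr add0r.
Qed.

(** * Normal projections and the self-shrinker equation *)

Lemma dotvE (R : realType) n (u v : 'rV[R]_n) : dotv u v = (u *m v^T) 0 0.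
Proof. by rewrite /dotv mxE; apply: eq_bigr => i _; rewrite mxE. Qed.

Lemma dotv_self_eq0 (R : realType) n (u : 'rV[R]_n) : dotv u u = 0 -> u = 0.
Proof.
move=> h; apply/rowP => i; rewrite mxE; apply/eqP; rewrite -sqrf_eq0 expr2.
move/eqP: h; rewrite /dotv psumr_eq0; last by move=> j _; rewrite -expr2 sqr_ge0.
by move=> /allP /(_ i); rewrite mem_index_enum => /(_ isT).
Qed.

Lemma dotv_linear (R : realType) n (w : 'rV[R]_n) a u v :
  dotv (a *: u + v) w = a * dotv u w + dotv v w.
Proof.
rewrite /dotv mulr_sumr -big_split; apply: eq_bigr => i _ /=.
by rewrite !mxE mulrDl mulrA.
Qed.

Lemma dotvC (R : realType) n (u v : 'rV[R]_n) : dotv u v = dotv v u.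
Proof. by apply: eq_bigr => i _; rewrite mulrC. Qed.

Lemma dotv0l (R : realType) n (v : 'rV[R]_n) : dotv 0 v = 0.
Proof. by rewrite /dotv big1// => i _; rewrite mxE mul0r. Qed.

Lemma dotvDl (R : realType) n (u v w : 'rV[R]_n) : dotv (u + v) w = dotv u w + dotv v w.
Proof. by have := dotv_linear w 1 u v; rewrite scale1r mul1r. Qed.

Lemma dotvZl (R : realType) n a (u w : 'rV[R]_n) : dotv (a *: u) w = a * dotv u w.
Proof. by have := dotv_linear w a u 0; rewrite addr0 dotv0l addr0. Qed.

Lemma dotvNl (R : realType) n (u w : 'rV[R]_n) : dotv (- u) w = - dotv u w.
Proof. by rewrite -scaleN1r dotvZl mulN1r. Qed.

Lemma dotvBl (R : realType) n (u v w : 'rV[R]_n) : dotv (u - v) w = dotv u w - dotv v w.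
Proof. by rewrite dotvDl dotvNl. Qed.

Lemma dotv_suml (R : realType) n (I : finType) (u : I -> 'rV[R]_n) w :
  dotv (\sum_i u i) w = \sum_i dotv (u i) w.
Proof.
rewrite (big_morph (fun v => dotv v w) (id1 := 0) (op1 := +%R))// ?dotv0l//.
by move=> x y; rewrite dotvDl.
Qed.

Lemma is_derive_dotv (R : realType) (V : normedModType R) n (f : V -> 'rV[R]_n)
    (x v : V) (b : 'rV[R]_n) : derivable f x v ->
  is_derive x v (fun y => dotv (f y) b) (dotv ('D_v f x) b).
Proof.
move=> df.
have -> : (fun y => dotv (f y) b) = \sum_(i < n) (b 0 i *: (fun y => f y 0 i)).
  by apply/funext => y; rewrite fct_sumE; apply: eq_bigr => i _; rewrite mulrC.
have -> : dotv ('D_v f x) b = \sum_(i < n) (b 0 i *: 'D_v (fun y => f y 0 i) x).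
  by apply: eq_bigr => i _; rewrite derive_mx// mxE mulrC.
apply: is_derive_sum => i; apply: is_deriveZ; apply: derivableP.
by move/derivable_mxP: df => /(_ 0 i).
Qed.

Section NormalPart.
Context (R : realType) (m n : nat) (J : 'M[R]_(m, n)).

Lemma tangent_normal_capmx0 : (kermx J^T :&: <<J>>)%MS = 0.
Proof.
apply/eqP; rewrite -submx0; apply/rV_subP => v; rewrite sub_capmx.
move=> /andP[/sub_kermxP vJ]; rewrite genmxE => /submxP[u vE].
suff -> : v = 0 by rewrite sub0mx.
apply: dotv_self_eq0; rewrite dotvE {2}vE trmx_mul mulmxA vJ mul0mx mxE//.
Qed.

Lemma tangent_normal_sum_full (v : 'rV[R]_n) : (v <= kermx J^T + <<J>>)%MS.
Proof.
apply: submx_full; rewrite /row_full; apply/eqP.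
have := mxrank_disjoint_sum tangent_normal_capmx0 => ->.
rewrite mxrank_ker mxrank_gen mxrank_tr subnK// rank_leq_col //.
Qed.

Lemma normal_projection_eq0 (v : 'rV[R]_n) :
  v *m proj_mx (kermx J^T) <<J>>%MS = 0 <-> (v <= J)%MS.
Proof.
split=> [h|vJ]; last first.
  by apply: proj_mx_0; [exact: tangent_normal_capmx0|rewrite genmxE].
have := add_proj_mx tangent_normal_capmx0 (tangent_normal_sum_full v).
rewrite h add0r => <-; rewrite -(genmxE J); exact: proj_mx_sub.
Qed.

End NormalPart.

Lemma row_jacobian (R : realType) m n (f : 'rV[R]_m -> 'rV[R]_n) x (i : 'I_m) :
  differentiable f x -> row i ('J f x) = 'D_(delta_mx 0 i) f x.
Proof. by move=> df; rewrite deriveEjacobian// -rowE. Qed.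

Lemma first_fundamental_form_unit (R : realType) m n (f : 'rV[R]_m -> 'rV[R]_n) x :
  differentiable f x -> injective ('d f x) ->
  first_fundamental_form f x \in unitmx.
Proof.
move=> df inj; rewrite -row_free_unit; apply: inj_row_free => v.
rewrite /first_fundamental_form mulmxA => h.
have : v *m 'J f x = 0.
  apply: dotv_self_eq0; rewrite dotvE trmx_mul mulmxA h mul0mx mxE//.
rewrite -deriveEjacobian// deriveE// => h2; apply: inj; rewrite h2 linear0//.
Qed.

(** By the shrinker equation the trace of the second derivatives plus the position has zero normal
    part, hence is tangent; pairing it with one normal vector [N] removes the projection from the
    formula. *)
Lemma shrinker_normal_component (R : realType) m n (U : set 'rV[R]_m)
    (f : 'rV[R]_m -> 'rV[R]_n) x (N : 'rV[R]_n) :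
  self_shrinker_on U f -> U x -> (forall v, dotv ('D_v f x) N = 0) ->
  \sum_(i < m) \sum_(j < m) invmx (first_fundamental_form f x) i j *
    dotv ('D_(delta_mx 0 i) ('D_(delta_mx 0 j) f) x) N + dotv (f x) N = 0.
Proof.
move=> [[smooth _] H] Ux NT; have df : differentiable f x by have [h _] := smooth 1%N; exact: h.
set W := invmx _.
pose X := \sum_(i < m) \sum_(j < m) W i j *: 'D_(delta_mx 0 i) ('D_(delta_mx 0 j) f) x + f x.
suff /submxP[u XE] : (X <= 'J f x)%MS.
  have : dotv X N = 0.
    by rewrite XE -deriveEjacobian.
  rewrite /X dotvDl dotv_suml => h; apply: etrans h; congr (_ + _); apply: eq_bigr => i _.
  by rewrite dotv_suml; apply: eq_bigr => j _; rewrite dotvZl.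
apply/normal_projection_eq0; rewrite /X mulmxDl.
have := H x Ux; rewrite /normal_part => /eqP; rewrite -addr_eq0 => /eqP h; apply: etrans h.
congr (_ + _); rewrite mulmx_suml /mean_curvature; apply: eq_bigr => i _.
rewrite mulmx_suml; apply: eq_bigr => j _; rewrite -scalemxAl //.
Qed.

Section SmoothComponent.
Context (R : realType) (V : normedModType R) (n : nat) (U : set V).
Context (f : V -> 'rV[R]_n) (b : 'rV[R]_n).
Hypothesis U_open : open U.
Hypothesis f_smooth : smooth_on U f.
Let p y := dotv (f y) b.

Lemma smooth_differentiable y : U y -> differentiable f y.
Proof. by have [h _] := f_smooth 1%N; exact: h. Qed.

Lemma smooth_differentiable_derive w y : U y -> differentiable ('D_w f) y.
Proof. by have [_ /(_ w)[h _]] := f_smooth 2%N; exact: h. Qed.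

Lemma smooth_continuous_derive2 v w y : U y -> {for y, continuous ('D_v ('D_w f))}.
Proof. by have [_ /(_ w)[_ /(_ v)]] := f_smooth 2%N; exact. Qed.

Lemma component_derive v y : U y -> is_derive y v p (dotv ('D_v f y) b).
Proof.
by move=> Uy; apply: is_derive_dotv; apply: diff_derivable; exact: smooth_differentiable.
Qed.

Lemma component_derive_near w y : U y ->
  \near y, dotv ('D_w f y) b = 'D_w p y.
Proof.
move=> Uy; have : nbhs y U by exact: open_nbhs_nbhs.
by apply: filterS => y' Uy'; have [_ ->] := component_derive w Uy'.
Qed.

Lemma component_derive2 v w y : U y ->
  is_derive y v ('D_w p) (dotv ('D_v ('D_w f) y) b).
Proof.
move=> Uy; apply: near_eq_is_derive (component_derive_near w Uy) _.
by apply: is_derive_dotv; apply: diff_derivable; exact: smooth_differentiable_derive.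
Qed.

Lemma dotv_continuous : continuous (fun u : 'rV[R]_n => dotv u b).
Proof.
move=> u; apply: differentiable_continuous.
have -> : (fun u => dotv u b) = \sum_(i < n) (b 0 i *: (fun u : 'rV[R]_n => u 0 i)).
  by apply/funext => w; rewrite fct_sumE; apply: eq_bigr => i _; rewrite mulrC.
by apply: differentiable_sum => i; apply: differentiableZ; exact: differentiable_coord.
Qed.

Lemma component_continuous_derive w y : U y -> {for y, continuous ('D_w p)}.
Proof.
move=> Uy; have gc := differentiable_continuous (smooth_differentiable_derive w Uy).
have c := continuous_comp gc (@dotv_continuous ('D_w f y)).
have e := component_derive_near w Uy.
rewrite /prop_for /continuous_at -(nbhs_singleton e).
exact: cvg_trans (near_eq_cvg e) c.
Qed.

Lemma component_continuous_derive2 v w y : U y ->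
  {for y, continuous ('D_v ('D_w p))}.
Proof.
move=> Uy; have gc := @smooth_continuous_derive2 v w y Uy.
have c := continuous_comp gc (@dotv_continuous ('D_v ('D_w f) y)).
have e : \near y, dotv ('D_v ('D_w f) y) b = 'D_v ('D_w p) y.
  have : nbhs y U by exact: open_nbhs_nbhs.
  by apply: filterS => y' Uy'; have [_ ->] := component_derive2 v w Uy'.
rewrite /prop_for /continuous_at -(nbhs_singleton e).
exact: cvg_trans (near_eq_cvg e) c.
Qed.

Lemma component_derive_commute v w y : U y ->
  'D_v ('D_w p) y = 'D_w ('D_v p) y.
Proof.
move=> Uy; apply: (derive_commute U_open Uy).
- by move=> z Uz; have [] := component_derive v Uz.
- by move=> z Uz; have [] := component_derive w Uz.
- by move=> z Uz; have [] := component_derive2 v w Uz.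
- by move=> z Uz; have [] := component_derive2 w v Uz.
- exact: component_continuous_derive2.
- exact: component_continuous_derive2.
Qed.

End SmoothComponent.

(** * The curvature of a rank one factor *)

Lemma derive_row_linear (R : realType) m (W : normedModType R) (f : 'rV[R]_m -> W)
    (y v : 'rV[R]_m) : differentiable f y ->
  'D_v f y = \sum_(i < m) v 0 i *: 'D_(delta_mx 0 i) f y.
Proof.
move=> df; rewrite deriveE// [in LHS](row_sum_delta v) linear_sum.
by apply: eq_bigr => i _; rewrite linearZ /= deriveE.
Qed.

(** For four vectors of R^4 this single bilinear identity says that they form an orthonormal
    basis. *)
Definition parseval_frame (R : realType) (m1 m2 n1 n2 : 'rV[R]_4) : Prop :=
  forall u w, dotv u w = dotv u m1 * dotv w m1 + dotv u m2 * dotv w m2 +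
                         (dotv u n1 * dotv w n1 + dotv u n2 * dotv w n2).

Definition rank1_components (R : realType) (V W : Type) (D : V -> W -> 'rV[R]_4)
    (U : set W) (b1 b2 : 'rV[R]_4) : Prop :=
  forall y v w, U y ->
    dotv (D v y) b1 * dotv (D w y) b2 = dotv (D w y) b1 * dotv (D v y) b2.

Lemma dotv_scaleB (R : realType) n (s t : R) (u v w : 'rV[R]_n) :
  dotv (s *: u - t *: v) w = s * dotv u w - t * dotv v w.
Proof. by rewrite dotvBl !dotvZl. Qed.

Lemma parseval_frame_eq (R : realType) (m1 m2 n1 n2 u v : 'rV[R]_4) (x y a b : R) :
  parseval_frame m1 m2 n1 n2 -> dotv u n1 = 0 -> dotv u n2 = 0 ->
  dotv u m1 = x * a -> dotv u m2 = x * b ->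
  dotv v m1 = y * a -> dotv v m2 = y * b ->
  dotv u v = x * (a ^+ 2 + b ^+ 2) * y.
Proof. by move=> fr un1 un2 um1 um2 vm1 vm2; rewrite fr un1 un2 um1 um2 vm1 vm2; ring. Qed.

Lemma dotv_scaleD (R : realType) n (s t : R) (u v w : 'rV[R]_n) :
  dotv (s *: u + t *: v) w = s * dotv u w + t * dotv v w.
Proof. by rewrite dotvDl !dotvZl. Qed.

Lemma rV2_decomposition (R : realType) (w : 'rV[R]_2) :
  w = w 0 0 *: delta_mx 0 0 + w 0 1 *: delta_mx 0 1.
Proof.
apply/rowP => i; rewrite !mxE.
case: i => [[|[|i]] hi] //=.
  by rewrite mulr1 mulr0 addr0; congr (w 0 _); exact: val_inj.
by rewrite mulr1 mulr0 add0r; congr (w 0 _); exact: val_inj.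
Qed.

Lemma derive_rV2 (R : realType) (W : normedModType R) (f : 'rV[R]_2 -> W)
    (y w : 'rV[R]_2) : differentiable f y ->
  'D_w f y = w 0 0 *: 'D_(delta_mx 0 0) f y + w 0 1 *: 'D_(delta_mx 0 1) f y.
Proof.
move=> df; rewrite !deriveE// [in LHS](rV2_decomposition w) [in LHS]linearD.
by congr (_ + _); rewrite linearZ.
Qed.

Lemma rV2_combination_eq0 (R : realType) (x y : R) :
  y *: delta_mx 0 0 - x *: delta_mx 0 1 = 0 :> 'rV[R]_2 -> x = 0 /\ y = 0.
Proof.
move=> /rowP h; have := h 0; have := h 1; rewrite !mxE /= => h1 h0; split.
  by move: h1; rewrite mulr0 mulr1 add0r => /eqP; rewrite oppr_eq0 => /eqP.
by move: h0; rewrite mulr0 mulr1 subr0.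
Qed.

(** The 2 by 2 matrix of derivatives of the two components is singular. Applied to one factor, this
    yields a tangent direction that only the other factor sees. *)
Lemma rank1_kernel (R : realType) (f : 'rV[R]_2 -> 'rV[R]_4) (y : 'rV[R]_2)
    (b1 b2 : 'rV[R]_4) : differentiable f y ->
  (forall v w, dotv ('D_v f y) b1 * dotv ('D_w f y) b2 =
               dotv ('D_w f y) b1 * dotv ('D_v f y) b2) ->
  exists2 u : 'rV[R]_2, u != 0 & dotv ('D_u f y) b1 = 0 /\ dotv ('D_u f y) b2 = 0.
Proof.
move=> df rk.
pose e0 : 'rV[R]_2 := delta_mx 0 0; pose e1 : 'rV[R]_2 := delta_mx 0 1.
have dE0 (s t : R) b : dotv ('D_(s *: e0 - t *: e1) f y) b =
    s * dotv ('D_e0 f y) b - t * dotv ('D_e1 f y) b.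
  have -> : 'D_(s *: e0 - t *: e1) f y = s *: 'D_e0 f y - t *: 'D_e1 f y.
    by rewrite !deriveE// [in LHS]linearB [X in X - _]linearZ [X in _ - X]linearZ.
  exact: dotv_scaleB.
pose c b (i : bool) := dotv ('D_(if i then e1 else e0) f y) b.
have dE (s t : R) b : dotv ('D_(s *: e0 - t *: e1) f y) b = s * c b false - t * c b true.
  exact: dE0.
have c0E b : dotv ('D_e0 f y) b = c b false by exact: erefl.
have rkc : c b1 false * c b2 true = c b1 true * c b2 false by exact: rk.
have e00 : e0 != 0.
  by apply/negP => /eqP/rowP/(_ 0); rewrite !mxE /= => /eqP; rewrite oner_eq0.
have ind (s t : R) : s *: e0 - t *: e1 = 0 -> t = 0 /\ s = 0.
  exact: rV2_combination_eq0.
clear dE0; clearbody c e0 e1.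
have [z1|nz1] := eqVneq (c b1 true *: e0 - c b1 false *: e1) 0; last first.
  exists (c b1 true *: e0 - c b1 false *: e1); first exact: nz1.
  by rewrite !dE rkc subrr mulrC subrr.
have [a0 a1] := ind _ _ z1.
have [z2|nz2] := eqVneq (c b2 true *: e0 - c b2 false *: e1) 0; last first.
  exists (c b2 true *: e0 - c b2 false *: e1); first exact: nz2.
  by rewrite !dE a0 a1 !mulr0 subrr mulrC subrr.
have [c0 c1] := ind _ _ z2.
by exists e0; rewrite ?c0E.
Qed.

Lemma near_bounded (R : realType) (V : normedModType R) (h : V -> R) (x : V) :
  {for x, continuous h} -> exists2 M, 0 < M & \near x, `|h x| <= M.
Proof.
move=> /cvgrPdist_le hc; exists (`|h x| + 1); first by rewrite ltr_wpDl.
apply: filterS (hc 1 ltr01) => y hy.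
have -> : h y = h x - (h x - h y) by ring.
by apply: le_trans (ler_normB _ _) _; rewrite lerD2l.
Qed.

Lemma norm_coord_le (R : realType) m n (x : 'M[R]_(m, n)) i j : `|x i j| <= `|x|.
Proof.
rewrite [leRHS]mx_normrE.
exact: (le_bigmax 0 (fun ij : 'I_m * 'I_n => `|x ij.1 ij.2|) (i, j)).
Qed.

Section Curvature.
Context (R : realType) (U : set 'rV[R]_2) (f : 'rV[R]_2 -> 'rV[R]_4).
Context (m1 m2 n1 n2 : 'rV[R]_4).
Hypothesis U_open : open U.
Hypothesis f_shrinker : self_shrinker_on U f.
Hypothesis frame : parseval_frame m1 m2 n1 n2.
Hypothesis rank_m : rank1_components (fun v y => 'D_v f y) U m1 m2.
Hypothesis rank_n : rank1_components (fun v y => 'D_v f y) U n1 n2.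
Let p y := dotv (f y) m1.
Let q y := dotv (f y) m2.

Let f_smooth : smooth_on U f := f_shrinker.1.1.

Lemma factor_derivative_neq0 y (u : 'rV[R]_2) : U y -> u != 0 ->
  dotv ('D_u f y) n1 = 0 -> dotv ('D_u f y) n2 = 0 ->
  0 < 'D_u p y ^+ 2 + 'D_u q y ^+ 2.
Proof.
move=> Uy u0 h1 h2; have df := smooth_differentiable f_smooth Uy.
rewrite lt_neqAle addr_ge0 ?sqr_ge0// andbT eq_sym; apply/negP => /eqP h.
have [_ pE] := component_derive m1 f_smooth u Uy.
have [_ qE] := component_derive m2 f_smooth u Uy.
rewrite pE qE in h.
have : 'D_u f y = 0.
  by apply: dotv_self_eq0; rewrite frame h1 h2 !mulr0 addr0 addr0 -!expr2.
rewrite deriveE// => h3; move/eqP: u0; apply.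
by apply: (f_shrinker.1.2 y Uy); rewrite h3 linear0.
Qed.

(** The rank one relation gives [dp = a l] and [dq = b l] at [y] for a linear form [l] with
    [l k = 1]. Let [h] be the Hessian paired with [N = a m2 - b m1], which is normal to the surface.
    Differentiating the relation gives [h x w = l w * h x k], and by symmetry
    [h x w = l x * l w * h k k]. The trace in the shrinker equation is thus [h k k] times the
    squared length of [l] in the inverse metric, which equals [1 / r2]. *)
Lemma factor_curvature (k : 'rV[R]_2) y v : U y ->
  0 < 'D_k p y ^+ 2 + 'D_k q y ^+ 2 ->
  'D_k p y * 'D_v ('D_k q) y - 'D_v ('D_k p) y * 'D_k q y =
    (p y * 'D_k q y - q y * 'D_k p y) *
    ('D_k p y * 'D_v p y + 'D_k q y * 'D_v q y).
Proof.
move=> Uy; have df := smooth_differentiable f_smooth Uy.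
have pE w z (Uz : U z) : 'D_w p z = dotv ('D_w f z) m1.
  by have [_ ->] := component_derive m1 f_smooth w Uz.
have qE w z (Uz : U z) : 'D_w q z = dotv ('D_w f z) m2.
  by have [_ ->] := component_derive m2 f_smooth w Uz.
set a := 'D_k p y; set b := 'D_k q y => r0.
pose r2 := a ^+ 2 + b ^+ 2.
have rn : r2 != 0 by rewrite gt_eqF.
pose l w := (a * 'D_w p y + b * 'D_w q y) / r2.
have rk w : 'D_w p y * b = 'D_w q y * a.
  by rewrite /a /b !pE// !qE// [RHS]mulrC; exact: rank_m.
have lp w : 'D_w p y = l w * a.
  have -> : l w * a = (a ^+ 2 * 'D_w p y + b * ('D_w q y * a)) / r2 by rewrite /l; field.
  rewrite -rk; have -> : a ^+ 2 * 'D_w p y + b * ('D_w p y * b) = 'D_w p y * r2.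
    by rewrite /r2; move: ('D_w p y) => x; ring.
  by rewrite mulfK.
have lq w : 'D_w q y = l w * b.
  have -> : l w * b = (a * ('D_w p y * b) + b ^+ 2 * 'D_w q y) / r2 by rewrite /l; field.
  rewrite rk; have -> : a * ('D_w q y * a) + b ^+ 2 * 'D_w q y = 'D_w q y * r2.
    by rewrite /r2; move: ('D_w q y) => x; ring.
  by rewrite mulfK.
pose h x w := a * 'D_x ('D_w q) y - 'D_x ('D_w p) y * b.
have hl x w : h x w = l w * h x k.
  have E : \near y, ('D_w p * 'D_k q) y = ('D_w q * 'D_k p) y.
    have : nbhs y U by exact: open_nbhs_nbhs.
    by apply: filterS => z Uz /=; rewrite /GRing.mul /= !pE// !qE// [RHS]mulrC; exact: rank_m.
  have dd m w' : derivable ('D_w' (fun y => dotv (f y) m)) y x.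
    by have [d _] := component_derive2 m U_open f_smooth x w' Uy.
  have H := near_eq_derive x E.
  rewrite (deriveM (dd m1 w) (dd m2 k)) (deriveM (dd m2 w) (dd m1 k)) in H.
  rewrite -/p -/q -/a -/b (lp w) (lq w) /GRing.scale /= in H.
  rewrite /h; move: H.
  move: ('D_x ('D_k q) y) ('D_x ('D_w p) y) ('D_x ('D_k p) y) ('D_x ('D_w q) y).
  move=> A B C D; move: (l w) (a) (b) => lw a' b' H; apply/eqP; rewrite -subr_eq0.
  have -> : a' * D - B * b' - lw * (a' * A - C * b') =
    (lw * b' * C + a' * D) - (lw * a' * A + b' * B) by ring.
  by rewrite H subrr.
have hs x w : h x w = h w x.
  by rewrite /h (component_derive_commute m1 U_open f_smooth x w Uy)
             (component_derive_commute m2 U_open f_smooth x w Uy).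
have lk : l k = 1 by rewrite /l -/a -/b -!expr2 divff.
have hE x w : h x w = a * 'D_x ('D_w q) y - 'D_x ('D_w p) y * b by exact: erefl.
have lE w : l w = (a * 'D_w p y + b * 'D_w q y) / r2 by exact: erefl.
clearbody h.
clearbody l.
have hll x w : h x w = l x * l w * h k k.
  by rewrite (hl x w) (hs x k) (hl k x) mulrA (mulrC (l w)).
suff t : h k k = r2 * (p y * b - q y * a).
  rewrite -hE (hll v k) lk mulr1 t lE; move: ('D_v p y) ('D_v q y) => X Y.
  by field.
(* The vector [u] has no component in the second factor, so the metric pairs it with the others
   through the first factor alone: [u g = (l u * r2) L]. This evaluates the inverse metric on [L]
   without computing the inverse. *)
have [u u0 [un1 un2]] := rank1_kernel df (fun v w => rank_n v w Uy).
have lu0 : l u != 0.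
  have := factor_derivative_neq0 Uy u0 un1 un2; rewrite lp lq => hu.
  by apply/eqP => e; move: hu; rewrite e !mul0r expr0n addr0 ltxx.
pose N := a *: m2 - b *: m1.
have NE X : dotv X N = a * dotv X m2 - dotv X m1 * b.
  by rewrite /N dotvC dotvBl !dotvZl (dotvC m2) (dotvC m1) (mulrC b).
have := shrinker_normal_component f_shrinker Uy (N := N).
have -> : dotv (f y) N = a * q y - p y * b by rewrite NE.
have NT w : dotv ('D_w f y) N = 0.
  by rewrite NE -pE// -qE// rk mulrC subrr.
move=> /(_ NT).
set g := first_fundamental_form f y; set W := invmx g.
pose L : 'rV[R]_2 := \row_j l (delta_mx 0 j).
have gu : g \in unitmx by apply: first_fundamental_form_unit => //; exact: (f_shrinker.1.2 y Uy).
have ug : u *m g = (l u * r2) *: L.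
  apply/rowP => j; rewrite /g /first_fundamental_form mulmxA -deriveEjacobian//.
  have -> : ('D_u f y *m ('J f y)^T) 0 j = dotv ('D_u f y) (row j ('J f y)).
    by rewrite mxE; apply: eq_bigr => i _; rewrite !mxE.
  rewrite row_jacobian// [RHS]mxE [L 0 j]mxE.
  apply: (parseval_frame_eq frame un1 un2); rewrite -?(pE _ _ Uy) -?(qE _ _ Uy) ?lp ?lq//.
have lin w b' : dotv ('D_w f y) b' = \sum_j w 0 j * dotv ('D_(delta_mx 0 j) f y) b'.
  by rewrite derive_row_linear// dotv_suml; apply: eq_bigr => j _; rewrite dotvZl.
have lL : (u *m L^T) 0 0 = l u.
  rewrite mxE lE !pE// !qE// (lin u m1) (lin u m2) !mulr_sumr -big_split mulr_suml.
  apply: eq_bigr => j _; rewrite [L^T _ _]mxE [L _ _]mxE lE pE// qE//=.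
  by move: (dotv _ m1) (dotv _ m2) (u 0 j) => x x' x''; ring.
have LWL : \sum_(i < 2) \sum_(j < 2) W i j * (L 0 i * L 0 j) = r2^-1.
  transitivity ((L *m W *m L^T) 0 0).
    rewrite exchange_big [RHS]mxE; apply: eq_bigr => j _.
    rewrite [L^T _ _]mxE [(L *m W) _ _]mxE mulr_suml.
    by apply: eq_bigr => i _; rewrite mulrA [W i j * _]mulrC.
  have c0 : l u * r2 != 0 by rewrite mulf_neq0.
  have LE : L = (l u * r2)^-1 *: (u *m g) by rewrite ug scalerA mulVf// scale1r.
  rewrite {1}LE -scalemxAl mulmxK// -scalemxAl mxE lL; field.
  by rewrite rn lu0.
have -> : \sum_(i < 2) \sum_(j < 2) W i j * dotv ('D_(delta_mx 0 i) ('D_(delta_mx 0 j) f) y) N = r2^-1 * h k k.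
  rewrite -LWL mulr_suml; apply: eq_bigr => i _; rewrite mulr_suml; apply: eq_bigr => j _.
  rewrite -mulrA; congr (_ * _); rewrite NE.
  have [_ <-] := component_derive2 m1 U_open f_smooth (delta_mx 0 i) (delta_mx 0 j) Uy.
  have [_ <-] := component_derive2 m2 U_open f_smooth (delta_mx 0 i) (delta_mx 0 j) Uy.
  by rewrite -hE hll [L 0 i]mxE [L 0 j]mxE.
move=> E.
have -> : h k k = r2 * (r2^-1 * h k k) by field.
by congr (_ * _); move/eqP: E; rewrite addr_eq0 => /eqP ->; rewrite opprB mulrC (mulrC a).
Qed.
(** The direction [k] is taken in the kernel of the second factor at [x0] only and kept constant;
    regularity of the first factor along it persists nearby by continuity. [C] adds up local bounds
    of the four partial derivatives. *)
Lemma factor_patch_exists (x0 : 'rV[R]_2) (r : R) : U x0 ->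
  (forall y, U y -> `|p y| <= r /\ `|q y| <= r) ->
  exists e k C, [/\ 0 < e, 0 < C, ball x0 e `<=` U & factor_patch (ball x0 e) p q k r C].
Proof.
move=> Ux0 bnd; have df := smooth_differentiable f_smooth Ux0.
have [k k0 [kn1 kn2]] := rank1_kernel df (fun v w => rank_n v w Ux0).
have s0 := factor_derivative_neq0 Ux0 k0 kn1 kn2.
have cp w := @component_continuous_derive _ _ _ _ _ m1 U_open f_smooth w _ Ux0.
have cq w := @component_continuous_derive _ _ _ _ _ m2 U_open f_smooth w _ Ux0.
have N1 : \near x0, 0 < 'D_k p x0 ^+ 2 + 'D_k q x0 ^+ 2.
  have c : 'D_k p y * 'D_k p y + 'D_k q y * 'D_k q y @[y --> x0] -->
      'D_k p x0 * 'D_k p x0 + 'D_k q x0 * 'D_k q x0.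
    exact: (cvgD (cvgM (cp k) (cp k)) (cvgM (cq k) (cq k))).
  rewrite !expr2 in s0; apply: filterS (cvgr_gt _ c 0 s0) => y.
  by rewrite !expr2.
pose e0 : 'rV[R]_2 := delta_mx 0 0; pose e1 : 'rV[R]_2 := delta_mx 0 1.
have [M0 M00 B0] := near_bounded (cp e0); have [M1 M10 B1] := near_bounded (cp e1).
have [M2 M20 B2] := near_bounded (cq e0); have [M3 M30 B3] := near_bounded (cq e1).
have NU : nbhs x0 U by exact: open_nbhs_nbhs.
have N := filterI NU (filterI N1 (filterI B0 (filterI B1 (filterI B2 B3)))).
have [e /= epos eA] := (@nbhs_ballP _ _ x0 _).1 (N _ _ _ _ _).
pose C := M0 + M1 + M2 + M3.
have C0 : 0 < C by rewrite !addr_gt0.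
exists e, k, C; split; [exact: epos|exact: C0|by move=> y /eA []|].
split.
- move=> y v /eA [Uy _].
  have [d1 _] := component_derive m1 f_smooth v Uy.
  have [d2 _] := component_derive m2 f_smooth v Uy.
  exact: (conj d1 d2).
- move=> y v w /eA [Uy _].
  have [d1 _] := component_derive2 m1 U_open f_smooth v w Uy.
  have [d2 _] := component_derive2 m2 U_open f_smooth v w Uy.
  exact: (conj d1 d2).
- by move=> y /eA [_ []].
- move=> y v /eA [Uy _].
  have [_ ->] := component_derive m1 f_smooth v Uy.
  have [_ ->] := component_derive m1 f_smooth k Uy.
  have [_ ->] := component_derive m2 f_smooth v Uy.
  have [_ ->] := component_derive m2 f_smooth k Uy.
  rewrite [RHS]mulrC; exact: rank_m.
- by move=> y v /eA [Uy [ps _]]; exact: factor_curvature.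
- by move=> y /eA [Uy _]; exact: bnd.
- move=> y v /eA [Uy [_ [b0 [b1 [b2 b3]]]]].
  have v0 := norm_coord_le v 0 0; have v1 := norm_coord_le v 0 1.
  have nv : 0 <= `|v| by [].
  have dfy := smooth_differentiable f_smooth Uy.
  have est (x x' M M' : R) : `|x| <= M -> `|x'| <= M' -> M + M' <= C ->
      `|v 0 0 * x + v 0 1 * x'| <= C * `|v|.
    move=> hx hx' hC; apply: le_trans (ler_normD _ _) _; rewrite !normrM.
    apply: (@le_trans _ _ (`|v| * M + `|v| * M')); first by apply: lerD; apply: ler_pM.
    by rewrite -mulrDr mulrC ler_wpM2r.
  have lin m w : dotv ('D_w f y) m = w 0 0 * dotv ('D_e0 f y) m + w 0 1 * dotv ('D_e1 f y) m.
    by rewrite (derive_rV2 w dfy) -/e0 -/e1; exact: dotv_scaleD.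
  have [_ p0] := component_derive m1 f_smooth e0 Uy.
  have [_ p1] := component_derive m1 f_smooth e1 Uy.
  have [_ q0] := component_derive m2 f_smooth e0 Uy.
  have [_ q1] := component_derive m2 f_smooth e1 Uy.
  have [_ pv] := component_derive m1 f_smooth v Uy.
  have [_ qv] := component_derive m2 f_smooth v Uy.
  pose comb (a b : R) := v 0 0 * a + v 0 1 * b.
  have pE : 'D_v p y = comb ('D_e0 p y) ('D_e1 p y).
    exact: etrans pv (etrans (lin m1 v) (esym (congr2 comb p0 p1))).
  have qE : 'D_v q y = comb ('D_e0 q y) ('D_e1 q y).
    exact: etrans qv (etrans (lin m2 v) (esym (congr2 comb q0 q1))).
  have MC : M0 + M1 <= C by rewrite /C -[_ + M2 + M3]addrA lerDl; apply: addr_ge0; exact: ltW.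
  have MC' : M2 + M3 <= C by rewrite /C -[_ + M2 + M3]addrA lerDr; apply: addr_ge0; exact: ltW.
  rewrite pE qE; exact: (conj (est _ _ _ _ b0 b1 MC) (est _ _ _ _ b2 b3 MC')).
Qed.

End Curvature.

(** * First order behaviour of immersions *)

Lemma near_differential (R : realType) (V W : normedModType R) (f : V -> W) (x : V)
    (e : R) : differentiable f x -> 0 < e ->
  \forall y \near x, `|f y - f x - 'd f x (y - x)| <= e * `|y - x|.
Proof.
move=> [[_ df]] e0; have := eqadd_some_oP df e0; rewrite norm_lim_id.
by apply: filterS => y h; rewrite -addrA -opprD; exact: h.
Qed.

Lemma mulmx_bounded (R : realType) m n (B : 'M[R]_(m, n)) :
  exists2 K, 0 < K & forall v : 'rV[R]_m, `|v *m B| <= K * `|v|.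
Proof.
pose K := 1 + \sum_(i < m) \sum_(j < n) `|B i j|.
have K0 : 0 < K by rewrite ltr_wpDr// sumr_ge0// => i _; rewrite sumr_ge0.
exists K => // v; rewrite [leLHS]mx_normrE; apply: bigmax_le.
  by rewrite mulr_ge0// ltW.
move=> [i j] _ /=; rewrite !mxE; apply: le_trans (ler_norm_sum _ _ _) _.
have -> : K * `|v| = `|v| + \sum_(k < m) (\sum_(l < n) `|B k l|) * `|v|.
  by rewrite /K mulrDl mul1r mulr_suml.
apply: ler_wpDl => //; apply: ler_sum => k _; rewrite normrM mulrC.
apply: ler_pM => //; last exact: norm_coord_le.
by rewrite (bigD1 j)//= lerDl sumr_ge0.
Qed.

(** The differential has a left inverse of norm at most [K]; near [x] the error of linearisation is
    at most half of [|y - x|] after applying it and is absorbed, which doubles the constant. *)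
Lemma immersion_expansive (R : realType) m n (f : 'rV[R]_m -> 'rV[R]_n) (x : 'rV[R]_m) :
  differentiable f x -> injective ('d f x) ->
  exists2 K, 0 < K & \forall y \near x, `|y - x| <= K * `|f y - f x|.
Proof.
move=> df inj; have J_free : row_free ('J f x).
  apply: inj_row_free => v; rewrite -deriveEjacobian// deriveE// => h.
  by apply: inj; rewrite h linear0.
have [K K0 hK] := mulmx_bounded (pinvmx ('J f x)).
have dK v : `|v| <= K * `|'d f x v|.
  have {1}-> : v = 'd f x v *m pinvmx ('J f x).
    by rewrite -deriveE// deriveEjacobian// -mulmxA mulmxVp ?mulmx1.
  exact: hK.
exists (2 * K); first by rewrite mulr_gt0.
have e0 : 0 < (2 * K)^-1 by rewrite invr_gt0 mulr_gt0.
apply: filterS (near_differential df e0) => y hy.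
have := dK (y - x); have -> : 'd f x (y - x) = (f y - f x) - (f y - f x - 'd f x (y - x)).
  by rewrite [RHS]addrC opprB subrK.
move=> h.
have h2 : K * `|f y - f x - (f y - f x - 'd f x (y - x))| <=
    K * `|f y - f x| + `|y - x| / 2.
  have -> : K * `|f y - f x| + `|y - x| / 2 = K * (`|f y - f x| + (2 * K)^-1 * `|y - x|).
    by field; rewrite gt_eqF.
  rewrite ler_pM2l//; apply: le_trans (ler_normB _ _) _; rewrite lerD2l; exact: hy.
by have := le_trans h h2; move: `|y - x| `|f y - f x| => s t; lra.
Qed.

(** The error is measured by the distance in the image rather than in the chart, so the test applies
    to points of which only the images are known. *)
Lemma immersion_tangent_test (R : realType) m n (f : 'rV[R]_m -> 'rV[R]_n)
    (x : 'rV[R]_m) (N : 'rV[R]_n) (e : R) :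
  differentiable f x -> injective ('d f x) ->
  (forall v, dotv ('D_v f x) N = 0) -> 0 < e ->
  \forall y \near x, `|dotv (f y - f x) N| <= e * `|f y - f x|.
Proof.
move=> df inj NT e0.
have [K K0 hK] := immersion_expansive df inj.
have [L L0 hL] := mulmx_bounded N^T.
have d0 : 0 < e / (K * L) by rewrite divr_gt0// mulr_gt0.
apply: filterS (filterI hK (near_differential df d0)) => y [h1 h2].
have -> : dotv (f y - f x) N = dotv (f y - f x - 'd f x (y - x)) N.
  by rewrite [RHS]dotvBl -deriveE// NT subr0.
rewrite dotvE; apply: le_trans (norm_coord_le _ _ _) _; apply: le_trans (hL _) _.
apply: (@le_trans _ _ (L * (e / (K * L) * (K * `|f y - f x|)))).
  rewrite ler_pM2l//; apply: le_trans h2 _; rewrite ler_pM2l//.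
by rewrite le_eqVlt; apply/orP; left; apply/eqP; field; rewrite !gt_eqF.
Qed.

Lemma near_difference_quotient (R : realType) (V W : normedModType R) (f : V -> W)
    (x v : V) (e : R) : differentiable f x -> 0 < e ->
  \forall h \near (0 : R)^', `|h^-1 *: (f (x + h *: v) - f x) - 'D_v f x| <= e.
Proof.
move=> df e0; have dv : derivable f x v by exact: diff_derivable.
have /cvgrPdist_le/(_ e e0) := dv.
apply: filterS => h /=; rewrite distrC [h *: v + x]addrC; exact.
Qed.

(** * Tangent planes of an immersed manifold *)

Section Tangents.
Context (R : realType) (m n : nat) (S : topologicalType).
Context (A : set (chart R m S)) (F : S -> 'rV[R]_n).
Hypothesis A_atlas : smooth_atlas A.
Hypothesis F_immersion : forall c, A c -> immersion_on (chart_cod c) (F \o chart_inv c).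

Definition tangent (s : S) : set 'rV[R]_n :=
  [set w | exists c : chart R m S, [/\ A c, chart_dom c s &
    exists v, w = 'D_v (F \o chart_inv c) (chart_map c s)]].

Lemma chart_cod_map (c : chart R m S) s : chart_dom c s -> chart_cod c (chart_map c s).
Proof. exact: chart_map_cod. Qed.

Lemma immersion_differentiable (c : chart R m S) x : A c -> chart_cod c x ->
  differentiable (F \o chart_inv c) x.
Proof. by move=> /F_immersion [sm _]; exact: smooth_differentiable. Qed.

Lemma derive_chart_change (c d : chart R m S) s v : A c -> A d -> chart_dom c s -> chart_dom d s ->
  exists v', 'D_v (F \o chart_inv c) (chart_map c s) =
             'D_v' (F \o chart_inv d) (chart_map d s).
Proof.
move=> Ac Ad cs ds; have cx := chart_cod_map cs; have dx := chart_cod_map ds.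
pose tau := chart_map d \o chart_inv c.
have tauE : tau (chart_map c s) = chart_map d s by rewrite /tau /= chart_mapK.
have dtau : differentiable tau (chart_map c s).
  have [_ /(_ c d Ac Ad) sm] := A_atlas.
  apply: (smooth_differentiable sm); split=> //=.
  by rewrite chart_mapK.
have dF : differentiable (F \o chart_inv d) (tau (chart_map c s)).
  by rewrite tauE; exact: immersion_differentiable.
have E : \forall y \near chart_map c s,
    (F \o chart_inv d \o tau) y = (F \o chart_inv c) y.
  have : nbhs (chart_inv c (chart_map c s)) (chart_dom d).
    by rewrite chart_mapK//; apply: open_nbhs_nbhs; split => //; exact: chart_dom_open.
  move=> /(chart_inv_continuous cx) h.
  have h' : \forall y \near chart_map c s, chart_dom d (chart_inv c y) by exact: h.
  apply: filterS h' => y dy.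
  by rewrite /tau /= chart_mapK.
exists ('d tau (chart_map c s) v).
rewrite -(near_eq_derive v E) deriveE; last exact: differentiable_comp.
by rewrite diff_comp// deriveE ?tauE//; exact: immersion_differentiable.
Qed.

Lemma tangent_chart (d : chart R m S) s w : A d -> chart_dom d s -> tangent s w ->
  exists v, w = 'D_v (F \o chart_inv d) (chart_map d s).
Proof.
by move=> Ad ds [c [Ac cs [v ->]]]; exact: derive_chart_change.
Qed.

Lemma near_chart (c : chart R m S) s (P : set 'rV[R]_m) : chart_dom c s ->
  nbhs (chart_map c s) P -> \forall s' \near s, chart_dom c s' /\ P (chart_map c s').
Proof.
move=> cs hP; have N : nbhs s (chart_dom c).
  by apply: open_nbhs_nbhs; split => //; exact: chart_dom_open.
by apply: filterI => //; exact: chart_map_continuous cs _ hP.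
Qed.

Lemma immersion_continuous : continuous F.
Proof.
move=> s; have [c Ac cs] := A_atlas.1 s; have cx := chart_cod_map cs.
have fc := differentiable_continuous (immersion_differentiable Ac cx).
have gc := continuous_comp (chart_map_continuous cs) fc.
have E : \forall s' \near s, (F \o chart_inv c \o chart_map c) s' = F s'.
  have : nbhs s (chart_dom c).
    by apply: open_nbhs_nbhs; split => //; exact: chart_dom_open.
  by apply: filterS => s' cs'; rewrite /= chart_mapK.
rewrite /continuous_at -(nbhs_singleton E).
exact: cvg_trans (near_eq_cvg E) gc.
Qed.

Lemma tangent_test (s : S) (N : 'rV[R]_n) (e : R) :
  (forall w, tangent s w -> dotv w N = 0) -> 0 < e ->
  \forall s' \near s, `|dotv (F s' - F s) N| <= e * `|F s' - F s|.
Proof.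
move=> NT e0; have [c Ac cs] := A_atlas.1 s; have cx := chart_cod_map cs.
have df := immersion_differentiable Ac cx.
have inj := (F_immersion Ac).2 _ cx.
have NT' v : dotv ('D_v (F \o chart_inv c) (chart_map c s)) N = 0.
  by apply: NT; exists c; split => //; exists v.
apply: filterS (near_chart cs (immersion_tangent_test df inj NT' e0)) => s' [cs'].
by rewrite /= !chart_mapK.
Qed.

Lemma immersion_locally_injective (s : S) :
  \forall s' \near s, F s' = F s -> s' = s.
Proof.
have [c Ac cs] := A_atlas.1 s; have cx := chart_cod_map cs.
have df := immersion_differentiable Ac cx.
have inj := (F_immersion Ac).2 _ cx.
have [K K0 hK] := immersion_expansive df inj.
apply: filterS (near_chart cs hK) => s' [cs'] /=; rewrite !chart_mapK// => h e.
have : `|chart_map c s' - chart_map c s| <= 0.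
  by apply: le_trans h _; rewrite e subrr normr0 mulr0.
rewrite normr_le0 subr_eq0 => /eqP e'.
by rewrite -(chart_mapK cs') e' chart_mapK.
Qed.

End Tangents.

(** * Reflected tangent planes are isotropic *)

Lemma big_ord4 (R : pzRingType) (f : 'I_4 -> R) :
  \sum_(i < 4) f i = f 0 + f 1 + f 2 + f 3.
Proof.
rewrite !big_ord_recl big_ord0 addr0 !addrA.
by congr (f _ + f _ + f _ + f _); exact: val_inj.
Qed.

Lemma near_dist_le (R : numFieldType) (T : topologicalType)
    (V : pseudoMetricNormedZmodType R) (f : T -> V) (x : T) (e : R) :
  {for x, continuous f} -> 0 < e -> \forall y \near x, `|f x - f y| <= e.
Proof. by move=> /cvgrPdist_le; exact. Qed.

Lemma le0_of_le_small (R : realType) (x K : R) : 0 < K ->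
  (forall e, 0 < e -> e <= 1 -> x <= e * K) -> x <= 0.
Proof.
move=> K0 h; apply/ler_addgt0Pl => e e0; rewrite addr0.
have eK : 0 < e / K by rewrite divr_gt0.
have m0 : 0 < Num.min 1 (e / K) by rewrite lt_min ltr01.
apply: le_trans (h _ m0 _) _; first by rewrite ge_min lexx.
by rewrite -ler_pdivlMr// ge_min lexx orbT.
Qed.

Section Kahler.
Context (R : realType).
Implicit Types u v w : 'rV[R]_4.

Definition kahler_mx : 'M[R]_4 := \matrix_(i, j)
  (if (i == 0) && (j == 1) then 1 else if (i == 1) && (j == 0) then -1
   else if (i == 2) && (j == 3) then 1 else if (i == 3) && (j == 2) then -1 else 0).

Lemma kahler_mulmx u v : kahler_form u v = (u *m kahler_mx *m v^T) 0 0.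
Proof.
rewrite mxE big_ord4 !mxE !big_ord4 !mxE /=.
by rewrite /kahler_form; ring.
Qed.

Lemma kahler_dotv u v : kahler_form u v = dotv u (v *m kahler_mx^T).
Proof. by rewrite kahler_mulmx dotvE trmx_mul trmxK mulmxA. Qed.

Lemma kahlerDl u u' v : kahler_form (u + u') v = kahler_form u v + kahler_form u' v.
Proof. by rewrite !kahler_dotv dotvDl. Qed.

Lemma kahlerZl a u v : kahler_form (a *: u) v = a * kahler_form u v.
Proof. by rewrite !kahler_dotv dotvZl. Qed.

Lemma kahlerC u v : kahler_form u v = - kahler_form v u.
Proof. by rewrite /kahler_form; ring. Qed.

Lemma kahler_mx_unit : kahler_mx \in unitmx.
Proof.
rewrite -row_free_unit; apply: inj_row_free => u h.
apply: dotv_self_eq0; pose w : 'rV[R]_4 := \row_j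
  (if j == 0 then - u 0 1 else if j == 1 then u 0 0
   else if j == 2 then - u 0 3 else u 0 2).
have : kahler_form u w = 0 by rewrite kahler_mulmx h mul0mx mxE.
by rewrite /kahler_form !mxE /= /dotv big_ord4 => <-; ring.
Qed.

(** A Lagrangian plane is its own symplectic complement: it lies in it, and both have dimension 2
    because the form is nondegenerate. Hence [u] and [v] belong to the plane. *)
Lemma isotropic_complement (J : 'M[R]_(2, 4)) u v : row_free J ->
  (forall a b : 'rV_2, kahler_form (a *m J) (b *m J) = 0) ->
  (forall a : 'rV_2, kahler_form u (a *m J) = 0) ->
  (forall a : 'rV_2, kahler_form v (a *m J) = 0) -> kahler_form u v = 0.
Proof.
move=> Jf JJ uJ vJ; pose K := kahler_mx *m J^T.
have rK : \rank K = 2%N.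
  have h : row_full kahler_mx by rewrite row_full_unit kahler_mx_unit.
  by rewrite (eqmxMfull _ h) mxrank_tr; apply/eqP.
have kK w : (forall a : 'rV_2, kahler_form w (a *m J) = 0) -> (w <= kermx K)%MS.
  move=> h; apply/sub_kermxP/rowP => j; have := h (delta_mx 0 j).
  rewrite kahler_mulmx -rowE => e.
  rewrite [RHS]mxE -[RHS]e /K mulmxA !mxE.
  by apply: eq_bigr => i _; rewrite !mxE.
have JK : (J <= kermx K)%MS.
  apply/row_subP => i; apply: kK => a; rewrite rowE; exact: JJ.
have KJ : (kermx K <= J)%MS.
  have [_ <-] := mxrank_leqif_sup JK.
  by rewrite mxrank_ker rK (eqP Jf).
have /submxP[a ->] := submx_trans (kK _ uJ) KJ.
have /submxP[b ->] := submx_trans (kK _ vJ) KJ.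
exact: JJ.
Qed.

End Kahler.

Lemma affine_two_roots (R : idomainType) (x y a b : R) :
  a != b -> x + a * y = 0 -> x + b * y = 0 -> x = 0 /\ y = 0.
Proof.
move=> ab h1 h2; have : (a - b) * y = 0.
  have -> : (a - b) * y = (x + a * y) - (x + b * y) by ring.
  by rewrite h1 h2 subrr.
move/eqP; rewrite mulf_eq0 subr_eq0 (negbTE ab) /= => /eqP y0.
by move: h1; rewrite y0 mulr0 addr0.
Qed.

Section Reflected.
Context (R : realType) (S : topologicalType).
Context (A : set (chart R 2 S)) (F : S -> 'rV[R]_4).
Hypothesis A_atlas : smooth_atlas A.
Hypothesis S_compact : compact [set: S].
Hypothesis F_immersion : forall c, A c -> immersion_on (chart_cod c) (F \o chart_inv c).
Hypothesis F_lagrangian : lagrangian A F.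
Context (B : 'M[R]_4) (t : 'rV[R]_4).
Hypothesis F_symmetric : forall s, exists q, F q = F s *m B + t.

Lemma tangent_lagrangian s u v : tangent A F s u -> tangent A F s v -> kahler_form u v = 0.
Proof.
move=> Tu [c [Ac cs [b ->]]].
have [a ->] := tangent_chart A_atlas F_immersion Ac cs Tu.
have df := immersion_differentiable F_immersion Ac (chart_map_cod cs).
rewrite !deriveE//; exact: F_lagrangian (chart_map_cod cs) a b.
Qed.

(** Tangency at [q] is expressed as symplectic orthogonality to the Lagrangian tangent plane there.
    The preimage [q] may depend on [v], which is why a second argument is needed to treat two
    vectors at once. *)
Lemma reflected_tangent (c : chart R 2 S) s v : A c -> chart_dom c s ->
  exists2 q, F q = F s *m B + t & forall w, tangent A F q w ->
    kahler_form ('D_v (F \o chart_inv c) (chart_map c s) *m B) w = 0.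
Proof.
move=> Ac cs; have cx := chart_map_cod cs.
set x := chart_map c s; pose f := F \o chart_inv c; pose D := 'D_v f x.
have df : differentiable f x by apply: immersion_differentiable Ac cx.
have fx : f x = F s by rewrite /f /= chart_mapK.
have [q qP] : {q : R -> S & forall h, F (q h) = f (x + h *: v) *m B + t}.
  by apply: (choice (P := fun h q => F q = f (x + h *: v) *m B + t)) => h; exact: F_symmetric.
(* The preimages [q h] are chosen without any continuity in [h]; a cluster point as [h] tends to 0
   replaces a limit. *)
have [q0 [_ q0cl]] : [set: S] `&` cluster (q @ (0 : R)^') !=set0.
  exact: S_compact (filterT : (q @ (0 : R)^') [set: S]).
have [M M0 hM] := mulmx_bounded B.
pose delta (h : R) := h^-1 *: (f (x + h *: v) - f x).
have fq h : h != 0 -> F (q h) - (F s *m B + t) = h *: (delta h *m B).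
  move=> h0; rewrite qP opprD addrACA subrr addr0 -fx -mulmxBl scalemxAl.
  by rewrite /delta scalerA mulfV// scale1r.
have dB (e : R) : 0 < e -> \forall h \near (0 : R)^', [/\ h != 0, `|h| <= e, `|delta h - D| <= e &
    `|F (q h) - (F s *m B + t)| <= e * (M * (`|D| + e))].
  move=> e0; have d := near_difference_quotient v df e0.
  apply: filterS (filterI (nbhs_dnbhs_neq (0 : R)) (filterI (dnbhs0_le e0) d)) => h [/= h0 [he hd]].
  split => //; rewrite fq// normrZ; apply: ler_pM => //.
  apply: le_trans (hM _) _; rewrite ler_pM2l//.
  rewrite -[delta h](subrK D) addrC; apply: le_trans (ler_normD _ _) _.
  by rewrite lerD2l.
have cl (P : set R) (Q : set S) : (\forall h \near (0 : R)^', P h) -> nbhs q0 Q ->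
    exists2 h, P h & Q (q h).
  move=> hP hQ; have [||_ [[h Ph <-] Qh]] := q0cl (q @` P) Q.
  - by apply: filterS hP => h Ph; exists h.
  - exact: hQ.
  by exists h.
have Fc := immersion_continuous A_atlas F_immersion.
have Fq0 : F q0 = F s *m B + t.
  apply/eqP; rewrite -subr_eq0 -normr_le0.
  apply: (@le0_of_le_small _ _ (1 + M * (`|D| + 1))) => [|e e0 e1].
    by rewrite ltr_wpDr// mulr_ge0 ?ltW// ltr_wpDl.
  have [h [_ _ _ h1] h2] := cl _ _ (dB e e0) (near_dist_le (Fc q0) e0).
  rewrite -[F q0](subrK (F (q h))) -addrA; apply: le_trans (ler_normD _ _) _.
  rewrite mulrDr mulr1; apply: lerD h2 _; apply: le_trans h1 _.
  by rewrite !ler_pM2l// lerD2l.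
(* Rotating the tangent vector [w] gives a vector [N] normal to the surface at [q0], since the
   tangent plane there is Lagrangian. The secants [delta h *m B] are nearly orthogonal to [N], and
   they converge to [D *m B]. *)
exists q0 => // w Tw; rewrite kahler_dotv; set N := w *m _.
have NT w' : tangent A F q0 w' -> dotv w' N = 0.
  by move=> Tw'; rewrite -kahler_dotv; exact: tangent_lagrangian Tw' Tw.
have [L L0 hL] := mulmx_bounded N^T.
have LN z : `|dotv z N| <= L * `|z|.
  by rewrite dotvE; apply: le_trans (norm_coord_le _ _ _) _.
apply/eqP; rewrite -normr_le0.
apply: (@le0_of_le_small _ _ (M * (`|D| + 1) + L * M)) => [|e e0 e1].
  by rewrite ltr_wpDl ?mulr_gt0// mulr_ge0 ?ltW// ltr_wpDl.
have [h [h0 he hd _] h2] := cl _ _ (dB e e0) (tangent_test A_atlas F_immersion NT e0).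
move: h2; rewrite /= Fq0 fq// dotvZl normrM normrZ mulrCA ler_pM2l ?normr_gt0// => h2.
have -> : D *m B = delta h *m B - (delta h - D) *m B by rewrite mulmxBl opprB addrC subrK.
rewrite dotvBl; apply: le_trans (ler_normB _ _) _; rewrite mulrDr; apply: lerD.
  apply: le_trans h2 _; rewrite ler_pM2l//; apply: le_trans (hM _) _; rewrite ler_pM2l//.
  rewrite -[delta h](subrK D) addrC; apply: le_trans (ler_normD _ _) _.
  by rewrite lerD2l (le_trans hd).
apply: le_trans (LN _) _; rewrite mulrCA ler_pM2l//; apply: le_trans (hM _) _.
by rewrite mulrC ler_pM2r.
Qed.

Lemma reflected_isotropic (c : chart R 2 S) s u v : A c -> chart_dom c s ->
  kahler_form ('D_u (F \o chart_inv c) (chart_map c s) *m B)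
              ('D_v (F \o chart_inv c) (chart_map c s) *m B) = 0.
Proof.
move=> Ac cs; have cx := chart_map_cod cs.
set x := chart_map c s; pose f := F \o chart_inv c.
have df : differentiable f x by apply: immersion_differentiable Ac cx.
pose p := F s *m B + t; pose D w := 'D_w f x *m B.
have DE (k : nat) : D (u + k%:R *: v) = D u + k%:R *: D v.
  rewrite /D !deriveE// scalemxAl -mulmxDl; congr (_ *m _).
  by rewrite linearD linearZ.
have [q qP] : {q : nat -> S & forall k, F (q k) = p /\
    forall w, tangent A F (q k) w -> kahler_form (D (u + k%:R *: v)) w = 0}.
  apply: (choice (P := fun (k : nat) (q : S) => F q = p /\
    forall w, tangent A F q w -> kahler_form (D (u + k%:R *: v)) w = 0)) => k.
  by have [q h1 h2] := reflected_tangent (u + k%:R *: v) Ac cs; exists q.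
have [q0 [_ q0cl]] : [set: S] `&` cluster (q @ \oo) !=set0.
  exact: S_compact (filterT : (q @ \oo) [set: S]).
have cl n (Q : set S) : nbhs q0 Q -> exists2 k, (n <= k)%N & Q (q k).
  move=> hQ; have [||_ [[k nk <-] Qk]] := q0cl (q @` [set k | (n <= k)%N]) Q.
  - by apply: filterS (nbhs_infty_ge n) => k nk; exists k.
  - exact: hQ.
  by exists k.
have Fc := immersion_continuous A_atlas F_immersion.
have Fq0 : F q0 = p.
  apply/eqP; rewrite -subr_eq0 -normr_le0; apply/ler_addgt0Pl => e e0; rewrite addr0.
  by have [k _] := cl 0%N _ (near_dist_le (Fc q0) e0); rewrite (qP k).1.
have inj := immersion_locally_injective A_atlas F_immersion q0.
(* All the [q k] have the same image [p], so those close to [q0] are equal to it; asking for an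
   index beyond [k1] produces two different integers with the same preimage. *)
have [k1 _ e1] := cl 0%N _ inj; have [k2 k12 e2] := cl k1.+1 _ inj.
have {}e1 : q k1 = q0 by apply: e1; rewrite (qP k1).1.
have {}e2 : q k2 = q0 by apply: e2; rewrite (qP k2).1.
have h1 w : tangent A F q0 w -> kahler_form (D u) w + k1%:R * kahler_form (D v) w = 0.
  by rewrite -{1}e1 -kahlerZl -kahlerDl -DE; exact: (qP k1).2.
have h2 w : tangent A F q0 w -> kahler_form (D u) w + k2%:R * kahler_form (D v) w = 0.
  by rewrite -{1}e2 -kahlerZl -kahlerDl -DE; exact: (qP k2).2.
have k12n : k1%:R != k2%:R :> R by rewrite eqr_nat neq_ltn k12.
have huv w (Tw : tangent A F q0 w) := affine_two_roots k12n (h1 w Tw) (h2 w Tw).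
have [d Ad dq] := A_atlas.1 q0; have dx := chart_map_cod dq.
have dd := immersion_differentiable F_immersion Ad dx.
have T0 b : tangent A F q0 (b *m 'J (F \o chart_inv d) (chart_map d q0)).
  by exists d; split => //; exists b; rewrite deriveEjacobian.
apply: (@isotropic_complement _ ('J (F \o chart_inv d) (chart_map d q0))).
- apply: inj_row_free => b; rewrite -deriveEjacobian// deriveE// => h.
  by apply: ((F_immersion Ad).2 _ dx); rewrite h linear0.
- by move=> a b; apply: tangent_lagrangian.
- by move=> b; exact: (huv _ (T0 b)).1.
- by move=> b; exact: (huv _ (T0 b)).2.
Qed.

End Reflected.

(** * The Hermitian frame of a normal vector *)

Section HermitianFrame.
Context (R : realType).
Implicit Types u v n : 'rV[R]_4.

Definition row4 (a b c d : R) : 'rV[R]_4 := \row_j [:: a; b; c; d]`_j.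

Lemma dotv4 u v : dotv u v = u 0 0 * v 0 0 + u 0 1 * v 0 1 + u 0 2 * v 0 2 + u 0 3 * v 0 3.
Proof. exact: big_ord4. Qed.

(* Multiplication by i, and a vector spanning the Hermitian complement of n:
   (z1, z2) |-> (- conj z2, conj z1). *)
Definition imul n : 'rV[R]_4 := row4 (- n 0 1) (n 0 0) (- n 0 3) (n 0 2).
Definition hermitian_complement n : 'rV[R]_4 := row4 (- n 0 2) (n 0 3) (n 0 0) (- n 0 1).

Lemma dotv_imul u n :
  dotv u (imul n) = u 0 1 * n 0 0 - u 0 0 * n 0 1 + u 0 3 * n 0 2 - u 0 2 * n 0 3.
Proof. by rewrite dotv4 !mxE /=; ring. Qed.

Lemma kahler_imul u n : kahler_form u n = - dotv u (imul n).
Proof. by rewrite dotv_imul /kahler_form; ring. Qed.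

Lemma hermitian_frame_parseval n : dotv n n = 1 ->
  parseval_frame (hermitian_complement n) (imul (hermitian_complement n)) n (imul n).
Proof.
rewrite dotv4 => n1 u v; rewrite -[LHS]mulr1 -n1 !dotv_imul !dotv4 !mxE /=; ring.
Qed.

Lemma hermitian_frame_kahler n u v : dotv n n = 1 ->
  let m := hermitian_complement n in
  kahler_form u v = (dotv u m * dotv v (imul m) - dotv u (imul m) * dotv v m) +
                    (dotv u n * dotv v (imul n) - dotv u (imul n) * dotv v n).
Proof.
rewrite dotv4 => n1 m; rewrite -[LHS]mulr1 -n1 !dotv_imul !dotv4 !mxE /= /kahler_form; ring.
Qed.

Definition reflection_mx (nu : 'rV[R]_4) : 'M[R]_4 := 1%:M - (2 / dotv nu nu) *: (nu^T *m nu).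

Lemma mulmx_reflection nu u : u *m reflection_mx nu = u - (2 * dotv u nu / dotv nu nu) *: nu.
Proof.
rewrite /reflection_mx mulmxBr mulmx1 -scalemxAr mulmxA; congr (_ - _).
rewrite [u *m _]mx11_scalar -dotvE mul_scalar_mx scalerA; congr (_ *: _); ring.
Qed.

Lemma reflection_affine nu a u :
  reflection nu a u = u *m reflection_mx nu + (2 * a / dotv nu nu) *: nu.
Proof.
rewrite mulmx_reflection /reflection mulrBr mulrBl scalerBl opprB addrA addrAC.
by rewrite -addrA [- _ + _]addrC addrA.
Qed.

Lemma unit_normal (nu : 'rV[R]_4) : nu != 0 ->
  exists2 n, dotv n n = 1 & forall u, u *m reflection_mx nu = u - (2 * dotv u n) *: n.
Proof.
move=> nu0; have d0 : 0 < dotv nu nu.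
  rewrite lt_neqAle eq_sym; apply/andP; split.
    by apply: contra_neq nu0; exact: dotv_self_eq0.
  by rewrite sumr_ge0// => i _; rewrite -expr2 sqr_ge0.
set d := dotv nu nu in d0 *; pose r := Num.sqrt d.
have r2 : r ^+ 2 = d by rewrite sqr_sqrtr// ltW.
have r0 : r != 0 by rewrite gt_eqF// sqrtr_gt0.
exists (r^-1 *: nu).
  by rewrite dotvZl dotvC dotvZl -/d -r2; field.
move=> u; rewrite mulmx_reflection -/d scalerA; congr (_ - _ *: _).
by rewrite [dotv u (_ *: _)]dotvC dotvZl (dotvC nu) -r2; field.
Qed.

(** Omega is the sum of the area forms of the complex lines of [m] and [n]. The reflection negates
    the coordinate along [n] and fixes the other three, so it pulls omega back to their difference;
    both area forms vanish on [u], [v]. *)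
Lemma isotropic_split n u v : dotv n n = 1 ->
  kahler_form u v = 0 ->
  kahler_form (u - (2 * dotv u n) *: n) (v - (2 * dotv v n) *: n) = 0 ->
  let m := hermitian_complement n in
  dotv u m * dotv v (imul m) = dotv v m * dotv u (imul m) /\
  dotv u n * dotv v (imul n) = dotv v n * dotv u (imul n).
Proof.
move=> n1 h1 h2 m; have h0 := hermitian_frame_kahler u v n1; cbv zeta in h0.
rewrite h1 -/m in h0; move: h0.
have kB x y z a : kahler_form (x - a *: y) z = kahler_form x z - a * kahler_form y z.
  by rewrite -scaleNr kahlerDl kahlerZl mulNr.
move: h2; rewrite kB (kahlerC u) (kahlerC n) !kB.
rewrite (kahlerC v u) h1 (kahler_imul v) (kahlerC n u) (kahler_imul u).
have -> : kahler_form n n = 0 by rewrite /kahler_form; ring.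
move: (dotv u n) (dotv v n) (dotv u (imul n)) (dotv v (imul n)).
move: (dotv u m) (dotv v m) (dotv u (imul m)) (dotv v (imul m)).
move=> a b c d a' b' c' d' h3 h4.
have h5 : a' * d' - c' * b' = 0 by lra.
rewrite h5 addr0 in h4.
split; apply/eqP; rewrite -subr_eq0; apply/eqP.
  by rewrite [RHS]h4; ring.
by rewrite -[RHS]h5; ring.
Qed.

End HermitianFrame.

(** * Matching the surface with the flow *)

Definition tangent_match (R : realType) (S : topologicalType) (A : set (chart R 2 S))
    (F : S -> 'rV[R]_4) (b1 b2 : 'rV[R]_4) (z : phase -> R -> R) (s : S) (t : R) : Prop :=
  [/\ dotv (F s) b1 = z (false, false) t, dotv (F s) b2 = z (false, true) t,
      z (true, false) t ^+ 2 + z (true, true) t ^+ 2 = 1 &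
      forall w, tangent A F s w -> dotv w b1 * z (true, true) t = dotv w b2 * z (true, false) t].

Section Factor.
Context (R : realType) (S : topologicalType) (A : set (chart R 2 S)) (F : S -> 'rV[R]_4).
Hypothesis A_atlas : smooth_atlas A.
Hypothesis F_shrinker : self_shrinker A F.
Context (b1 b2 b3 b4 : 'rV[R]_4) (r : R).
Hypothesis frame : parseval_frame b1 b2 b3 b4.
Hypothesis rank12 : forall c, A c ->
  rank1_components (fun v y => 'D_v (F \o chart_inv c) y) (chart_cod c) b1 b2.
Hypothesis rank34 : forall c, A c ->
  rank1_components (fun v y => 'D_v (F \o chart_inv c) y) (chart_cod c) b3 b4.
Hypothesis r_gt0 : 0 < r.
Hypothesis F_bounded : forall s, `|dotv (F s) b1| <= r /\ `|dotv (F s) b2| <= r.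

Let F_immersion c : A c -> immersion_on (chart_cod c) (F \o chart_inv c).
Proof. by move=> /F_shrinker []. Qed.

Lemma tangent_match_chart (c : chart R 2 S) z y t : A c -> chart_cod c y ->
  tangent_match A F b1 b2 z (chart_inv c y) t <->
  phase_match z (fun y => dotv ((F \o chart_inv c) y) b1)
    (fun y => dotv ((F \o chart_inv c) y) b2) y t.
Proof.
move=> Ac cy; have sm := (F_immersion Ac).1.
have D b w : 'D_w (fun y => dotv ((F \o chart_inv c) y) b) y =
    dotv ('D_w (F \o chart_inv c) y) b.
  by have [_ ->] := component_derive b sm w cy.
split=> -[h1 h2 h3 h4]; split => //.
  move=> w; rewrite !D; apply: h4; exists c; split => //; first exact: chart_inv_dom.
  by exists w; rewrite chart_invK.
move=> w /(tangent_chart A_atlas F_immersion Ac (chart_inv_dom cy)) [v ->].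
by rewrite chart_invK// -!D.
Qed.

Lemma tangent_match_local (c : chart R 2 S) s0 : A c -> chart_dom c s0 ->
  exists e C, [/\ 0 < e, 0 < C, ball (chart_map c s0) e `<=` chart_cod c &
    forall z y0 y1 t0, shrinker_flow r z ->
      ball (chart_map c s0) e y0 -> ball (chart_map c s0) e y1 ->
      tangent_match A F b1 b2 z (chart_inv c y0) t0 ->
      exists2 t1, tangent_match A F b1 b2 z (chart_inv c y1) t1 & `|t1 - t0| <= C * `|y1 - y0| ].
Proof.
move=> Ac cs; have bnd y : chart_cod c y -> `|dotv ((F \o chart_inv c) y) b1| <= r /\
    `|dotv ((F \o chart_inv c) y) b2| <= r by move=> _; exact: F_bounded.
have [e [k [C [e0 C0 eU patch]]]] := factor_patch_exists (@chart_cod_open _ _ _ c)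
  (F_shrinker Ac) frame (rank12 Ac) (rank34 Ac) (chart_map_cod cs) bnd.
exists e, (2 * C); split => //; first by rewrite mulr_gt0.
move=> z y0 y1 t0 zf h0 h1 /(tangent_match_chart z t0 Ac (eU _ h0)) m0.
have seg t : 0 <= t <= 1 -> ball (chart_map c s0) e (y0 + t *: (y1 - y0)).
  move=> /andP[t0' t1]; move: h0 h1; rewrite -!ball_normE /= => h0 h1.
  have -> : chart_map c s0 - (y0 + t *: (y1 - y0)) =
      (1 - t) *: (chart_map c s0 - y0) + t *: (chart_map c s0 - y1).
    by rewrite scalerBl scale1r !scalerBr; apply/rowP => j; rewrite !mxE; ring.
  apply: le_lt_trans (ler_normD _ _) _; rewrite !normrZ (ger0_norm t0').
  rewrite (@ger0_norm _ (1 - t)) ?subr_ge0//.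
  have [->|tn] := eqVneq t 0; first by rewrite subr0 mul1r mul0r addr0.
  have tp : 0 < t by rewrite lt_neqAle eq_sym tn.
  have -> : e = (1 - t) * e + t * e by ring.
  by apply: ler_ltD; [rewrite ler_wpM2l ?subr_ge0// ltW|rewrite ltr_pM2l].
have [t1 m1 ht] := phase_match_along_segment r_gt0 C0 zf patch seg m0.
by exists t1 => //; apply/(tangent_match_chart z t1 Ac (eU _ h1)).
Qed.

(** [C] is uniform in the flow and in the time. The transfer from [s0] to [s] gives openness and the
    bound on times; the transfer back to [s0] gives closedness. *)
Lemma tangent_match_near (s0 : S) : exists2 C, 0 < C & \forall s \near s0,
  forall z t0, shrinker_flow r z -> 
   (tangent_match A F b1 b2 z s0 t0 ->
    exists2 t, tangent_match A F b1 b2 z s t & `|t - t0| <= C) /\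
   (tangent_match A F b1 b2 z s t0 -> exists t, tangent_match A F b1 b2 z s0 t).
Proof.
have [c Ac cs] := A_atlas.1 s0; have [e [C [e0 C0 eU H]]] := tangent_match_local Ac cs.
exists (C * e); first by rewrite mulr_gt0.
have N := near_chart cs (nbhsx_ballx (chart_map c s0) e e0).
apply: filterS N => s [cs' hs] z t0 zf.
have hs0 := ballxx (chart_map c s0) e0.
split => m.
  have [|t m' ht] := H z _ _ t0 zf hs0 hs; first by rewrite chart_mapK.
  exists t; first by rewrite chart_mapK in m'.
  apply: le_trans ht _; rewrite ler_pM2l//; move: hs.
  by rewrite -ball_normE /= distrC => /ltW.
have [|t m' _] := H z _ _ t0 zf hs hs0; first by rewrite chart_mapK.
by exists t; rewrite chart_mapK in m'.
Qed.

Hypothesis S_compact : compact [set: S].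
Hypothesis S_connected : connected [set: S].

Lemma tangent_match_everywhere (s0 : S) : exists z, shrinker_flow r z /\
  exists N, forall s, exists2 t, `|t| <= N & tangent_match A F b1 b2 z s t.
Proof.
have [c Ac cs] := A_atlas.1 s0.
have bnd y : chart_cod c y -> `|dotv ((F \o chart_inv c) y) b1| <= r /\
    `|dotv ((F \o chart_inv c) y) b2| <= r by move=> _; exact: F_bounded.
have [e [k [C [e0 C0 eU patch]]]] := factor_patch_exists (@chart_cod_open _ _ _ c)
  (F_shrinker Ac) frame (rank12 Ac) (rank34 Ac) (chart_map_cod cs) bnd.
pose p y := dotv ((F \o chart_inv c) y) b1; pose q y := dotv ((F \o chart_inv c) y) b2.
set x := chart_map c s0 in eU patch.
have Bx : ball x e x by exact: ballxx.
pose a := 'D_k p x; pose b := 'D_k q x; pose rho := Num.sqrt (a ^+ 2 + b ^+ 2).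
have reg : 0 < a ^+ 2 + b ^+ 2 by exact: fp_regular patch _ Bx.
have rho0 : rho != 0 by rewrite gt_eqF// sqrtr_gt0.
have rho2 : rho ^+ 2 = a ^+ 2 + b ^+ 2 by rewrite sqr_sqrtr// ltW.
pose z0 (i : phase) : R := match i with
  | (false, false) => p x | (false, true) => q x
  | (true, false) => a / rho | (true, true) => b / rho end.
have [z [zf z00]] := shrinker_flow_exists z0 r_gt0.
have m0 : tangent_match A F b1 b2 z s0 0.
  have -> : s0 = chart_inv c x by rewrite chart_mapK.
  apply/(tangent_match_chart z 0 Ac (eU _ Bx)); split; rewrite ?z00 //=.
    by rewrite !expr_div_n -mulrDl -rho2 divff// expf_neq0.
  move=> w; have h := fp_rank1 patch w Bx.
  have {}h : 'D_w p x * b = 'D_w q x * a := h.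
  have h' : 'D_w p x * (b / rho) = 'D_w q x * (a / rho) by rewrite !mulrA h.
  exact: h'.
exists z; split => //.
pose U := [set s | exists t, tangent_match A F b1 b2 z s t].
have UT : U = [set: S].
  apply: S_connected.
  - by exists s0; exists 0.
  - exists U; last by rewrite setTI.
    rewrite openE => s [t m]; have [D D0] := tangent_match_near s.
    apply: filterS => s' /(_ z t zf) [/(_ m) [t' m' _] _]; by exists t'.
  (* The complement is open: a match at a point near [s] would be carried back to [s]. *)
  - exists U; last by rewrite setTI.
    rewrite -[U]setCK; apply: open_closedC; rewrite openE => s nUs.
    have [D D0] := tangent_match_near s.
    by apply: filterS => s' H [t' m']; apply: nUs; exact: (H z t' zf).2.
have cov : near_covering [set: S] by apply/compact_near_coveringP.
have H s : [set: S] s -> \forall s' \near s & N \near +oo%R,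
    exists2 t, `|t| <= N & tangent_match A F b1 b2 z s' t.
  move=> _; have [t m] : U s by rewrite UT.
  have [D D0 near_s] := tangent_match_near s.
  exists ([set s' | forall z t0, shrinker_flow r z -> 
   (tangent_match A F b1 b2 z s t0 ->
    exists2 t, tangent_match A F b1 b2 z s' t & `|t - t0| <= D) /\
   (tangent_match A F b1 b2 z s' t0 -> exists t, tangent_match A F b1 b2 z s t)],
   [set N | `|t| + D <= N]).
    split; first exact: near_s.
    by apply: nbhs_pinfty_ge; exact: num_real.
  move=> [s' N] [/= /(_ z t zf) [/(_ m) [t' m' ht] _] hN].
  exists t' => //; apply: le_trans hN; rewrite -[t'](subrK t) addrC.
  by apply: le_trans (ler_normD _ _) _; rewrite lerD2l.
have hN := cov R _ (fun N s => exists2 t, `|t| <= N & tangent_match A F b1 b2 z s t) _ H.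
have [N] := filter_ex (hN _).
by move=> h; exists N => s; exact: h.
Qed.

End Factor.

(** * Surjectivity onto the product *)

Lemma mean_value_between (R : realType) (g g' : R -> R) (t0 t : R) :
  (forall u : R, is_derive u 1 g (g' u)) ->
  exists2 xi, `|xi - t0| <= `|t - t0| & g t - g t0 = g' xi * (t - t0).
Proof.
move=> dg; have cg a b : {within `[a, b], continuous g}.
  by apply: continuous_subspaceT => u; exact: is_derive_continuous (dg u).
have [tt|tt] := leP t0 t.
  have [xi] := MVT_segment tt (fun u _ => dg u) (cg _ _).
  rewrite in_itv /= => /andP[h1 h2] E; exists xi => //.
  by rewrite !ger0_norm ?subr_ge0// lerD2r.
have [xi] := MVT_segment (ltW tt) (fun u _ => dg u) (cg _ _).
rewrite in_itv /= => /andP[h1 h2] E; exists xi.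
  by rewrite !ler0_norm ?subr_le0 ?(ltW tt)// lerN2 lerD2r.
by rewrite -opprB E -mulrN opprB.
Qed.

Section Flow.
Context (R : realType) (r : R) (z : phase -> R -> R).
Hypothesis r_gt0 : 0 < r.
Hypothesis z_flow : shrinker_flow r z.

Lemma flow_lipschitz i t u : `|z i t - z i u| <= (2 * r + 1) * `|t - u|.
Proof.
exact: lipschitz_of_derive (z_flow i) (fun t => shrinker_field_bounded (z^~ t) i (ltW r_gt0)) t u.
Qed.

Lemma flow_position_lipschitz b t u : `|z (false, b) t - z (false, b) u| <= `|t - u|.
Proof.
rewrite -[leRHS]mul1r; apply: lipschitz_of_derive (z_flow (false, b)) _ t u => {}t.
by rewrite /shrinker_field; case: b => /=; apply: norm_clip; exact: ler01.
Qed.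

(** Velocity coordinates change at a rate of at most [2 r + 1], hence by at most 1/4 in the allowed
    window. The component of the velocity along its value at [t0] then stays at least
    [1 - 1/4 - 1/4 > 0], so the curve leaves its normal line at [t0] and does not return within the
    window. *)
Lemma flow_tangent_injective t0 t :
  z (true, false) t0 ^+ 2 + z (true, true) t0 ^+ 2 = 1 ->
  `|t - t0| <= (4 * (2 * r + 1))^-1 ->
  (z (false, false) t0 - z (false, false) t) * z (true, false) t0 +
  (z (false, true) t0 - z (false, true) t) * z (true, true) t0 = 0 -> t = t0.
Proof.
set c0 := z (true, false) t0; set s0 := z (true, true) t0 => cs1 ht E.
pose cl (x : R) : R := clip 1 x.
have small x y : x ^+ 2 + y ^+ 2 = 1 -> `|x| <= 1 :> R.
  move=> h; have h2 : x ^+ 2 <= 1 by rewrite -h lerDl sqr_ge0.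
  by rewrite -(@expr_le1 _ 2)// real_normK// num_real.
have c1 := small _ _ cs1; have s1 : `|s0| <= 1 by apply: small (_ : _ + c0 ^+ 2 = 1); rewrite addrC.
pose g u := z (false, false) u * c0 + z (false, true) u * s0.
have dg (u : R) : is_derive u 1 g (cl (z (true, false) u) * c0 + cl (z (true, true) u) * s0).
  have h1 := z_flow (false, false) u; have h2 := z_flow (false, true) u.
  have -> : g = (c0 *: z (false, false)) + (s0 *: z (false, true)).
    by apply/funext => x; rewrite /g mulrC [X in _ + X]mulrC.
  apply: is_derive_eq (is_deriveD (is_deriveZ c0 h1) (is_deriveZ s0 h2)) _.
  by rewrite /GRing.scale /= mulrC [X in _ + X]mulrC.
have [xi hxi Eg] := mean_value_between t0 t dg.
have : (cl (z (true, false) xi) * c0 + cl (z (true, true) xi) * s0) * (t - t0) = 0.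
  by rewrite -Eg -[RHS]oppr0 -E /g; ring.
move/eqP; rewrite mulf_eq0 subr_eq0 => /orP[/eqP h|/eqP//]; exfalso.
have B0 : 0 < 2 * r + 1 by rewrite ltr_wpDl ?mulr_ge0 ?ltW.
have near_cl i y : `|y| <= 1 -> `|z i t0| <= 1 -> `|cl (z i xi) * y - z i t0 * y| <= 4^-1.
  move=> y1 z1; rewrite -mulrBl normrM -[leRHS]mulr1; apply: ler_pM => //.
  rewrite -{1}(clip_id z1); apply: le_trans (clip_lipschitz _ _ _) _.
  apply: le_trans (flow_lipschitz _ _ _) _.
  apply: (@le_trans _ _ ((2 * r + 1) * (4 * (2 * r + 1))^-1)).
    by rewrite ler_pM2l// (le_trans hxi).
  by rewrite invfM mulrCA mulfV ?mulr1// gt_eqF.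
have k1 := near_cl (true, false) c0 c1 c1; have k2 := near_cl (true, true) s0 s1 s1.
move: k1 k2; rewrite !ler_norml => /andP[k1 _] /andP[k2 _].
move: h k1 k2 cs1; rewrite -/c0 -/s0; move: (cl _) (cl _) => x y h k1 k2 cs1.
rewrite !expr2 in cs1; lra.
Qed.

End Flow.

(** * Critical points of the distance to a target point *)

Lemma sqr_norm_le_dotv (R : realType) n (v : 'rV[R]_n) : `|v| ^+ 2 <= dotv v v.
Proof.
have d0 : 0 <= dotv v v by rewrite sumr_ge0// => i _; rewrite -expr2 sqr_ge0.
rewrite -(sqr_sqrtr d0) ler_sqr ?nnegrE ?sqrtr_ge0//.
rewrite [leLHS]mx_normrE; apply: bigmax_le; first exact: sqrtr_ge0.
move=> [i j] _ /=; rewrite -sqrtr_sqr ler_sqrt// (ord1 i) /dotv (bigD1 j)//= -expr2.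
by rewrite lerDl sumr_ge0// => k _; rewrite -expr2 sqr_ge0.
Qed.

Lemma orthogonal_unit_parallel (R : realFieldType) (d1 d2 e1 e2 c s : R) :
  c ^+ 2 + s ^+ 2 = 1 -> d1 * s = d2 * c -> 0 < d1 ^+ 2 + d2 ^+ 2 ->
  e1 * d1 + e2 * d2 = 0 -> e1 * c + e2 * s = 0.
Proof.
move=> cs1 par d0 orth; pose l := d1 * c + d2 * s.
have d1E : d1 = l * c.
  have -> : l * c = d1 * c ^+ 2 + (d2 * c) * s by rewrite /l; ring.
  by rewrite -par -mulrA -expr2 -mulrDr cs1 mulr1.
have d2E : d2 = l * s.
  have -> : l * s = (d1 * s) * c + d2 * s ^+ 2 by rewrite /l; ring.
  by rewrite par -mulrA -expr2 -mulrDr cs1 mulr1.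
clearbody l; have l0 : l != 0.
  by apply/eqP => l0; move: d0; rewrite d1E d2E l0 !mul0r expr0n addr0 ltxx.
apply: (mulfI l0); rewrite mulr0 -orth d1E d2E; ring.
Qed.

Lemma local_min_derive_eq0 (R : realType) (V : normedModType R) (E : V -> R) (y v : V) :
  (\forall x \near y, E y <= E x) -> (\forall x \near y, derivable E x v) ->
  'D_v E y = 0.
Proof.
move=> mn dE.
(* The two edges of this degenerate parallelogram cover both sides of [y] on the line of direction
   [v]. *)
have [h h0 H] := nbhs_parallelogram v (- v) (filterI mn dE).
have line t : `|t| <= h -> E y <= E (y + t *: v) /\ derivable E (y + t *: v) v.
  have zh : 0 <= (0 : R) <= h by rewrite lexx ltW.
  have [t0|t0] := leP 0 t => th.
    have th' : 0 <= t <= h by rewrite t0 -(ger0_norm t0).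
    by have := H t 0 th' zh; rewrite scale0r addr0.
  have th' : 0 <= - t <= h by rewrite oppr_ge0 ltW// -(ltr0_norm t0).
  by have := H 0 (- t) zh th'; rewrite scale0r addr0 scaleNr scalerN opprK.
pose phi t := E (y + t *: v).
have oo t : t \in `]- h, h[ -> `|t| <= h.
  by rewrite in_itv /= => /andP[h1 h2]; rewrite ler_norml !ltW.
have hh : - h <= h by rewrite (le_trans _ (ltW h0))// oppr_le0 ltW.
have z0 : (0 : R) \in `]- h, h[ by rewrite in_itv /= oppr_lt0 h0.
have dphi t : t \in `]- h, h[ -> is_derive t 1 phi ('D_v E (y + t *: v)).
  by move=> /oo /line [_ d]; exact: is_derive_line.
have [|||_ e] := @derive1_at_min R phi (- h) h 0 hh.
- by move=> t /dphi [].
- exact: z0.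
- by move=> t /oo /line [le _]; rewrite /phi scale0r addr0.
have [_] := dphi 0 z0; rewrite e scale0r addr0 => <-; exact: erefl.
Qed.

Lemma is_derive_sqr_sub (R : realType) (V : normedModType R) (g : V -> R) (y v : V) (T d : R) :
  is_derive y v g d -> is_derive y v (fun x => (g x - T) ^+ 2) (2 * (g y - T) * d).
Proof.
move=> dg.
have dgT : is_derive y v (fun x => g x - T) d.
  by have := is_deriveB dg (is_derive_cst T y v); rewrite subr0.
have -> : (fun x => (g x - T) ^+ 2) = (fun x => g x - T) * (fun x => g x - T) by [].
apply: is_derive_eq (is_deriveM dgT dgT) _; rewrite /GRing.scale /=; ring.
Qed.

Lemma compact_ball_le (R : realType) n (x : 'rV[R]_n) (e : R) :
  compact [set y | `|y - x| <= e].
Proof.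
apply: bounded_closed_compact.
  exists (`|x| + e); split; first exact: num_real.
  move=> M hM y /= hy; apply: ltW; apply: le_lt_trans hM.
  by rewrite -[y](subrK x) addrC (le_trans (ler_normD _ _))// lerD2l.
have -> : [set y | `|y - x| <= e] = (fun y => `|y - x|) @^-1` [set t | t <= e] by [].
apply: closed_comp; last exact: closed_le.
move=> y _; have c : (z - x) @[z --> y] --> y - x.
  exact: (@cvgB _ _ _ (nbhs y) _ id (cst x) y x cvg_id (cvg_cst x)).
exact: cvg_norm c.
Qed.

Section Sheet.
Context (R : realType) (U : set 'rV[R]_2) (f : 'rV[R]_2 -> 'rV[R]_4).
Context (b1 b2 b3 b4 : 'rV[R]_4).
Hypothesis U_open : open U.
Hypothesis f_smooth : smooth_on U f.
Hypothesis frame : parseval_frame b1 b2 b3 b4.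
Variables (T1 T2 T3 T4 : R).
Let E y := (dotv (f y) b1 - T1) ^+ 2 + (dotv (f y) b2 - T2) ^+ 2 +
           ((dotv (f y) b3 - T3) ^+ 2 + (dotv (f y) b4 - T4) ^+ 2).

Lemma sheet_distance_derive y v : U y -> is_derive y v E
  (2 * (dotv (f y) b1 - T1) * dotv ('D_v f y) b1 + 2 * (dotv (f y) b2 - T2) * dotv ('D_v f y) b2 +
  (2 * (dotv (f y) b3 - T3) * dotv ('D_v f y) b3 + 2 * (dotv (f y) b4 - T4) * dotv ('D_v f y) b4)).
Proof.
move=> Uy; have d b := component_derive b f_smooth v Uy.
have s b T := is_derive_sqr_sub T (d b).
exact: (is_deriveD (is_deriveD (s b1 T1) (s b2 T2)) (is_deriveD (s b3 T3) (s b4 T4))).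
Qed.

(* The triangle inequality |f y - f x| <= |f y - T| + |T - f x|, squared. *)
Lemma sqr_norm_sheet_le x y (d : R) :
  `|dotv (f x) b1 - T1| <= d -> `|dotv (f x) b2 - T2| <= d ->
  `|dotv (f x) b3 - T3| <= d -> `|dotv (f x) b4 - T4| <= d ->
  `|f y - f x| ^+ 2 <= 2 * E y + 8 * d ^+ 2.
Proof.
have key (u t w : R) : `|u - t| <= d -> (w - u) ^+ 2 <= 2 * (w - t) ^+ 2 + 2 * d ^+ 2.
  move=> h; have h2 : (u - t) ^+ 2 <= d ^+ 2.
    by rewrite -real_normK ?num_real// ler_sqr ?nnegrE// (le_trans _ h).
  have := sqr_ge0 ((w - t) + (u - t)); rewrite !expr2 in h2 *; lra.
move=> /key h1 /key h2 /key h3 /key h4; apply: le_trans (sqr_norm_le_dotv _) _.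
rewrite frame !dotvBl -!expr2 /E.
have := h1 (dotv (f y) b1); have := h2 (dotv (f y) b2).
have := h3 (dotv (f y) b3); have := h4 (dotv (f y) b4).
move: (dotv (f y) b1) (dotv (f y) b2) (dotv (f y) b3) (dotv (f y) b4).
move: (dotv (f x) b1) (dotv (f x) b2) (dotv (f x) b3) (dotv (f x) b4).
move=> x1 x2 x3 x4 y1 y2 y3 y4; clear; lra.
Qed.

End Sheet.

Lemma parseval_frame_swap (R : realType) (b1 b2 b3 b4 : 'rV[R]_4) :
  parseval_frame b1 b2 b3 b4 -> parseval_frame b3 b4 b1 b2.
Proof. by move=> fr u v; rewrite fr addrC. Qed.

(* At a critical point of the distance to the target, a tangent vector in the
   kernel of the second factor shows that the error in the first factor is
   orthogonal to the first curve; hence it vanishes. *)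
Lemma critical_factor_eq (R : realType) (U : set 'rV[R]_2) (f : 'rV[R]_2 -> 'rV[R]_4)
    (b1 b2 b3 b4 : 'rV[R]_4) (r : R) (z : phase -> R -> R) (y : 'rV[R]_2) (t t' : R)
    (e3 e4 : R) :
  open U -> U y -> self_shrinker_on U f -> parseval_frame b1 b2 b3 b4 ->
  rank1_components (fun v y => 'D_v f y) U b3 b4 -> 0 < r -> shrinker_flow r z ->
  phase_match z (fun y => dotv (f y) b1) (fun y => dotv (f y) b2) y t ->
  `|t' - t| <= (4 * (2 * r + 1))^-1 ->
  (forall v, (dotv (f y) b1 - z (false, false) t') * dotv ('D_v f y) b1 +
             (dotv (f y) b2 - z (false, true) t') * dotv ('D_v f y) b2 +
             (e3 * dotv ('D_v f y) b3 + e4 * dotv ('D_v f y) b4) = 0) ->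
  t' = t.
Proof.
move=> oU Uy shr frame rk34 r0 zf [h1 h2 cs1 par] tt crit.
have sm := shr.1.1; have df := smooth_differentiable sm Uy.
have [v v0 [v3 v4]] := rank1_kernel df (fun v w => rk34 y v w Uy).
have D b := component_derive b sm v Uy.
have pos := factor_derivative_neq0 shr frame Uy v0 v3 v4.
have := crit v; rewrite v3 v4 !mulr0 !addr0 h1 h2 => orth.
have [_ e1] := D b1; have [_ e2] := D b2.
move: pos (par v); rewrite e1 e2 => pos parv.
have h := orthogonal_unit_parallel cs1 parv pos orth.
exact: (flow_tangent_injective r0 zf cs1 tt h).
Qed.

Section Product.
Context (R : realType) (S : topologicalType) (A : set (chart R 2 S)) (F : S -> 'rV[R]_4).
Hypothesis A_atlas : smooth_atlas A.
Hypothesis F_shrinker : self_shrinker A F.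
Context (b1 b2 b3 b4 : 'rV[R]_4) (r : R).
Hypothesis frame : parseval_frame b1 b2 b3 b4.
Hypothesis rank12 : forall c, A c ->
  rank1_components (fun v y => 'D_v (F \o chart_inv c) y) (chart_cod c) b1 b2.
Hypothesis rank34 : forall c, A c ->
  rank1_components (fun v y => 'D_v (F \o chart_inv c) y) (chart_cod c) b3 b4.
Hypothesis r_gt0 : 0 < r.
Hypothesis F_bounded12 : forall s, `|dotv (F s) b1| <= r /\ `|dotv (F s) b2| <= r.
Hypothesis F_bounded34 : forall s, `|dotv (F s) b3| <= r /\ `|dotv (F s) b4| <= r.
Context (z w : phase -> R -> R).
Hypothesis z_flow : shrinker_flow r z.
Hypothesis w_flow : shrinker_flow r w.

Let F_immersion c : A c -> immersion_on (chart_cod c) (F \o chart_inv c).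
Proof. by move=> /F_shrinker []. Qed.

Definition product_match (s : S) (t u : R) : Prop :=
  tangent_match A F b1 b2 z s t /\ tangent_match A F b3 b4 w s u.

(** The target has the coordinates of [z] at [t'] and of [w] at [u]. A nearest point of the sheet is
    critical for the distance, and [critical_factor_eq], used once for each factor, turns it into an
    exact hit. The step [d] depends on [s0] only, which allows it to be made uniform by
    compactness. *)
Lemma product_match_local (s0 : S) : exists2 d, 0 < d & \forall s \near s0,
  forall t u t', product_match s t u -> `|t' - t| <= d ->
  exists s', product_match s' t' u.
Proof.
have [c Ac cs] := A_atlas.1 s0; have cx := chart_map_cod cs.
set x := chart_map c s0 in cx; pose f := F \o chart_inv c.
have sm := (F_immersion Ac).1; rewrite -/f in sm.
have df := smooth_differentiable sm cx.
have [e1 [C1 [e10 C10 e1U loc1]]] :=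
  tangent_match_local A_atlas F_shrinker frame rank12 rank34 r_gt0 F_bounded12 Ac cs.
have [e2 [C2 [e20 C20 e2U loc2]]] :=
  tangent_match_local A_atlas F_shrinker (parseval_frame_swap frame) rank34 rank12
    r_gt0 F_bounded34 Ac cs.
have [K K0 hK] := immersion_expansive df ((F_immersion Ac).2 _ cx).
have [e3 /= e30 e3K] := (nbhs_ballP _ _).1 hK.
pose a := (4 * (2 * r + 1))^-1.
have a0 : 0 < a by rewrite invr_gt0 mulr_gt0// ltr_wpDl// mulr_ge0// ltW.
(* Two points of the closed ball of radius [q] are at most [2 q] apart, so the matching times move
   by at most [a / 2]; with [d <= a / 2] all times stay in the window [a] of
   [flow_tangent_injective]. *)
have [q [q0 qe1 qe2 qe3] [qC1 qC2]] : exists2 q, [/\ 0 < q, q < e1, q < e2 & q < e3] &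
    C1 * (2 * q) <= a / 2 /\ C2 * (2 * q) <= a / 2.
  pose m := Num.min (Num.min (e1 / 2) (e2 / 2)) (Num.min (e3 / 2) (Num.min (a / (4 * C1)) (a / (4 * C2)))).
  have m0 : 0 < m by rewrite !lt_min !divr_gt0// mulr_gt0.
  have half (e : R) : 0 < e -> m <= e / 2 -> m < e.
    by move=> e0 h; apply: le_lt_trans h _; rewrite ltr_pdivrMr// ltr_pMr// ltr1n.
  have hC (C : R) : 0 < C -> m <= a / (4 * C) -> C * (2 * m) <= a / 2.
    move=> C0 h; have -> : a / 2 = C * (2 * (a / (4 * C))) by field; rewrite gt_eqF.
    by rewrite !ler_pM2l.
  exists m; split; rewrite ?m0//.
  - by apply: half => //; rewrite !ge_min lexx.
  - by apply: half => //; rewrite !ge_min lexx !orbT.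
  - by apply: half => //; rewrite !ge_min lexx !orbT.
  - by apply: hC => //; rewrite !ge_min lexx !orbT.
  - by apply: hC => //; rewrite !ge_min lexx !orbT.
pose d := Num.min (a / 2) (q / (7 * K)).
have d0 : 0 < d by rewrite lt_min !divr_gt0// mulr_gt0.
have da : d <= a / 2 by rewrite ge_min lexx.
have dq : d <= q / (7 * K) by rewrite ge_min lexx orbT.
have balls (y : 'rV[R]_2) : `|y - x| <= q -> [/\ ball x e1 y, ball x e2 y & ball x e3 y].
  by move=> h; rewrite -!ball_normE /= distrC; split; apply: le_lt_trans h _.
have Fc b : {for s0, continuous (fun s => dotv (F s) b)}.
  have h := immersion_continuous A_atlas F_immersion (x := s0).
  exact: continuous_comp h (@dotv_continuous _ _ b _).
exists d => //.
have N1 : \forall y \near x, `|y - x| <= q.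
  by apply: filterS (nbhsx_ballx x q q0) => y; rewrite -ball_normE /= distrC => /ltW.
apply: filterS (filterI (near_chart cs N1) (filterI (near_dist_le (Fc b1) d0)
  (filterI (near_dist_le (Fc b2) d0) (filterI (near_dist_le (Fc b3) d0) (near_dist_le (Fc b4) d0))))).
move=> s [[cs' sx] [k1 [k2 [k3 k4]]]] t u t' [mz mw] tt.
pose T1 := z (false, false) t'; pose T2 := z (false, true) t'.
pose T3 := w (false, false) u; pose T4 := w (false, true) u.
pose E y := (dotv (f y) b1 - T1) ^+ 2 + (dotv (f y) b2 - T2) ^+ 2 +
           ((dotv (f y) b3 - T3) ^+ 2 + (dotv (f y) b4 - T4) ^+ 2).
set y0 := chart_map c s in sx.
have fy0 : f y0 = F s by rewrite /f /= chart_mapK.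
have fx : f x = F s0 by rewrite /f /= chart_mapK.
have inU y : `|y - x| <= q -> chart_cod c y by move=> /balls [/e1U].
have zt b : `|z (false, b) t - z (false, b) t'| <= d.
  by apply: le_trans (flow_position_lipschitz z_flow _ _ _) _; rewrite distrC.
have [m1 m2 _ _] := mz; have [m3 m4 _ _] := mw.
have Ey0 : E y0 <= 2 * d ^+ 2.
  rewrite /E fy0 m1 m2 m3 m4 !subrr expr0n /= !addr0.
  have sq (v : R) : `|v| <= d -> v ^+ 2 <= d ^+ 2.
    by move=> h; rewrite -real_normK ?num_real// ler_sqr ?nnegrE// ltW.
  have := sq _ (zt false); have := sq _ (zt true); rewrite -/T1 -/T2 !expr2; lra.
have [y /set_mem yq ymin] : exists2 y, y \in [set y | `|y - x| <= q] &
    forall v, v \in [set y | `|y - x| <= q] -> E y <= E v.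
  apply: EVT_min_rV; [by exists y0|exact: compact_ball_le|].
  apply: continuous_in_subspaceT => v /set_mem /inU Uv.
  have g b : {for v, continuous (fun y => dotv (f y) b)}.
    have fc := differentiable_continuous (smooth_differentiable sm Uv).
    exact: (continuous_comp fc (@dotv_continuous _ _ b (f v))).
  have h b T : (dotv (f v') b - T) * (dotv (f v') b - T) @[v' --> v] -->
      (dotv (f v) b - T) * (dotv (f v) b - T).
    exact: (cvgM (cvgB (g b) (cvg_cst T)) (cvgB (g b) (cvg_cst T))).
  exact: (cvgD (cvgD (h b1 T1) (h b2 T2)) (cvgD (h b3 T3) (h b4 T4))).
rewrite /= in yq.
have Ey : E y <= 2 * d ^+ 2 by apply: le_trans Ey0; apply: ymin; exact/mem_set.
have Uy := inU _ yq.
(* The minimiser is interior. Indeed [|f y - f x|^2 <= 2 (2 d^2) + 8 (2 d)^2 = 36 d^2], whereas on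
   the boundary [q <= K |f y - f x| <= 6 K d], against [d <= q / (7 K)]. *)
have yq' : `|y - x| < q.
  rewrite lt_neqAle yq andbT; apply/negP => /eqP yqE.
  have [_ _ B3] := balls _ yq; have := e3K _ B3; rewrite /= yqE => hq.
  have near2 b (T v : R) : `|dotv (F s0) b - dotv (F s) b| <= d -> dotv (F s) b = v ->
      `|v - T| <= d -> `|dotv (f x) b - T| <= 2 * d.
    move=> h1 h2 h3; rewrite fx -[dotv (F s0) b](subrK (dotv (F s) b)) h2 -addrA.
    by apply: le_trans (ler_normD _ _) _; rewrite -h2 mulr2n mulrDl !mul1r h2; apply: lerD; rewrite // -h2.
  have dd : `|w (false, false) u - T3| <= d by rewrite subrr normr0 ltW.
  have dd' : `|w (false, true) u - T4| <= d by rewrite subrr normr0 ltW.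
  have := sqr_norm_sheet_le frame y (near2 _ _ _ k1 m1 (zt false)) (near2 _ _ _ k2 m2 (zt true))
    (near2 _ _ _ k3 m3 dd) (near2 _ _ _ k4 m4 dd').
  rewrite -/(E y) => hE.
  have hq2 : q ^+ 2 <= K ^+ 2 * `|f y - f x| ^+ 2.
    by rewrite -exprMn ler_sqr ?nnegrE// ?mulr_ge0// ltW.
  have hd : K * d <= q / 7.
    have -> : q / 7 = K * (q / (7 * K)) by field; rewrite gt_eqF.
    by rewrite ler_pM2l.
  have hd2 : K ^+ 2 * d ^+ 2 <= (q / 7) ^+ 2.
    by rewrite -exprMn ler_sqr ?nnegrE ?divr_ge0 ?mulr_ge0// ltW.
  have h36 : `|f y - f x| ^+ 2 <= 36 * d ^+ 2.
    by move: hE Ey; rewrite exprMn; move: (E y) (d ^+ 2) (`|_| ^+ 2) => E' d2 n2; lra.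
  have K2 : 0 <= K ^+ 2 by rewrite sqr_ge0.
  have := le_trans hq2 (ler_wpM2l K2 h36); move: hd2; rewrite expr_div_n.
  have q2 : 0 < q ^+ 2 by rewrite exprn_gt0.
  rewrite mulrCA; move: q2; move: (q ^+ 2) (K ^+ 2 * d ^+ 2) => q2 Kd.
  by rewrite !expr2; lra.
have ynear : \forall v \near y, `|v - x| <= q.
  have g0 : 0 < q - `|y - x| by rewrite subr_gt0.
  apply: filterS (nbhsx_ballx y _ g0) => v; rewrite -ball_normE /= => hv.
  rewrite -[v](subrK y) -addrA; apply: le_trans (ler_normD _ _) _.
  by rewrite distrC -lerBrDr ltW.
have crit v : (dotv (f y) b1 - T1) * dotv ('D_v f y) b1 +
             (dotv (f y) b2 - T2) * dotv ('D_v f y) b2 +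
             ((dotv (f y) b3 - T3) * dotv ('D_v f y) b3 +
              (dotv (f y) b4 - T4) * dotv ('D_v f y) b4) = 0.
  have E0 : 'D_v E y = 0.
    apply: local_min_derive_eq0; apply: filterS ynear => v' hv'.
      by apply: ymin; exact/mem_set.
    by have [] := sheet_distance_derive b1 b2 b3 b4 sm T1 T2 T3 T4 v (inU _ hv').
  have [_ e] := sheet_distance_derive b1 b2 b3 b4 sm T1 T2 T3 T4 v Uy.
  have := etrans (esym E0) e.
  move: (dotv ('D_v f y) b1) (dotv ('D_v f y) b2) (dotv ('D_v f y) b3) (dotv ('D_v f y) b4).
  move: (dotv (f y) b1 - T1) (dotv (f y) b2 - T2) (dotv (f y) b3 - T3) (dotv (f y) b4 - T4).
  move=> x1 x2 x3 x4 y1 y2 y3 y4; rewrite -!mulrA; lra.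
have crit' v : (dotv (f y) b3 - T3) * dotv ('D_v f y) b3 +
              (dotv (f y) b4 - T4) * dotv ('D_v f y) b4 +
             ((dotv (f y) b1 - T1) * dotv ('D_v f y) b1 +
             (dotv (f y) b2 - T2) * dotv ('D_v f y) b2) = 0 by rewrite addrC crit.
have [B1 B2 _] := balls _ yq; have [B1' B2' _] := balls _ sx.
have sE : s = chart_inv c y0 by rewrite chart_mapK.
have yy0 : `|y - y0| <= 2 * q.
  rewrite -[y](subrK x) -addrA; apply: le_trans (ler_normD _ _) _.
  by rewrite mulr2n mulrDl !mul1r; apply: lerD => //; rewrite distrC.
have step (C : R) : 0 < C -> C * (2 * q) <= a / 2 -> C * `|y - y0| <= a / 2.
  by move=> C0 h; apply: le_trans h; rewrite ler_pM2l.
rewrite sE in mz mw.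
have [t1 n1 tt1] := loc1 z y0 y t z_flow B1' B1 mz.
have [u1 n2 uu1] := loc2 w y0 y u w_flow B2' B2 mw.
have tt1' : `|t' - t1| <= a.
  rewrite -[t'](subrK t) -addrA [leRHS]splitr; apply: le_trans (ler_normD _ _) _.
  by apply: lerD; [apply: le_trans tt _|rewrite distrC (le_trans tt1)// step].
have uu1' : `|u - u1| <= a.
  rewrite distrC (le_trans uu1)//; apply: le_trans (step _ C20 qC2) _.
  by rewrite ler_pdivrMr// ler_peMr ?ler1n// ltW.
have p1 := (tangent_match_chart A_atlas F_shrinker b1 b2 z t1 Ac Uy).1 n1.
have p2 := (tangent_match_chart A_atlas F_shrinker b3 b4 w u1 Ac Uy).1 n2.
have oU := @chart_cod_open _ _ _ c.
have tE := critical_factor_eq oU Uy (F_shrinker Ac) frame (rank34 Ac) r_gt0 z_flow p1 tt1' crit.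
have uE := critical_factor_eq oU Uy (F_shrinker Ac) (parseval_frame_swap frame) (rank12 Ac)
  r_gt0 w_flow p2 uu1' crit'.
by exists (chart_inv c y); split; [rewrite tE|rewrite uE].
Qed.

End Product.

(** * The period *)

Lemma real_step_ind (R : realType) (Q : R -> Prop) (d t0 : R) : 0 < d ->
  (forall t t', Q t -> `|t' - t| <= d -> Q t') -> Q t0 -> forall t, Q t.
Proof.
move=> d0 step Q0 t.
have [n hn] : exists n : nat, `|t - t0| / d < n%:R.
  by exists (Num.bound (`|t - t0| / d)); apply: archi_boundP; rewrite divr_ge0// ltW.
have n0 : 0 < n%:R :> R by apply: le_lt_trans hn; rewrite divr_ge0// ltW.
pose h := (t - t0) / n%:R.
have hd : `|h| <= d.
  rewrite /h normrM normfV (gtr0_norm n0) ler_pdivrMr// mulrC -ler_pdivrMr//.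
  exact: ltW.
have Qk (k : nat) : Q (t0 + k%:R * h).
  elim: k => [|k IH]; first by rewrite mul0r addr0.
  apply: step IH _; have -> : t0 + k.+1%:R * h - (t0 + k%:R * h) = h.
    by rewrite -natr1; ring.
  exact: hd.
by have := Qk n; rewrite /h mulrCA mulfV ?gt_eqF// mulr1 addrC subrK.
Qed.

Section ProductMatch.
Context (R : realType) (S : topologicalType) (A : set (chart R 2 S)) (F : S -> 'rV[R]_4).
Hypothesis A_atlas : smooth_atlas A.
Hypothesis S_compact : compact [set: S].
Hypothesis F_shrinker : self_shrinker A F.

Definition rank1_on_atlas (b1 b2 : 'rV[R]_4) : Prop := forall c, A c ->
  rank1_components (fun v y => 'D_v (F \o chart_inv c) y) (chart_cod c) b1 b2.

Definition components_bounded (r : R) (b1 b2 : 'rV[R]_4) : Prop :=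
  forall s, `|dotv (F s) b1| <= r /\ `|dotv (F s) b2| <= r.

Lemma product_match_shift (b1 b2 b3 b4 : 'rV[R]_4) (r : R) (z w : phase -> R -> R) s t u t' :
  parseval_frame b1 b2 b3 b4 -> rank1_on_atlas b1 b2 -> rank1_on_atlas b3 b4 -> 0 < r ->
  components_bounded r b1 b2 -> components_bounded r b3 b4 ->
  shrinker_flow r z -> shrinker_flow r w ->
  tangent_match A F b1 b2 z s t -> tangent_match A F b3 b4 w s u ->
  exists s', tangent_match A F b1 b2 z s' t' /\ tangent_match A F b3 b4 w s' u.
Proof.
move=> frame rk12 rk34 r0 bd12 bd34 zf wf mz mw.
pose P (d : R) (s : S) := forall t u t', product_match A F b1 b2 b3 b4 z w s t u ->
  `|t' - t| <= d -> exists s', product_match A F b1 b2 b3 b4 z w s' t' u.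
have cov : near_covering [set: S] by apply/compact_near_coveringP.
(* [P d] only weakens as [d] decreases to 0, so the local step lengths combine into one valid on all
   of [S]; steps of that length reach every time. *)
have H s0 : [set: S] s0 -> \forall s' \near s0 & d \near 0^'+, P d s'.
  move=> _; have [d d0 near_s] := product_match_local A_atlas F_shrinker frame rk12 rk34
    r0 bd12 bd34 zf wf s0.
  exists ([set s | P d s], [set d' | d' <= d]).
    by split; [exact: near_s|exact: nbhs_right_le].
  move=> [s1 d1] [/= Ps d1d] t1 u1 t1' m h; apply: Ps m _; exact: le_trans h d1d.
have hP := cov R _ P _ H.
have [d [d0 Pd]] := filter_ex (filterI (nbhs_right_gt 0) (hP _)).
pose Q t := exists s', product_match A F b1 b2 b3 b4 z w s' t u.
apply: (@real_step_ind R Q d t d0); last by exists s.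
move=> t1 t1' [s1 m] h; exact: (Pd s1 _ t1 u t1' m h).
Qed.

Lemma product_match_all (b1 b2 b3 b4 : 'rV[R]_4) (r : R) (z w : phase -> R -> R) s t u :
  parseval_frame b1 b2 b3 b4 -> rank1_on_atlas b1 b2 -> rank1_on_atlas b3 b4 -> 0 < r ->
  components_bounded r b1 b2 -> components_bounded r b3 b4 ->
  shrinker_flow r z -> shrinker_flow r w ->
  tangent_match A F b1 b2 z s t -> tangent_match A F b3 b4 w s u ->
  forall t' u', exists s', tangent_match A F b1 b2 z s' t' /\ tangent_match A F b3 b4 w s' u'.
Proof.
move=> frame rk12 rk34 r0 bd12 bd34 zf wf mz mw t' u'.
have [s1 [m1 m2]] := product_match_shift t' frame rk12 rk34 r0 bd12 bd34 zf wf mz mw.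
have [s2 [n1 n2]] := product_match_shift u' (parseval_frame_swap frame) rk34 rk12 r0
  bd34 bd12 wf zf m2 m1.
by exists s2.
Qed.

End ProductMatch.

Section Period.
Context (R : realType) (r : R).
Hypothesis r_gt0 : 0 < r.

Lemma flow_unique (z w : phase -> R -> R) : shrinker_flow r z -> shrinker_flow r w ->
  (forall i, z i 0 = w i 0) -> forall i t, z i t = w i t.
Proof.
move=> zf wf e i t.
have Lp : 0 < 4 * r + 2 by rewrite ltr_wpDl// mulr_ge0// ltW.
(* The sign sg = -1 runs both flows backwards. *)
have main (sg : R) : `|sg| <= 1 -> forall t, 0 <= t -> forall i, z i (sg * t) = w i (sg * t).
  move=> sg1 T T0 j; have T1 : T \in `[0, T] by rewrite in_itv /= T0 lexx.
  have dz (x : phase -> R -> R) : shrinker_flow r x -> forall i (u : R),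
      is_derive u 1 (fun u => x i (sg * u)) (sg * shrinker_field r (fun i => x i (sg * u)) i).
    move=> xf k u.
    have ds : is_derive u 1 (fun u => sg * u) sg.
      by have := is_deriveZ sg (is_derive_id u (1 : R)); rewrite [_ *: 1]mulr1.
    rewrite mulrC; exact: (@is_derive1_comp R (x k) (fun u => sg * u) u _ _ (xf k (sg * u)) ds).
  have cz x : shrinker_flow r x -> forall i, {within `[0, T], continuous (fun u => x i (sg * u))}.
    move=> xf k; apply: continuous_subspaceT => u; exact: is_derive_continuous (dz x xf k u).
  exact: (@reparametrised_unique R phase (shrinker_field r) (4 * r + 2) (2 * r + 1) Lp
    (fun z w d => @shrinker_field_lipschitz R r z w d (ltW r_gt0))
    (fun z i => shrinker_field_bounded z i (ltW r_gt0))
    (fun i u => z i (sg * u)) (fun i u => w i (sg * u)) (fun=> sg) 1 T ltr01 (fun=> sg1)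
    (cz z zf) (cz w wf) (fun i u _ => dz z zf i u) (fun i u _ => dz w wf i u)
    (fun i => etrans (congr1 (z i) (mulr0 sg)) (etrans (e i) (esym (congr1 (w i) (mulr0 sg)))))
    T T1 j).
have [t0|t0] := leP 0 t.
  by have := main 1 _ t t0 i; rewrite normr1 mul1r; apply.
have := main (-1) _ (- t) _ i; rewrite mulN1r opprK normrN normr1; apply => //.
by rewrite oppr_ge0 ltW.
Qed.

Lemma flow_shift (z : phase -> R -> R) a : shrinker_flow r z ->
  shrinker_flow r (fun i t => z i (t + a)).
Proof.
move=> zf i t; have ds : is_derive t 1 (fun u => u + a) 1.
  by have := is_deriveD (is_derive_id t (1 : R)) (is_derive_cst a t 1); rewrite addr0.
have := @is_derive1_comp R (z i) (fun u => u + a) t _ _ (zf i (t + a)) ds.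
by rewrite mulr1.
Qed.

(** The same curve run backwards: the coordinates with [i.1] true are velocities and change sign.
    The curvature vector does not depend on the orientation, so this is again a flow line. *)
Definition reversed (z : phase -> R -> R) (i : phase) (t : R) : R :=
  if i.1 then - z i (- t) else z i (- t).

Lemma clipN (a x : R) : 0 <= a -> clip a (- x) = - clip a x.
Proof.
move=> a0; have aa : - a <= a by rewrite (le_trans _ a0)// oppr_le0.
have ge y : a <= y -> clip a y = a by move=> h; rewrite /clip min_l// max_r.
have le y : y <= - a -> clip a y = - a.
  by move=> h; rewrite /clip max_l// ge_min h orbT.
have [xa|xa] := leP a x; first by rewrite (ge x)// le// lerN2.
have [ax|ax] := leP x (- a); first by rewrite (le x)// ge ?opprK// lerNr.
by rewrite !clip_id ?normrN// ler_norml !ltW.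
Qed.

Lemma flow_reversed (z : phase -> R -> R) : shrinker_flow r z -> shrinker_flow r (reversed z).
Proof.
move=> zf i t.
have d j : is_derive t 1 (fun u => z j (- u)) (- shrinker_field r (fun i => z i (- t)) j).
  rewrite -mulrN1.
  exact: (@is_derive1_comp R (z j) (@GRing.opp R) t _ _ (zf j (- t)) (is_deriveNid t 1)).
have r0 := ltW r_gt0.
case: i => [[] []].
- have h : is_derive t 1 (reversed z (true, true))
      (- - shrinker_field r (fun i => z i (- t)) (true, true)) by exact: is_deriveN (d _).
  apply: is_derive_eq h _.
  by rewrite /shrinker_field /reversed /= !clipN ?ler01//; ring.
- have h : is_derive t 1 (reversed z (true, false))
      (- - shrinker_field r (fun i => z i (- t)) (true, false)) by exact: is_deriveN (d _).
  apply: is_derive_eq h _.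
  by rewrite /shrinker_field /reversed /= !clipN ?ler01//; ring.
- apply: (is_derive_eq (d (false, true) : is_derive t 1 (reversed z (false, true)) _)).
  by rewrite /shrinker_field /reversed /= !clipN ?ler01.
- apply: (is_derive_eq (d (false, false) : is_derive t 1 (reversed z (false, false)) _)).
  by rewrite /shrinker_field /reversed /= !clipN ?ler01.
Qed.

Lemma flow_periodic (z : phase -> R -> R) a b : shrinker_flow r z ->
  (forall t, z (true, false) t ^+ 2 + z (true, true) t ^+ 2 = 1) ->
  (forall c, z (false, c) a = z (false, c) b) ->
  z (true, false) a * z (true, true) b = z (true, true) a * z (true, false) b ->
  forall i t, z i (t + (a - b)) = z i t.
Proof.
move=> zf unit pos par.
pose l := z (true, false) a * z (true, false) b + z (true, true) a * z (true, true) b.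
have u1 := unit a; have u2 := unit b.
have ca : z (true, false) a = l * z (true, false) b.
  rewrite -[LHS]mulr1 -u2 mulrDr /l mulrDl !expr2 [X in _ + X]mulrA par; ring.
have sa : z (true, true) a = l * z (true, true) b.
  rewrite -[LHS]mulr1 -u2 mulrDr /l mulrDl !expr2 [X in X + _]mulrA -par; ring.
have l2 : l ^+ 2 = 1 by rewrite -u1 ca sa !exprMn -mulrDr u2 mulr1.
have [l1|lN1] : l = 1 \/ l = -1.
  by move/eqP: l2; rewrite sqrf_eq1 => /orP[] /eqP; [left|right].
  move=> i t; have e := flow_unique (flow_shift a zf) (flow_shift b zf).
  have := e _ i (t - b); rewrite addrAC -addrA subrK => -> //.
  move=> [[] []] /=; rewrite !add0r ?pos//.
    by rewrite sa l1 mul1r.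
  by rewrite ca l1 mul1r.
(* If the velocities at [a] and [b] are opposite, the flow forward from [a] is the reversed flow
   from [b]. Both arrive at the midpoint [m] at the same moment, so the velocity there equals its
   own opposite and vanishes, against unit speed. *)
exfalso; have e := flow_unique (flow_shift a zf) (flow_shift (- b) (flow_reversed zf)).
have h i : z i ((b - a) / 2 + a) = reversed z i ((b - a) / 2 - b).
  apply: e => -[[] []]; rewrite /reversed /= !add0r opprK ?pos//.
    by rewrite sa lN1 mulN1r.
  by rewrite ca lN1 mulN1r.
pose m := (a + b) / 2.
have e1 : (b - a) / 2 + a = m by rewrite /m; field.
have e2 : - ((b - a) / 2 - b) = m by rewrite /m; field.
have h1 := h (true, false); have h2 := h (true, true).
rewrite /reversed /= e1 e2 in h1 h2.
have := unit m; have -> : z (true, false) m = 0 by lra.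
have -> : z (true, true) m = 0 by lra.
by rewrite expr0n addr0 => /eqP; rewrite eq_sym oner_eq0.
Qed.

End Period.

(** * Abresch-Langer curves from periodic flows *)

Section Regularity.
Context (R : realType).
Implicit Types a b : R -> R.

(** Regularity expressed by the existence of derivative functions on the line, which is easily
    closed under products; [plane_curve_Ck] translates it into [Ck_on]. *)
Fixpoint Ck_real (k : nat) (a : R -> R) : Prop :=
  if k is k'.+1 then
    exists a', (forall t : R, is_derive t 1 a (a' t)) /\ Ck_real k' a'
  else continuous a.

Lemma Ck_realS k a : Ck_real k.+1 a -> Ck_real k a.
Proof.
elim: k a => [|k IH] a [a' [da Ca']]; last by exists a'; split=> //; exact: IH.
by move=> t; exact: is_derive_continuous (da t).
Qed.

Lemma Ck_realD k a b : Ck_real k a -> Ck_real k b -> Ck_real k (fun t => a t + b t).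
Proof.
elim: k a b => [|k IH] a b.
  by move=> ca cb t; exact: (cvgD (ca t) (cb t)).
move=> [a' [da Ca]] [b' [db Cb]]; exists (fun t => a' t + b' t); split; last exact: IH.
by move=> t; exact: is_deriveD (da t) (db t).
Qed.

Lemma Ck_realM k a b : Ck_real k a -> Ck_real k b -> Ck_real k (fun t => a t * b t).
Proof.
elim: k a b => [|k IH] a b.
  by move=> ca cb t; exact: (cvgM (ca t) (cb t)).
move=> Ca0 Cb0; have [Ca1 Cb1] := (Ck_realS Ca0, Ck_realS Cb0).
case: Ca0 => a' [da Ca]; case: Cb0 => b' [db Cb].
exists (fun t => a t * b' t + b t * a' t); split.
  by move=> t; exact: is_deriveM (da t) (db t).
by apply: Ck_realD; exact: IH.
Qed.

Lemma Ck_real_cst k (e : R) : Ck_real k (fun=> e).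
Proof.
elim: k e => [|k IH] e; first by move=> t; exact: cvg_cst.
by exists (fun=> 0); split; [move=> t; exact: is_derive_cst|exact: IH].
Qed.

Lemma is_derive_dilate (T t a' : R) a : is_derive (T * t) 1 a a' ->
  is_derive t 1 (fun u => a (T * u)) (T * a').
Proof.
move=> da; have ds : is_derive t 1 (fun u => T * u) T.
  by have := is_deriveZ T (is_derive_id t (1 : R)); rewrite [_ *: 1]mulr1.
by rewrite mulrC; exact: (@is_derive1_comp R a (fun u => T * u) t _ _ da ds).
Qed.

Lemma Ck_real_dilate k (T : R) a : Ck_real k a -> Ck_real k (fun t => T * a t) /\
  Ck_real k (fun t => a (T * t)).
Proof.
move=> Ca; split; first by apply: Ck_realM Ca; exact: Ck_real_cst.
elim: k a Ca => [|k IH] a.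
  move=> ca t; apply: (@continuous_comp _ _ _ (fun t => T * t) a); last exact: ca.
  exact: (cvgM (cvg_cst T) cvg_id).
move=> [a' [da Ca]]; exists (fun t => T * a' (T * t)); split.
  by move=> t; exact: is_derive_dilate.
by apply: Ck_realM (IH _ Ca); exact: Ck_real_cst.
Qed.

Definition plane_curve a b (t : R) : 'rV[R]_2 := a t *: delta_mx 0 0 + b t *: delta_mx 0 1.

Definition plane_curve_mx a b (v : 'rV[R]_1) : 'rV[R]_2 := plane_curve a b (v 0 0).

Lemma differentiable_coord0 a (v : 'rV[R]_1) (a' : R) : is_derive (v 0 0) 1 a a' ->
  differentiable (fun v : 'rV[R]_1 => a (v 0 0)) v.
Proof.
move=> [da _]; apply: (@differentiable_comp _ _ _ _ (fun v : 'rV[R]_1 => v 0 0) a).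
  exact: differentiable_coord.
exact/derivable1_diffP.
Qed.

Lemma derive_coord0 a (v w : 'rV[R]_1) (a' : R) : is_derive (v 0 0) 1 a a' ->
  'D_w (fun v : 'rV[R]_1 => a (v 0 0)) v = w 0 0 * a'.
Proof.
move=> da; have [d e] := da.
pose cd (v : 'rV[R]_1) := v 0 0.
have dc : differentiable cd v by exact: differentiable_coord.
have dcw : 'd cd v w = w 0 0.
  rewrite -deriveE//; have dv : derivable (@id 'rV[R]_1) v w by exact: derivable_id.
  by have := derive_mx dv; rewrite derive_id => /matrixP/(_ 0 0); rewrite mxE => <-.
rewrite deriveE; last exact: differentiable_coord0 da.
rewrite (@diff_comp _ _ _ _ cd a) //=; last exact/derivable1_diffP.
by rewrite dcw deriv1E// derive1E e.
Qed.

Lemma plane_curve_differentiable a b (v : 'rV[R]_1) (a' b' : R) :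
  is_derive (v 0 0) 1 a a' -> is_derive (v 0 0) 1 b b' ->
  differentiable (plane_curve_mx a b) v.
Proof.
move=> da db; apply: differentiableD; apply: differentiableZl.
  exact: differentiable_coord0 da.
exact: differentiable_coord0 db.
Qed.

Lemma plane_curve_derive a b (v w : 'rV[R]_1) (a' b' : R) :
  is_derive (v 0 0) 1 a a' -> is_derive (v 0 0) 1 b b' ->
  'D_w (plane_curve_mx a b) v =
    (w 0 0 * a') *: delta_mx 0 0 + (w 0 0 * b') *: delta_mx 0 1.
Proof.
move=> da db; have dfa := differentiable_coord0 da; have dfb := differentiable_coord0 db.
rewrite -(derive_coord0 w da) -(derive_coord0 w db).
pose e0 : 'rV[R]_2 := delta_mx 0 0; pose e1 : 'rV[R]_2 := delta_mx 0 1.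
have E1 : 'D_w (fun v : 'rV[R]_1 => a (v 0 0) *: e0) v = 'D_w (fun v : 'rV[R]_1 => a (v 0 0)) v *: e0.
  rewrite !deriveE//; last exact: differentiableZl.
  exact: (congr1 (fun h => h w) (diffZl e0 dfa)).
have E2 : 'D_w (fun v : 'rV[R]_1 => b (v 0 0) *: e1) v = 'D_w (fun v : 'rV[R]_1 => b (v 0 0)) v *: e1.
  rewrite !deriveE//; last exact: differentiableZl.
  exact: (congr1 (fun h => h w) (diffZl e1 dfb)).
have d1 : derivable (fun v : 'rV[R]_1 => a (v 0 0) *: e0) v w.
  by apply: diff_derivable; exact: differentiableZl.
have d2 : derivable (fun v : 'rV[R]_1 => b (v 0 0) *: e1) v w.
  by apply: diff_derivable; exact: differentiableZl.
exact: (etrans (deriveD d1 d2) (congr2 +%R E1 E2)).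
Qed.

(** One order of regularity is given away so that continuity in the base case also comes from a
    derivative. *)
Lemma plane_curve_Ck k a b : Ck_real k.+1 a -> Ck_real k.+1 b ->
  Ck_on k [set: 'rV[R]_1] (plane_curve_mx a b).
Proof.
elim: k a b => [|k IH] a b [a' [da Ca]] [b' [db Cb]].
  move=> v _; apply: differentiable_continuous.
  exact: plane_curve_differentiable (da _) (db _).
split; first by move=> v _; exact: plane_curve_differentiable (da _) (db _).
move=> w; have -> : 'D_w (plane_curve_mx a b) =
    plane_curve_mx (fun t => w 0 0 * a' t) (fun t => w 0 0 * b' t).
  by apply/funext => v; rewrite (plane_curve_derive w (da _) (db _)).
by apply: IH; apply: (Ck_real_dilate _ _).1.
Qed.

End Regularity.

Section ShrinkingCurve.
Context (R : realType) (x y c s : R -> R) (T : R).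
Let k t := x t * s t - y t * c t.
Hypothesis dx : forall t : R, is_derive t 1 x (c t).
Hypothesis dy : forall t : R, is_derive t 1 y (s t).
Hypothesis dc : forall t : R, is_derive t 1 c (- s t * k t).
Hypothesis ds : forall t : R, is_derive t 1 s (c t * k t).
Hypothesis unit_speed : forall t, c t ^+ 2 + s t ^+ 2 = 1.
Hypothesis T_neq0 : T != 0.

(** The derivatives of the four functions are polynomials in the functions themselves, so regularity
    bootstraps. *)
Lemma shrinking_curve_Ck n : [/\ Ck_real n x, Ck_real n y, Ck_real n c & Ck_real n s].
Proof.
elim: n => [|n [Cx Cy Cc Cs]].
  by split=> t; [exact: is_derive_continuous (dx t)|exact: is_derive_continuous (dy t)|
    exact: is_derive_continuous (dc t)|exact: is_derive_continuous (ds t)].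
have CN a : Ck_real n a -> Ck_real n (fun t => - a t).
  move=> Ca; have -> : (fun t => - a t) = (fun t => -1 * a t).
    by apply/funext => t; rewrite mulN1r.
  by apply: Ck_realM Ca; exact: Ck_real_cst.
have Ck : Ck_real n k.
  by apply: Ck_realD; [exact: Ck_realM|apply: CN; exact: Ck_realM].
split.
- by exists c.
- by exists s.
- by exists (fun t => - s t * k t); split => //; apply: Ck_realM => //; exact: CN.
- by exists (fun t => c t * k t); split => //; exact: Ck_realM.
Qed.

Lemma shrinking_curve_self_shrinker :
  self_shrinker_on [set: 'rV[R]_1]
    (plane_curve_mx (fun t => x (T * t)) (fun t => y (T * t))).
Proof.
have dX (t : R) := is_derive_dilate (dx (T * t)).
have dY (t : R) := is_derive_dilate (dy (T * t)).
have dX2 (t : R) : is_derive t 1 (fun t => T * c (T * t)) (T * (T * (- s (T * t) * k (T * t)))).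
  have h := is_deriveZ T (is_derive_dilate (dc (T * t))).
  exact: h.
have dY2 (t : R) : is_derive t 1 (fun t => T * s (T * t)) (T * (T * (c (T * t) * k (T * t)))).
  have h := is_deriveZ T (is_derive_dilate (ds (T * t))).
  exact: h.
set f := plane_curve_mx _ _.
have df v : differentiable f v by exact: plane_curve_differentiable (dX _) (dY _).
have Df v w : 'D_w f v = (w 0 0 * (T * c (T * v 0 0))) *: delta_mx 0 0 +
                         (w 0 0 * (T * s (T * v 0 0))) *: delta_mx 0 1.
  exact: plane_curve_derive (dX _) (dY _).
pose e : 'rV[R]_1 := delta_mx 0 0.
have e1 : e 0 0 = 1 by rewrite mxE.
have De v : 'D_e f v = plane_curve_mx (fun t => T * c (T * t)) (fun t => T * s (T * t)) v.
  by rewrite Df e1 !mul1r.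
have D2 v : 'D_e ('D_e f) v = (T * (T * (- s (T * v 0 0) * k (T * v 0 0)))) *: delta_mx 0 0 +
    (T * (T * (c (T * v 0 0) * k (T * v 0 0)))) *: delta_mx 0 1.
  have -> : 'D_e f = plane_curve_mx (fun t => T * c (T * t)) (fun t => T * s (T * t)).
    by apply/funext => u; exact: De.
  by rewrite (plane_curve_derive e (dX2 _) (dY2 _)) e1 !mul1r.
have norm2 a b : dotv (a *: delta_mx 0 0 + b *: delta_mx 0 1 : 'rV[R]_2)
    (a *: delta_mx 0 0 + b *: delta_mx 0 1) = a ^+ 2 + b ^+ 2.
  by rewrite /dotv !big_ord_recl big_ord0 !mxE /=; ring.
have DD v : dotv ('D_e f v) ('D_e f v) = T ^+ 2.
  by rewrite De norm2 -[RHS]mulr1 -(unit_speed (T * v 0 0)); ring.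
split.
  split.
    move=> n; apply: plane_curve_Ck; apply: (Ck_real_dilate _ _).2.
      by have [] := shrinking_curve_Ck n.+1.
    by have [] := shrinking_curve_Ck n.+1.
  move=> v _ w w' dE.
  have DE : 'D_w f v = 'D_w' f v by rewrite (deriveE w (df v)) (deriveE w' (df v)).
  have lin u : 'D_u f v = u 0 0 *: 'D_e f v.
    by rewrite Df De scalerDr !scalerA.
  move: DE; rewrite (lin w) (lin w') => /eqP; rewrite -subr_eq0 -scalerBl scaler_eq0 => /orP[|/eqP h].
    by rewrite subr_eq0 => /eqP h; apply/rowP => j; rewrite (ord1 j).
  have := DD v; rewrite h dotv0l => /esym/eqP; rewrite expf_eq0 /= => /eqP T0.
  by move: T_neq0; rewrite T0 eqxx.
move=> v _; rewrite /mean_curvature !big_ord1.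
have g00 : first_fundamental_form f v = (T ^+ 2)%:M.
  rewrite [LHS]mx11_scalar; congr (_ %:M).
  rewrite -(DD v) -(row_jacobian 0 (df v)) /first_fundamental_form mxE.
  by apply: eq_bigr => j _; rewrite !mxE.
rewrite g00 invmx_scalar mxE eqxx mulr1n /second_fundamental_form.
rewrite /normal_part scalemxAl; apply/eqP; rewrite -subr_eq0 opprK -mulmxDl; apply/eqP.
apply/normal_projection_eq0.
(* The acceleration [k (-s, c)] cancels the normal part of the position, leaving its component along
   the unit tangent [(c, s)]; since ['D_e f] is [T] times that tangent, a division by [T]
   appears. *)
have -> : (T ^+ 2)^-1 *: 'D_(delta_mx 0 ord0) ('D_(delta_mx 0 ord0) f) v + f v =
    ((x (T * v 0 0) * c (T * v 0 0) + y (T * v 0 0) * s (T * v 0 0)) / T) *: 'D_e f v.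
  have -> : f v = x (T * v 0 0) *: delta_mx 0 0 + y (T * v 0 0) *: delta_mx 0 1 by [].
  rewrite [X in _ *: X](D2 v) De /plane_curve_mx /plane_curve.
  rewrite !scalerDr !scalerA addrACA -!scalerDl /k.
  move: (unit_speed (T * v 0 0)) => u1.
  move: (x _) (y _) (c _) (s _) u1 => x' y' c' s' u1.
  congr (_ *: _ + _ *: _).
    transitivity (x' * (c' ^+ 2 + s' ^+ 2) - s' * (x' * s' - y' * c')); last by field.
    by rewrite u1 mulr1; field.
  transitivity (y' * (c' ^+ 2 + s' ^+ 2) + c' * (x' * s' - y' * c')); last by field.
  by rewrite u1 mulr1; field.
by rewrite -row_jacobian//; apply: scalemx_sub; exact: row_sub.
Qed.

Lemma shrinking_curve_abresch_langer :
  (forall t, x (t + T) = x t) -> (forall t, y (t + T) = y t) ->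
  abresch_langer_curve ((fun t => Complex (x t) (y t)) @` [set: R]).
Proof.
move=> px py; exists (plane_curve (fun t => x (T * t)) (fun t => y (T * t))); split.
- by move=> t; rewrite /plane_curve mulrDr mulr1 px py.
- exact: shrinking_curve_self_shrinker.
have pc t : C_of_R2 (plane_curve (fun t => x (T * t)) (fun t => y (T * t)) t) =
    Complex (x (T * t)) (y (T * t)).
  by rewrite /C_of_R2 /plane_curve !mxE /= !mulr1 !mulr0 addr0 add0r.
apply/seteqP; split => [_ [t _ <-]|_ [t _ <-]] /=.
  by exists (t / T) => //=; rewrite pc mulrC divfK.
by exists (T * t) => //; rewrite pc.
Qed.

End ShrinkingCurve.

(** * The product decomposition *)

Lemma parallel_to_common (R : idomainType) (d1 d2 c s c' s' : R) :
  (d1 != 0) || (d2 != 0) -> d1 * s = d2 * c -> d1 * s' = d2 * c' -> c * s' = s * c'.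
Proof.
move=> d0 h h'; apply/eqP; rewrite -subr_eq0; case/orP: d0 => d0.
  rewrite -(mulrI_eq0 _ (mulfI d0)); have -> : d1 * (c * s' - s * c') = c * (d1 * s') - (d1 * s) * c' by ring.
  by rewrite h h'; apply/eqP; ring.
rewrite -(mulrI_eq0 _ (mulfI d0)); have -> : d2 * (c * s' - s * c') = (d2 * c) * s' - s * (d2 * c') by ring.
by rewrite -h -h'; apply/eqP; ring.
Qed.

Section FactorCurve.
Context (R : realType) (S : topologicalType) (A : set (chart R 2 S)) (F : S -> 'rV[R]_4).
Hypothesis A_atlas : smooth_atlas A.
Hypothesis F_shrinker : self_shrinker A F.
Context (b1 b2 b3 b4 : 'rV[R]_4) (r : R).
Hypothesis frame : parseval_frame b1 b2 b3 b4.
Hypothesis rank34 : rank1_on_atlas A F b3 b4.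
Hypothesis r_gt0 : 0 < r.
Hypothesis F_bounded : components_bounded F r b1 b2.

Let F_immersion c : A c -> immersion_on (chart_cod c) (F \o chart_inv c).
Proof. by move=> /F_shrinker []. Qed.

Lemma tangent_component_neq0 s : exists2 w, tangent A F s w &
  (dotv w b1 != 0) || (dotv w b2 != 0).
Proof.
have [c Ac cs] := A_atlas.1 s; have cx := chart_map_cod cs.
have sm := (F_immersion Ac).1; have df := smooth_differentiable sm cx.
have [v v0 [v3 v4]] := rank1_kernel df (fun v w => rank34 Ac v w cx).
have pos := factor_derivative_neq0 (F_shrinker Ac) frame cx v0 v3 v4.
move: pos; have [_ ->] := component_derive b1 sm v cx.
have [_ ->] := component_derive b2 sm v cx => pos.
exists ('D_v (F \o chart_inv c) (chart_map c s)).
  by exists c; split => //; exists v.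
rewrite -negb_and; apply/negP => /andP[/eqP h1 /eqP h2].
by rewrite h1 h2 expr0n addr0 ltxx in pos.
Qed.

Lemma factor_abresch_langer (z : phase -> R -> R) (N : R) : shrinker_flow r z ->
  (forall s, exists2 t, `|t| <= N & tangent_match A F b1 b2 z s t) ->
  (forall t, exists s, tangent_match A F b1 b2 z s t) ->
  abresch_langer_curve ((fun s => Complex (dotv (F s) b1) (dotv (F s) b2)) @` [set: S]).
Proof.
move=> zf cover onto.
(* Every time is realised by a point of the surface, so unit speed and the bound [r] hold along the
   whole trajectory and all truncations disappear. *)
have unit t : z (true, false) t ^+ 2 + z (true, true) t ^+ 2 = 1.
  by have [s []] := onto t.
have small u v : u ^+ 2 + v ^+ 2 = 1 -> `|u| <= 1 :> R.
  move=> h; have h2 : u ^+ 2 <= 1 by rewrite -h lerDl sqr_ge0.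
  by rewrite -(@expr_le1 _ 2)// real_normK// num_real.
have c1 t : clip 1 (z (true, false) t) = z (true, false) t.
  by apply: clip_id; exact: small (unit t).
have s1 t : clip 1 (z (true, true) t) = z (true, true) t.
  by apply: clip_id; apply: small (z (true, false) t) _; rewrite addrC.
have xr t : clip r (z (false, false) t) = z (false, false) t.
  by apply: clip_id; have [s [<- _ _ _]] := onto t; exact: (F_bounded s).1.
have yr t : clip r (z (false, true) t) = z (false, true) t.
  by apply: clip_id; have [s [_ <- _ _]] := onto t; exact: (F_bounded s).2.
(* The time [N + 1] lies beyond the interval that already covers the surface, so the point reached
   then is also matched at some [t <= N]; the difference of the two times is a nonzero period. *)
have [s ms] := onto (N + 1); have [t tN mt] := cover s.
pose T := N + 1 - t.
have T0 : T != 0.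
  rewrite gt_eqF// subr_gt0; apply: (@le_lt_trans _ _ N); last by rewrite ltrDl.
  exact: le_trans (ler_norm t) tN.
have [p1 q1 _ k1] := ms; have [p2 q2 _ k2] := mt.
have pos e : z (false, e) (N + 1) = z (false, e) t.
  by case: e; rewrite -?p1 -?q1 -?p2 -?q2.
have [w Tw w0] := tangent_component_neq0 s.
have par := parallel_to_common w0 (k1 w Tw) (k2 w Tw).
have period := flow_periodic r_gt0 zf unit pos par.
have -> : (fun s => Complex (dotv (F s) b1) (dotv (F s) b2)) @` [set: S] =
    (fun t => Complex (z (false, false) t) (z (false, true) t)) @` [set: R].
  apply/seteqP; split => [_ [s' _ <-]|_ [t' _ <-]].
    by have [t' _ [-> -> _ _]] := cover s'; exists t'.
  by have [s' [<- <- _ _]] := onto t'; exists s'.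
apply: (@shrinking_curve_abresch_langer R (z (false, false)) (z (false, true))
  (z (true, false)) (z (true, true)) T) => // u.
- by have := zf (false, false) u; rewrite /shrinker_field c1.
- by have := zf (false, true) u; rewrite /shrinker_field s1.
- by have := zf (true, false) u; rewrite /shrinker_field c1 s1 xr yr.
- by have := zf (true, true) u; rewrite /shrinker_field c1 s1 xr yr.
Qed.

End FactorCurve.

(** * Boundedness of the immersion and the unitary matrix of the frame *)

Lemma compact_image_bounded (R : realType) n (S : topologicalType) (F : S -> 'rV[R]_n) :
  compact [set: S] -> continuous F -> exists2 M, 0 < M & forall s, `|F s| <= M.
Proof.
move=> cS cF; have cov : near_covering [set: S] by apply/compact_near_coveringP.
have H s0 : [set: S] s0 -> \forall s' \near s0 & M \near +oo%R, `|F s'| <= M.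
  move=> _; exists ([set s | `|F s0 - F s| <= 1], [set M | `|F s0| + 1 <= M]).
    split; first exact: near_dist_le (cF s0) ltr01.
    by apply: nbhs_pinfty_ge; exact: num_real.
  move=> [s M] [/= h hM]; apply: le_trans hM.
  rewrite -[F s](subKr (F s0)); apply: le_trans (ler_normB _ _) _.
  by rewrite lerD2l.
have hN := cov R _ (fun M s => `|F s| <= M) _ H.
have [M [M0 hM]] := filter_ex (filterI (nbhs_pinfty_gt (num_real (0 : R))) (hN _)).
by exists M => // s; exact: hM.
Qed.

Lemma components_bound (R : realType) n (S : topologicalType) (F : S -> 'rV[R]_n)
    (bs : seq 'rV[R]_n) : compact [set: S] -> continuous F ->
  exists2 r, 0 < r & forall s b, b \in bs -> `|dotv (F s) b| <= r.
Proof.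
move=> cS cF; have [M M0 FM] := compact_image_bounded cS cF.
elim: bs => [|b bs [r r0 IH]]; first by exists 1.
have [K K0 hK] := mulmx_bounded b^T.
exists (K * M + r); first by rewrite addr_gt0// mulr_gt0.
move=> s b'; rewrite inE => /orP[/eqP ->|/(IH s) h].
  apply: (@le_trans _ _ (K * M)); last by rewrite lerDl ltW.
  rewrite dotvE; apply: le_trans (norm_coord_le _ _ _) _; apply: le_trans (hK _) _.
  by rewrite ler_pM2l.
by apply: le_trans h _; rewrite lerDr mulr_ge0// ltW.
Qed.

Lemma complex_mulD (R : rcfType) (a b c d a' b' c' d' : R) :
  Complex a b * Complex c d + Complex a' b' * Complex c' d' =
  Complex (a * c - b * d + (a' * c' - b' * d')) (a * d + b * c + (a' * d' + b' * c')).
Proof. by []. Qed.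

Section HermitianMatrix.
Context (R : realType).

(* The rows are the conjugates of m and n, so that the k-th coordinate of
   [G z] is the Hermitian product of the k-th frame vector with z. *)
Definition hermitian_mx (m n : 'rV[R]_4) : 'M[R[i]]_2 :=
  \matrix_(i, j) let b := if i == 0 then m else n in
    if j == 0 then Complex (b 0 0) (- b 0 1) else Complex (b 0 2) (- b 0 3).

Lemma ord2P (P : 'I_2 -> Prop) : P 0 -> P 1 -> forall i, P i.
Proof.
move=> P0 P1 i; case: (unliftP 0 i) => [i' ->|->] //.
by rewrite (ord1 i') (_ : lift 0 0 = 1)//; exact: val_inj.
Qed.

Lemma big_ord2 (V : nmodType) (f : 'I_2 -> V) : \sum_(i < 2) f i = f 0 + f 1.
Proof.
by rewrite !big_ord_recl big_ord0 addr0; congr (f _ + f _); exact: val_inj.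
Qed.

Lemma hermitian_mx_mul m n v k :
  (hermitian_mx m n *m C2_of_R4 v) k 0 =
  Complex (dotv v (if k == 0 then m else n)) (dotv v (imul (if k == 0 then m else n))).
Proof.
rewrite mxE big_ord2 !mxE /= complex_mulD; set b := if _ then _ else _.
by rewrite dotv_imul dotv4; congr Complex; ring.
Qed.

Lemma hermitian_mx_unitary n : dotv n n = 1 ->
  hermitian_mx (hermitian_complement n) n \is unitarymx.
Proof.
rewrite dotv4 => n1; apply/unitarymxP/matrixP.
have conjE (a b : R) : Num.conj (Complex a b) = Complex a (- b) by [].
elim/ord2P; elim/ord2P.
all: rewrite mxE big_ord2 !mxE /= !conjE !opprK complex_mulD.
all: apply/eqP; rewrite eq_complex /=; apply/andP; split; apply/eqP.
all: rewrite ?mxE /= -?n1; ring.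
Qed.

End HermitianMatrix.

Theorem theorem1p2 (R : realType) (S : topologicalType)
    (A : set (chart R 2 S)) (F : S -> 'rV[R]_4) (P : set 'rV[R]_4) :
  closed_connected_manifold A ->
  self_shrinker A F ->
  lagrangian A F ->
  symmetric_wrt_hyperplane P (range F) ->
  exists G : 'M[R[i]]_2, G \is unitarymx /\
  exists Gamma1 Gamma2 : set R[i],
    [/\ abresch_langer_curve Gamma1, abresch_langer_curve Gamma2 &
        (fun s => G *m C2_of_R4 (F s)) @` [set: S] = cprod Gamma1 Gamma2].
Proof.
move=> [atlas _ cS conS [s0 _]] shr lagr [nu [a [nu0 _ refl]]].
have imm c : A c -> immersion_on (chart_cod c) (F \o chart_inv c) by move=> /shr [].
have sym s : exists q, F q = F s *m reflection_mx nu + (2 * a / dotv nu nu) *: nu.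
  have : range F (reflection nu a (F s)) by rewrite -refl; exists (F s) => //; exists s.
  by move=> [q _ e]; exists q; rewrite e reflection_affine.
have [n n1 reflE] := unit_normal nu0.
pose m := hermitian_complement n.
have iso x y : kahler_form (x *m reflection_mx nu) (y *m reflection_mx nu) = 0 ->
    kahler_form (x - (2 * dotv x n) *: n) (y - (2 * dotv y n) *: n) = 0.
  by rewrite !reflE.
have comp_split c y u v : A c -> chart_cod c y ->
    dotv ('D_u (F \o chart_inv c) y) m * dotv ('D_v (F \o chart_inv c) y) (imul m) =
    dotv ('D_v (F \o chart_inv c) y) m * dotv ('D_u (F \o chart_inv c) y) (imul m) /\
    dotv ('D_u (F \o chart_inv c) y) n * dotv ('D_v (F \o chart_inv c) y) (imul n) =
    dotv ('D_v (F \o chart_inv c) y) n * dotv ('D_u (F \o chart_inv c) y) (imul n).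
  move=> Ac cy; have dy := chart_inv_dom cy.
  (* [reflected_isotropic] differentiates at [chart_map c (chart_inv c y)]; abstracting that point
     allows it to be replaced by [y]. *)
  have key x : chart_map c (chart_inv c y) = x ->
      kahler_form ('D_u (F \o chart_inv c) x *m reflection_mx nu)
                  ('D_v (F \o chart_inv c) x *m reflection_mx nu) = 0.
    by move=> <-; have h := reflected_isotropic atlas cS imm lagr sym u v Ac dy; exact: h.
  have df := immersion_differentiable imm Ac cy.
  have h1 := lagr c Ac y cy u v; rewrite -(deriveE u df) -(deriveE v df) in h1.
  exact: isotropic_split n1 h1 (iso _ _ (key y (chart_invK cy))).
have rk1 : rank1_on_atlas A F m (imul m).
  by move=> c Ac y u v cy; exact: (comp_split c y u v Ac cy).1.
have rk2 : rank1_on_atlas A F n (imul n).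
  by move=> c Ac y u v cy; exact: (comp_split c y u v Ac cy).2.
have frame := hermitian_frame_parseval n1; rewrite -/m in frame.
have [r r0 Fr] := components_bound [:: m; imul m; n; imul n] cS (immersion_continuous atlas imm).
have bd1 : components_bounded F r m (imul m).
  by move=> s; split; apply: Fr; rewrite !inE eqxx ?orbT.
have bd2 : components_bounded F r n (imul n).
  by move=> s; split; apply: Fr; rewrite !inE eqxx ?orbT.
have [z [zf [N1 cov1]]] := tangent_match_everywhere atlas shr frame rk1 rk2 r0 bd1 cS conS s0.
have [w [wf [N2 cov2]]] := tangent_match_everywhere atlas shr (parseval_frame_swap frame)
  rk2 rk1 r0 bd2 cS conS s0.
have all t u : exists s, tangent_match A F m (imul m) z s t /\
    tangent_match A F n (imul n) w s u.
  have [t0 _ mt0] := cov1 s0; have [u0 _ mu0] := cov2 s0.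
  have h := product_match_all atlas cS shr frame rk1 rk2 r0 bd1 bd2 zf wf mt0 mu0 t u.
  exact: h.
exists (hermitian_mx m n); split; first exact: hermitian_mx_unitary.
exists ((fun s => Complex (dotv (F s) m) (dotv (F s) (imul m))) @` [set: S]),
       ((fun s => Complex (dotv (F s) n) (dotv (F s) (imul n))) @` [set: S]); split.
- have onto t : exists s, tangent_match A F m (imul m) z s t.
    by have [s [ms _]] := all t 0; exists s.
  have h := factor_abresch_langer atlas shr frame rk2 r0 bd1 zf cov1 onto.
  exact: h.
- have onto u : exists s, tangent_match A F n (imul n) w s u.
    by have [s [_ ms]] := all 0 u; exists s.
  have h := factor_abresch_langer atlas shr (parseval_frame_swap frame) rk1 r0 bd2 wf cov2 onto.
  exact: h.
have G0 v : (hermitian_mx m n *m C2_of_R4 v) 0 0 = Complex (dotv v m) (dotv v (imul m)).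
  exact: hermitian_mx_mul.
have G1 v : (hermitian_mx m n *m C2_of_R4 v) 1 0 = Complex (dotv v n) (dotv v (imul n)).
  exact: hermitian_mx_mul.
apply/seteqP; split => [_ [s _ <-]|Z [[s1 _ e1] [s2 _ e2]]].
  by split; [exists s; rewrite ?G0|exists s; rewrite ?G1].
(* The two coordinates of [Z] come from different points of the surface; only the times at which
   these are matched are kept, and [all] supplies one point with both times. *)
have [t _ [p1 q1 _ _]] := cov1 s1; have [u _ [p2 q2 _ _]] := cov2 s2.
have [s [[p1' q1' _ _] [p2' q2' _ _]]] := all t u.
exists s => //; apply/matrixP => i j; rewrite (ord1 j); elim/ord2P: i.
  by rewrite G0 -e1 p1 q1 p1' q1'.
by rewrite G1 -e2 p2 q2 p2' q2'.
Qed.
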